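(* Let $q>2$ be an integer and let $(p_n)$ be a sequence in $[0,1]$ such that $$p_n=\frac{\beta_c}{n}+\frac{\gamma}{n^2}+o\left(\frac1{n^2}\right)$$ for some $\gamma\in\mathbb{R}$, where $\beta_c=2\frac{q-1}{q-2}\log(q-1)$. Then, with a probability that converges, as $n\to\infty$, to $$\frac{1}{1+\frac1q\left(\frac{1-\beta_c/q}{1-\beta_c/(q(q-1))}\right)^{\frac{2-q}{2}}\exp\left(-\left(\frac{\beta_c^2}{4}+\frac{\gamma}{2}\right)\frac{(q-2)^2}{q(q-1)}\right)},$$ the random-cluster graph $G(n,p_n,q)$ contains a giant component.
   Context: The random-cluster model $G(n,p,q)$ on the complete graph $K_n$ with $n$ vertices: a random configuration $\omega\in\{0,1\}^{E(K_n)}$, where $\omega$ has probability proportional to $$\prod_{e\in E(K_n)}p^{\omega_e}(1-p)^{1-\omega_e}\;q^{C(\omega)},$$ with $C(\omega)$ the number of connected components of the subgraph of $K_n$ with all $n$ vertices and edge set $\{e\in E(K_n):\omega_e=1\}$. A giant component is a connected component of this subgraph of size $\Theta(n)$; precisely, the claim is that for every sufficiently small fixed $\delta>0$ the probability that the subgraph has a connected component with at least $\delta n$ vertices converges to the displayed limit. *)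

(* Defs.v *)
From HB Require Import structures.
From mathcomp Require Import all_boot all_order all_algebra.
From mathcomp Require Import all_classical all_reals all_analysis.
Set Implicit Arguments.
Unset Strict Implicit.
Unset Printing Implicit Defensive.
Import Order.TTheory GRing.Theory Num.Theory.
Import numFieldNormedType.Exports.
Local Open Scope ring_scope.

Definition edge (n : nat) : finType := {e : {set 'I_n} | #|e| == 2}.

Definition config (n : nat) : finType := {ffun edge n -> bool}.

(* Every edge has exactly two endpoints, so this relation is irreflexive. *)
Definition adj (n : nat) (w : config n) : rel 'I_n :=
  fun x y => [exists e : edge n, w e && (val e == [set x; y])].

Definition ncomp (n : nat) (w : config n) : nat := n_comp (adj w) 'I_n.

Definition rc_weight (R : realType) (n : nat) (p q : R) (w : config n) : R :=
  (\prod_(e : edge n) (p ^+ w e * (1 - p) ^+ (1 - w e))) * q ^+ ncomp w.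

Definition rc_partition (R : realType) (n : nat) (p q : R) : R :=
  \sum_(w : config n) rc_weight p q w.

Definition rc_prob (R : realType) (n : nat) (p q : R) (A : {set config n}) : R :=
  \sum_(w in A) (rc_weight p q w / rc_partition n p q).

Definition has_component_ge (R : realType) (n : nat) (delta : R) :
    {set config n} :=
  [set w : config n |
    [exists x : 'I_n, delta * n%:R <= #|connect (adj w) x|%:R]].

Definition beta_c (R : realType) (q : nat) : R :=
  2 * ((q%:R - 1) / (q%:R - 2)) * ln (q%:R - 1).

Definition giant_limit (R : realType) (q : nat) (gamma : R) : R :=
  let b : R := beta_c R q in
  let Q : R := q%:R in
  1 / (1 + 1 / Q
           * ((1 - b / Q) / (1 - b / (Q * (Q - 1)))) `^ ((2 - Q) / 2)
           * expR (- ((b ^+ 2 / 4 + gamma / 2)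
                      * ((Q - 2) ^+ 2 / (Q * (Q - 1)))))).

(* Main.v *)
Require Import Defs.
From HB Require Import structures.
From mathcomp Require Import all_boot all_order all_algebra.
From mathcomp Require Import all_classical all_reals all_analysis.
From mathcomp Require Import perm ring lra zify.
Set Implicit Arguments.
Unset Strict Implicit.
Unset Printing Implicit Defensive.
Import Order.TTheory GRing.Theory Num.Theory.
Import numFieldNormedType.Exports.
Local Open Scope classical_set_scope.
Local Open Scope ring_scope.

(** Write q = r + 1, let s = - ln (1 - p), and replace the random-cluster model
by its Edwards-Sokal coupling: a configuration together with one of q colours
on every connected component.  Summing out the colours gives back the
random-cluster weight ([es_sum_colours]), while summing out the configuration
leaves the mean-field Potts weight exp (- (s / 2) (n^2 - sum_c k_c^2)) of the
colour counts k_1, ..., k_q ([es_marginal]).  Probabilities of colour counts are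
thus explicit finite sums, and the existence of a giant component is read off
from the counts.

The weight of all colourings with frequencies x is at most V exp (- n D(x)),
where V <= Z and D is the relative entropy of x to the uniform law minus a
multiple of its squared distance to it ([type_tail]).  At beta_c the minimum of D is 0
and it is reached at exactly q + 1 points ([phase_gap]): the disordered point,
with all frequencies 1/q, and for each colour j the ordered point with
frequency 1 - 1/q at j and 1/(q (q - 1)) elsewhere.  This is proved by
induction on the number of colours: the chain rule of entropy splits off the
largest frequency a, and the resulting function of a alone is invariant under
a <-> 1 - a, so that it vanishes at 1/q and at 1 - 1/q.  All other (bad) colour
counts are exponentially unlikely ([bad_small]).

The ordered phase is the phase with a giant component.  Interchanging two
colours on a union of components preserves the coupling.  If a disordered
configuration had a giant component, recolouring it would produce a bad colour
count ([giant_swap_bad]).  If a configuration ordered at j had no giant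
component, recolouring the components one after the other would move the
frequency of j from 1 - 1/q to 1/(q (q - 1)) in steps too small to jump over
the bad values in between ([ord_swap_bad]).  By symmetry of the colours, the
probability of a giant component is q y + o(1), and x + q y = 1 + o(1), where x
and y are the probabilities of the disordered phase and of one ordered phase
([finite_bounds]).

It remains to compute lim y / x.  Both x and y are sums over the size k of
one colour class, with k close to n/q and to n - n/q.  The substitution
k -> n - k matches them term by term: the matched terms differ only by the
factor Z_r(k) / Z_r(n - k), where Z_r is the Potts partition function with
r colours ([mirror_bound]).  That factor converges uniformly ([ratio_limit]),
since at these subcritical temperatures Z_r(m) / V_r(m) tends to
(1 - th / r)^(-(r - 1) / 2) as s m -> th ([W_lim]).  The latter is an
induction on r in which one colour is integrated out against the binomial law
tilted by a Gaussian factor; comparing with the untilted law, of total mass 1,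
determines the constant in front of the Gaussian sums. *)

(** * Derivatives and logarithmic inequalities *)

Lemma gt0_derive_lt (R : realType) (f df : R -> R) (a b : R) : a < b ->
  (forall x, a <= x <= b -> is_derive x 1 f (df x)) ->
  (forall x, a < x < b -> 0 < df x) -> f a < f b.
Proof.
move=> ab dfE df0; have [||c] := MVT ab (df := df) (f := f).
- by move=> x; rewrite in_itv/= => /andP[ax xb]; apply: dfE; rewrite !ltW.
- apply: derivable_within_continuous => x; rewrite in_itv/= => xab.
  exact: (@ex_derive _ _ _ _ _ _ _ (dfE _ xab)).
rewrite in_itv/= => cab E; rewrite -subr_gt0 E mulr_gt0 ?df0// subr_gt0//.
Qed.

(** The arguments are explicit abstractions, so that the derivative of a concrete
expression can be computed by matching on its head operation. *)
Section DeriveFun.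
Variables (R : realType).
Implicit Types (f g : R -> R) (x : R).

Lemma derD f g x df dg : is_derive x 1 f df -> is_derive x 1 g dg ->
  is_derive x 1 (fun y => f y + g y) (df + dg).
Proof. by move=> ? ?; exact: is_deriveD. Qed.

Lemma derB f g x df dg : is_derive x 1 f df -> is_derive x 1 g dg ->
  is_derive x 1 (fun y => f y - g y) (df - dg).
Proof. by move=> ? ?; exact: is_deriveB. Qed.

Lemma derN f x df : is_derive x 1 f df -> is_derive x 1 (fun y => - f y) (- df).
Proof. by move=> ?; exact: is_deriveN. Qed.

Lemma derM f g x df dg : is_derive x 1 f df -> is_derive x 1 g dg ->
  is_derive x 1 (fun y => f y * g y) (f x * dg + g x * df).
Proof. by move=> ? ?; exact: is_deriveM. Qed.

Lemma derX2 f x df : is_derive x 1 f df ->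
  is_derive x 1 (fun y => f y ^+ 2) (2 * f x * df).
Proof.
move=> d; have -> : 2 * f x * df = f x * df + f x * df by ring.
exact: derM.
Qed.

Lemma derV f x df : f x != 0 -> is_derive x 1 f df ->
  is_derive x 1 (fun y => (f y)^-1) (- (f x) ^- 2 * df).
Proof. by move=> ? ?; exact: is_deriveV. Qed.

Lemma der_cst (c : R) x : is_derive x 1 (fun=> c) 0.
Proof. exact: is_derive_cst. Qed.

Lemma der_id x : is_derive x 1 (fun y : R => y) 1.
Proof. exact: is_derive_id. Qed.

Lemma der_ln f x df : 0 < f x -> is_derive x 1 f df ->
  is_derive x 1 (fun y => ln (f y)) (df / f x).
Proof.
move=> fx0 dfx; have dl := is_derive1_ln fx0.
by have := @is_derive1_comp R (@ln R) f x _ _ dl dfx; rewrite mulrC.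
Qed.

Lemma der_expR f x df : is_derive x 1 f df ->
  is_derive x 1 (fun y => expR (f y)) (df * expR (f x)).
Proof.
move=> dfx; have dl := is_derive_expR (f x).
by have := @is_derive1_comp R (@expR R) f x _ _ dl dfx; rewrite mulrC.
Qed.
End DeriveFun.

(** Reduces a derivative goal with an evaluable value to the nonvanishing or
positivity conditions of its inverses and logarithms. *)
Ltac der := lazymatch goal with
  | |- is_derive _ _ (fun=> ?c) _ => exact: der_cst
  | |- is_derive _ _ (fun y => y) _ => exact: der_id
  | |- is_derive _ _ (fun y => GRing.add (@?f y) (GRing.opp (@?g y))) _ =>
      eapply (@derB _ f g); der
  | |- is_derive _ _ (fun y => GRing.add (@?f y) (@?g y)) _ =>
      eapply (@derD _ f g); der
  | |- is_derive _ _ (fun y => GRing.opp (@?f y)) _ => eapply (@derN _ f); der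
  | |- is_derive _ _ (fun y => GRing.mul (@?f y) (@?g y)) _ =>
      eapply (@derM _ f g); der
  | |- is_derive _ _ (fun y => GRing.inv (@?f y)) _ =>
      eapply (@derV _ f); [|der]
  | |- is_derive _ _ (fun y => ln (@?f y)) _ => eapply (@der_ln _ f); [|der]
  | |- is_derive _ _ (fun y => expR (@?f y)) _ => eapply (@der_expR _ f); der
  | |- is_derive _ _ (fun y => GRing.exp (@?f y) 2) _ => eapply (@derX2 _ f); der
  | _ => idtac
  end.

(** With t = e^x this is x < sinh x; the difference of both sides has
derivative (1 - 1/t)^2. *)
Lemma ln_lt_sinh (R : realType) (t : R) : 1 < t -> 2 * ln t < t - t^-1.
Proof.
move=> t1.
have := @gt0_derive_lt R (fun x => (x - x^-1) - 2 * ln x)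
  (fun x => (1 - x^-1) ^+ 2) 1 t t1.
rewrite ln1 invr1 subrr mulr0 subrr subr_gt0; apply.
- move=> x /andP[x1 _]; have x0 : 0 < x by lra.
  have xn0 : x != 0 by lra.
  by apply: is_derive_eq; [der => // | field].
- by move=> x /andP[x1 _]; rewrite exprn_even_gt0//= subr_eq0 eq_sym invr_eq1; lra.
Qed.

(** With t = e^(2x) this is tanh x < x. *)
Lemma ln_gt_tanh (R : realType) (t : R) : 1 < t -> 2 * (t - 1) / (t + 1) < ln t.
Proof.
move=> t1.
have := @gt0_derive_lt R (fun x => ln x - 2 * (x - 1) / (x + 1))
  (fun x => (x - 1) ^+ 2 / (x * (x + 1) ^+ 2)) 1 t t1.
rewrite ln1 subrr mulr0 mul0r subrr subr_gt0; apply.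
- move=> x /andP[x1 _]; have x0 : 0 < x by lra.
  have xn0 : x != 0 by lra.
  have xn1 : x + 1 != 0 by lra.
  by apply: is_derive_eq; [der => // | field; apply/andP].
- move=> x /andP[x1 _]; apply: divr_gt0; first by rewrite exprn_even_gt0//=; lra.
  by rewrite mulr_gt0 ?exprn_gt0//; lra.
Qed.

(** With t = e^(2x) the function is 2 x / tanh x.  It decides the sign of the
derivative of the deficit of one frequency. *)
Lemma ln_over_tanh_incr (R : realType) (t u : R) : 1 < t -> t < u ->
  ln t * ((t + 1) / (t - 1)) < ln u * ((u + 1) / (u - 1)).
Proof.
move=> t1 tu.
apply: (@gt0_derive_lt R (fun x => ln x * ((x + 1) / (x - 1)))
  (fun x => ((x - x^-1) - 2 * ln x) / (x - 1) ^+ 2)) => //.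
- move=> x /andP[x1 _]; have x0 : 0 < x by lra.
  have xn0 : x != 0 by lra.
  have xn1 : x - 1 != 0 by lra.
  by apply: is_derive_eq; [der => // | field; apply/andP].
- move=> x /andP[x1 _]; apply: divr_gt0; last by rewrite exprn_even_gt0//=; lra.
  by rewrite subr_gt0 ln_lt_sinh//; lra.
Qed.

(** With t = e^x the function is x / (2 sinh x).  Up to a factor 2 its value at
t = r - 1 is beta_c / r, whence the monotonicity in [beta_crit_ratio]. *)
Lemma ln_over_sinh_decr (R : realType) (t u : R) : 1 < t -> t < u ->
  ln u / (u - u^-1) < ln t / (t - t^-1).
Proof.
move=> t1 tu; rewrite -ltrN2.
have H (x : R) : t <= x -> x - x^-1 != 0.
  by move=> tx; have := @ln_lt_sinh R x; have := @ln_gt0 R x; lra.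
apply: (@gt0_derive_lt R (fun x => - (ln x / (x - x^-1)))
  (fun x => (ln (x ^+ 2) - 2 * (x ^+ 2 - 1) / (x ^+ 2 + 1))
     * ((x ^+ 2 + 1) / (2 * x ^+ 2)) / (x - x^-1) ^+ 2)) => //.
- move=> x /andP[x1 _]; have x0 : 0 < x by lra.
  have xn0 : x != 0 by lra.
  have xn1 := H x x1.
  have xx1 : x * x - 1 != 0 by nra.
  have xx2 : x ^+ 2 + 1 != 0 by rewrite expr2; nra.
  apply: is_derive_eq; [der => // | rewrite lnXn//].
  by field; rewrite xn0 xx1 xx2.
- move=> x /andP[x1 _]; apply: divr_gt0; last first.
    by rewrite exprn_even_gt0//= H// ltW.
  have := @ln_gt_tanh R (x ^+ 2); set A := ln _ => ?.
  apply: mulr_gt0; first by rewrite subr_gt0; nra.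
  by rewrite divr_gt0//; nra.
Qed.

(** * Deficit of one frequency *)

Section BinaryDeficit.
Variables (R : realType) (t phi : R).
Hypotheses (t1 : 1 <= t) (phiE : ln t = phi * ((t - 1) / (t + 1))).

(** Relative entropy of (a, 1 - a) to (1/(t + 1), t/(t + 1)) minus a quadratic
term.  It is the part of the deficit of a vector of t + 1 frequencies that
depends on one frequency a.  The hypothesis on [phi] is criticality: it makes
the values at 1/(t + 1) and t/(t + 1) equal. *)
Definition binary_deficit (a : R) : R :=
  a * ln (a * (t + 1)) + (1 - a) * ln ((1 - a) * ((t + 1) / t))
  - phi * (a - (t + 1)^-1) ^+ 2.

Let t0 : 0 < t. Proof. exact: lt_le_trans t1. Qed.
Let tn0 : t != 0. Proof. by rewrite gt_eqF. Qed.
Let tp0 : 0 < t + 1. Proof. exact: ltr_wpDr. Qed.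
Let tn1 : t + 1 != 0. Proof. by rewrite gt_eqF. Qed.
Let tp1 : t + 1 \is Num.pos. Proof. by rewrite posrE. Qed.
Let tp : t \is Num.pos. Proof. by rewrite posrE. Qed.

(** Holds at a = 0 as well, which is why entropies are written with products
inside the logarithm. *)
Lemma xlnM (a c : R) : 0 <= a -> 0 < c -> a * ln (a * c) = a * ln a + a * ln c.
Proof.
rewrite le_eqVlt => /predU1P[<-|a0] c0; first by rewrite !mul0r addr0.
by rewrite lnM ?posrE// mulrDr.
Qed.

Lemma binary_deficitE (a : R) : 0 <= a <= 1 -> binary_deficit a =
  a * ln a + (1 - a) * ln (1 - a) + ln (t + 1) - (1 - a) * ln t
  - phi * (a - (t + 1)^-1) ^+ 2.
Proof.
move=> /andP[a0 a1]; rewrite /binary_deficit !xlnM//; try lra.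
  by rewrite ln_div//; ring.
by apply: divr_gt0 => //; lra.
Qed.

(** Under a <-> 1 - a the entropy part changes by (1 - 2 a) ln t and the quadratic
part by phi (1 - 2 a) (t - 1) / (t + 1), and these agree at criticality. *)
Lemma binary_deficit_sym (a : R) : 0 <= a <= 1 -> binary_deficit (1 - a) = binary_deficit a.
Proof.
move=> a01; rewrite !binary_deficitE//; last lra.
by rewrite subKr phiE; field.
Qed.

Lemma binary_deficit_top : binary_deficit (t / (t + 1)) = 0.
Proof.
have E1 : 1 - t / (t + 1) = (t + 1)^-1 by field.
rewrite /binary_deficit E1.
have -> : t / (t + 1) * (t + 1) = t by field.
have -> : (t + 1)^-1 * ((t + 1) / t) = t^-1 by field; apply/andP.
by rewrite lnV// phiE; field.
Qed.

(** The derivative is a function of the odds u = a / (1 - a), which makes its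
sign visible from the monotonicity of ln u (u + 1) / (u - 1). *)
Definition binary_deficit_deriv (a : R) : R :=
  let u := a / (1 - a) in
  ln u - phi * ((u - 1) / (u + 1)).

Lemma der_binary_deficit (a : R) : 0 < a < 1 ->
  is_derive a 1 binary_deficit (binary_deficit_deriv a).
Proof.
move=> /andP[a0 a1].
have an0 : a != 0 by lra.
have an1 : 1 - a != 0 by lra.
have a0' : 0 < a * (t + 1) by apply: mulr_gt0 => //; lra.
have a1' : 0 < (1 - a) * ((t + 1) / t).
  by apply: mulr_gt0; [lra|apply: divr_gt0 => //; lra].
rewrite /binary_deficit; apply: is_derive_eq.
  by der => //; rewrite ?a0' ?a1'.
have a1p : 0 < 1 - a by lra.
have -> : ln (a * (t + 1)) = ln a + ln (t + 1) by rewrite lnM ?posrE.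
rewrite /binary_deficit_deriv ln_div ?posrE//.
have -> : ln ((1 - a) * ((t + 1) / t)) = ln (1 - a) + ln (t + 1) - ln t.
  rewrite lnM ?posrE//; [rewrite ln_div//; ring|].
  by apply: divr_gt0.
rewrite phiE; move: (ln a) (ln (t + 1)) (ln (1 - a)) => A B C.
have -> : (a / (1 - a) - 1) / (a / (1 - a) + 1) = 2 * a - 1.
  by field; rewrite an1 addrC subrK oner_neq0.
by field; rewrite tn1 tn0 an1.
Qed.

(** The logarithm is not differentiable at the endpoint a = 1, so the monotonicity
up to 1 does not extend there by the mean value theorem.  The slope tends to
+oo, hence points close enough to 1 lie below the endpoint value. *)
Lemma binary_deficit1_ge (c : R) : c < 1 ->
  exists b, [/\ c < b, b < 1 & binary_deficit b <= binary_deficit 1].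
Proof.
move=> c1.
(* At b = 1 - 1/m the entropy falls below its value at 1 by about (ln m) / m; the
   quadratic term varies by at most 2 phi / m, which ln m >= 2 phi compensates. *)
pose m := Num.max (expR (2 * phi)) (Num.max 2 ((1 - c)^-1 + 1)).
have m1 : expR (2 * phi) <= m by rewrite /m le_max lexx.
have m2 : 2 <= m by rewrite /m !le_max lexx !orbT.
have m3 : (1 - c)^-1 + 1 <= m by rewrite /m !le_max lexx !orbT.
have m0 : 0 < m by lra.
pose b := 1 - m^-1.
have mi : 0 < m^-1 by rewrite invr_gt0.
have mi2 : m^-1 <= 2^-1 by rewrite lef_pV2 ?posrE//; lra.
have mc : m^-1 < 1 - c.
  by rewrite invf_plt ?posrE ?subr_gt0//; lra.
exists b; split; [rewrite /b; lra|rewrite /b; lra|].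
rewrite !binary_deficitE; [|lra|rewrite /b; lra].
rewrite ln1 subrr !mul0r mul1r.
have -> : 1 - b = m^-1 by rewrite /b; ring.
rewrite lnV ?posrE//.
have lb : ln b <= 0 by apply: ln_le0; rewrite /b; lra.
have lm : 2 * phi <= ln m.
  by rewrite -[2 * phi]expRK ler_ln ?posrE ?expR_gt0.
have blb : b * ln b <= 0 by rewrite /b in lb *; nra.
have lt0 : 0 <= ln t by apply: ln_ge0.
have phi0 : t = 1 \/ 0 <= phi.
  move: (t1); rewrite le_eqVlt => /predU1P[<-|t1']; [by left|right].
  have c0 : 0 < (t - 1) / (t + 1) by apply: divr_gt0 => //; rewrite subr_gt0.
  by rewrite -(pmulr_lge0 _ c0) -phiE.
have ti : 0 < (t + 1)^-1 <= 2^-1.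
  by rewrite invr_gt0 tp0 lef_pV2 ?posrE//; move: t1; lra.
set P := (t + 1)^-1 in ti *.
suff : phi * ((1 - P) ^+ 2 - (b - P) ^+ 2) <= m^-1 * (ln t + ln m).
  move: blb; rewrite /b; nra.
have -> : (1 - P) ^+ 2 - (b - P) ^+ 2 = m^-1 * (2 - m^-1 - 2 * P).
  by rewrite /b; ring.
rewrite mulrCA ler_pM2l//.
have lm0 : 0 <= ln m by apply: ln_ge0; lra.
case: phi0 => [E|p0]; last by nra.
have -> : P = 2^-1 by rewrite /P E; congr (_^-1); ring.
case: (leP 0 phi) => ?; nra.
Qed.

Lemma odds_gt1 (x : R) : 2^-1 < x < 1 -> 1 < x / (1 - x).
Proof. by move=> /andP[x0 x1]; rewrite ltr_pdivlMr; lra. Qed.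

Lemma binary_deficit_ltP (sgn : R) a b : a < b -> 0 < a -> b < 1 ->
  (forall x, a < x < b -> 0 < sgn * binary_deficit_deriv x) ->
  sgn * binary_deficit a < sgn * binary_deficit b.
Proof.
move=> ab a0 b1 H.
apply: (@gt0_derive_lt R (fun x => sgn * binary_deficit x)
  (fun x => sgn * binary_deficit_deriv x)) => //.
move=> x /andP[ax xb]; have := @der_binary_deficit x; set D := binary_deficit_deriv x => d.
have x01 : 0 < x < 1 by lra.
by apply: is_derive_eq (derM (der_cst sgn x) (d x01)) _; ring.
Qed.

End BinaryDeficit.

Lemma binary_deficit_half (R : realType) (phi : R) : binary_deficit 1 phi 2^-1 = 0.
Proof.
by rewrite -(@binary_deficit_top R 1 phi); [congr binary_deficit; field|lra|rewrite ln1; field].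
Qed.

(** For t = 1 the two zeros merge at 1/2 and phi = 2. *)
Lemma binary_deficit2_ge0 (R : realType) (a : R) : 0 <= a <= 1 -> 0 <= binary_deficit 1 2 a.
Proof.
have E1 : ln 1 = 2 * ((1 - 1) / (1 + 1)) :> R by rewrite ln1; field.
have H (x : R) : 2^-1 <= x < 1 -> 0 <= binary_deficit 1 2 x.
  move=> /andP[]; rewrite le_eqVlt => /predU1P[<- _|x0 x1].
    by rewrite binary_deficit_half.
  rewrite -[X in X <= _](@binary_deficit_half R 2) ltW//.
  rewrite -[X in X < _]mul1r -[X in _ < X]mul1r.
  apply: (binary_deficit_ltP (lexx _) E1) => // => /=.
  move=> y /andP[y0 y1]; rewrite mul1r /binary_deficit_deriv.
  have := @odds_gt1 R y; set u := y / (1 - y) => u1; rewrite subr_gt0 mulrA.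
  by apply: ln_gt_tanh; apply: u1; lra.
have H' (x : R) : 2^-1 <= x <= 1 -> 0 <= binary_deficit 1 2 x.
  move=> /andP[x0]; rewrite le_eqVlt => /predU1P[->|x1]; last by apply: H; rewrite x0.
  have [|b [b0 b1]] := @binary_deficit1_ge R 1 2 (lexx _) E1 (2^-1); first by lra.
  by apply: le_trans; apply: H; rewrite b1 ltW.
move=> a01; have [?|?] := leP 2^-1 a; first by apply: H'; lra.
by rewrite -(binary_deficit_sym (lexx _) E1) //; apply: H'; lra.
Qed.

Section Asym.
Variables (R : realType) (t : R).
Hypothesis t1 : 1 < t.
Let phi := ln t * ((t + 1) / (t - 1)).
Let h := binary_deficit t phi.
Let B := t / (t + 1).

Let phiE : ln t = phi * ((t - 1) / (t + 1)).
Proof. by rewrite /phi; move: t1; move: (ln t) => l ?; field; lra. Qed.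

Let t1' : 1 <= t. Proof. exact: ltW. Qed.

Let B_bd : 2^-1 < B < 1.
Proof. by rewrite /B ltr_pdivlMr ?ltr_pdivrMr; move: t1; lra. Qed.

Let dec (a b : R) : 2^-1 <= a -> a < b -> b <= B -> h b < h a.
Proof.
move=> a0 ab bB; have Bb := B_bd.
rewrite -ltrN2 -mulN1r -[X in _ < X]mulN1r.
apply: (binary_deficit_ltP t1' phiE) => //; try lra.
move=> x /andP[ax xb]; rewrite mulN1r oppr_gt0 /binary_deficit_deriv.
have u1 : 1 < x / (1 - x) by apply: odds_gt1; lra.
have ut : x / (1 - x) < t.
  rewrite ltr_pdivrMr; last lra.
  have : x < t / (t + 1) by apply: lt_le_trans bB.
  by rewrite ltr_pdivlMr; move: t1; lra.
have := ln_over_tanh_incr u1 ut; rewrite -/phi; set u := x / (1 - x) in u1 *.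
have c0 : 0 < (u - 1) / (u + 1) by apply: divr_gt0; lra.
have un1 : u - 1 != 0 by lra.
have un2 : u + 1 != 0 by lra.
rewrite subr_lt0 => lt; have -> : ln u = ln u * ((u + 1) / (u - 1)) * ((u - 1) / (u + 1)).
  by move: (ln u) => l; field; rewrite un1 un2.
by rewrite ltr_pM2r.
Qed.

Let inc (a b : R) : B <= a -> a < b -> b < 1 -> h a < h b.
Proof.
move=> aB ab b1; have Bb := B_bd.
rewrite -[X in X < _]mul1r -[X in _ < X]mul1r.
apply: (binary_deficit_ltP t1' phiE) => //; try lra.
move=> x /andP[ax xb]; rewrite mul1r /binary_deficit_deriv.
have u1 : 1 < x / (1 - x) by apply: odds_gt1; lra.
have ut : t < x / (1 - x).
  rewrite ltr_pdivlMr; last lra.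
  have : t / (t + 1) < x by apply: le_lt_trans ax.
  by rewrite ltr_pdivrMr; move: t1; lra.
have := ln_over_tanh_incr t1 ut; rewrite -/phi; set u := x / (1 - x) in u1 *.
have c0 : 0 < (u - 1) / (u + 1) by apply: divr_gt0; lra.
have un1 : u - 1 != 0 by lra.
have un2 : u + 1 != 0 by lra.
rewrite subr_gt0 => lt; have -> : ln u = ln u * ((u + 1) / (u - 1)) * ((u - 1) / (u + 1)).
  by move: (ln u) => l; field; rewrite un1 un2.
by rewrite ltr_pM2r.
Qed.

Let h_top : h B = 0. Proof. exact: binary_deficit_top. Qed.

(** On [1/2, 1] the function decreases down to its zero t/(t + 1) and increases
afterwards. *)
Lemma binary_deficit_gap_half (e : R) : 0 < e -> exists2 d, 0 < d &
  forall a, 2^-1 <= a <= 1 -> e <= `|a - B| -> d <= h a.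
Proof.
move=> e0; have Bb := B_bd.
pose e' := Num.min e (Num.min ((B - 2^-1) / 2) ((1 - B) / 2)).
have e'0 : 0 < e' by rewrite /e' !lt_min e0/=; apply/andP; split; lra.
have e'1 : e' <= (B - 2^-1) / 2 by rewrite /e' !ge_min lexx orbT.
have e'2 : e' <= (1 - B) / 2 by rewrite /e' !ge_min lexx !orbT.
have e'3 : e' <= e by rewrite /e' !ge_min lexx.
have hm : 0 < h (B - e') by rewrite -h_top; apply: dec; lra.
have hp : 0 < h (B + e') by rewrite -h_top; apply: inc; lra.
exists (Num.min (h (B - e')) (h (B + e'))); first by rewrite lt_min hm.
have P a : B + e' <= a -> a < 1 -> h (B + e') <= h a.
  rewrite le_eqVlt => /predU1P[->//|? ?]; apply/ltW/inc; lra.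
move=> a /andP[a0 a1] ea; rewrite ge_min.
have [aB|aB] := lerP B a; last first.
  rewrite ler0_norm in ea; last lra.
  apply/orP; left; have : a <= B - e' by lra.
  by rewrite le_eqVlt => /predU1P[->//|?]; apply/ltW/dec; lra.
rewrite ger0_norm in ea; last lra.
apply/orP; right; move: a1; rewrite le_eqVlt => /predU1P[->|a1].
  have [|b [b0 b1]] := binary_deficit1_ge t1' phiE (c := B + e'); first lra.
  by apply: le_trans; apply: P; lra.
by apply: P => //; lra.
Qed.

(** The two zeros 1/(t + 1) and t/(t + 1) are exchanged by the symmetry, so the
bound on [1/2, 1] is enough. *)
Lemma binary_deficit_gap (e : R) : 0 < e -> exists2 d, 0 < d &
  forall a, 0 <= a <= 1 -> e <= `|a - (t + 1)^-1| -> e <= `|a - B| -> d <= h a.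
Proof.
move=> e0; have [d d0 H] := binary_deficit_gap_half e0.
exists d => // a a01 e1 e2; have [?|?] := lerP 2^-1 a; first by apply: H => //; lra.
rewrite /h -(binary_deficit_sym t1' phiE)//; apply: H; first lra.
have -> : 1 - a - B = - (a - (t + 1)^-1) by rewrite /B; field; move: t1; lra.
by rewrite normrN.
Qed.

Lemma binary_deficit_ge0 (a : R) : 0 <= a <= 1 -> 0 <= h a.
Proof.
move=> a01.
have [->|aB] := eqVneq a B; first by rewrite h_top.
have [->|aP] := eqVneq a (t + 1)^-1.
  rewrite /h -(binary_deficit_sym t1' phiE).
    have -> : 1 - (t + 1)^-1 = B by rewrite /B; field; move: t1; lra.
    by rewrite -/h h_top.
  by rewrite invr_ge0 invf_le1; move: t1; lra.
have [|d d0 H] := @binary_deficit_gap (Num.min `|a - (t + 1)^-1| `|a - B|).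
  by rewrite lt_min !normr_gt0 !subr_eq0 aP.
by apply: ltW; apply: lt_le_trans d0 (H _ a01 _ _); rewrite ge_min lexx ?orbT.
Qed.
End Asym.

(** * The entropy inequality at the critical temperature *)

(** For r <= 2 the transition of the mean-field Potts model is of second order and
sits at 2.  The same value at r = 1 keeps [beta_crit_ratio] valid from the start of
the induction on the number of colours. *)
Definition beta_crit (R : realType) (r : nat) : R :=
  if (r <= 2)%N then 2 else beta_c R r.

Section Critical.
Variable R : realType.

Lemma beta_crit_gt0 r : 0 < beta_crit R r.
Proof.
rewrite /beta_crit /beta_c; case: leqP => // r3.
have r3' : 3 <= r%:R :> R by rewrite ler_nat.
apply: mulr_gt0; last by apply: ln_gt0; lra.
by rewrite mulr_gt0//; apply: divr_gt0; lra.
Qed.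

Lemma beta_critE r : (2 < r)%N -> let t := r%:R - 1 in
  beta_crit R r = r%:R * (2 * (ln t / (t - t^-1))).
Proof.
move=> r3 t; have r3' : 3 <= r%:R :> R by rewrite ler_nat.
rewrite /beta_crit leqNgt r3/= /beta_c -/t; move: (ln t) => l; rewrite /t.
have H : (r%:R - 1) * (r%:R - 1) - 1 != 0 :> R by rewrite gt_eqF//; nra.
by field; rewrite H; lra.
Qed.

Lemma beta_crit_lt r : (2 < r)%N -> beta_crit R r < r%:R.
Proof.
move=> r3; rewrite beta_critE//; have r3' : 3 <= r%:R :> R by rewrite ler_nat.
set t := r%:R - 1; have t1 : 1 < t by rewrite /t; lra.
have tt : 0 < t - t^-1 by have := ln_lt_sinh t1; have := ln_gt0 t1; lra.
rewrite -[ltRHS]mulr1 ltr_pM2l; last lra.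
by rewrite mulrA ltr_pdivrMr// mul1r ln_lt_sinh.
Qed.

Lemma beta_crit_le r : (1 < r)%N -> beta_crit R r <= r%:R.
Proof.
by rewrite leq_eqVlt => /predU1P[<-//|/beta_crit_lt/ltW].
Qed.

(** beta_c / r is strictly decreasing.  This is what makes the r remaining
colours subcritical once the largest colour class has been removed. *)
Lemma beta_crit_ratio r : (0 < r)%N -> r%:R * beta_crit R r.+1 < r.+1%:R * beta_crit R r.
Proof.
(* For r = 1 both values are 2; for r = 2 the claim is ln 2 < 3/4. *)
case: r => // -[|[|r]] _; first by rewrite /beta_crit/=; lra.
  rewrite beta_critE// (_ : beta_crit R 2 = 2)//.
  have -> : 3 - 1 = 2 :> R by ring.
  have := @ln_lt_sinh R 2 ltac:(lra).
  have -> : 2 - 2^-1 = 3 / 2 :> R by field.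
  by lra.
rewrite !beta_critE//.
set t := r.+3%:R - 1; set u := r.+4%:R - 1.
have tE : u = t + 1 by rewrite /u /t -natr1; ring.
have t1 : 1 < t by rewrite /t; have := ler0n R r; rewrite -!natr1; lra.
have := @ln_over_sinh_decr R t u t1; rewrite tE ltrDl ltr01 => /(_ isT).
rewrite mulrCA ltr_pM2l ?ltr0n//  ltr_pM2l ?ltr0n//; lra.
Qed.

Implicit Types (r : nat).

Definition mass r (y : 'I_r -> R) := \sum_i y i.
(** Homogeneous of degree 1 in [y]; for mass 1 it is the relative entropy to the
uniform law.  Homogeneity lets the same functional measure the frequencies that
remain when one coordinate is removed. *)
Definition rel_entropy r (y : 'I_r -> R) :=
  \sum_i y i * ln (r%:R * y i) - mass y * ln (mass y).
(** Squared distance from [y] to the constant vector of the same mass, see [spreadE]. *)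
Definition spread r (y : 'I_r -> R) := \sum_i y i ^+ 2 - mass y ^+ 2 / r%:R.

Lemma spreadE r (y : 'I_r -> R) : (0 < r)%N ->
  spread y = \sum_i (y i - mass y / r%:R) ^+ 2.
Proof.
move=> r0; have rn0 : r%:R != 0 :> R by rewrite pnatr_eq0 -lt0n.
have -> : \sum_i (y i - mass y / r%:R) ^+ 2 =
    \sum_i (y i ^+ 2 + (- 2 * (mass y / r%:R)) * y i + (mass y / r%:R) ^+ 2).
  by apply: eq_bigr => i _; ring.
rewrite !big_split/= -mulr_sumr -/(mass y) sumr_const card_ord /spread -mulr_natl.
by field.
Qed.

Lemma spread_ge0 r (y : 'I_r -> R) : (0 < r)%N -> 0 <= spread y.
Proof. by move=> r0; rewrite spreadE// sumr_ge0// => i _; rewrite sqr_ge0. Qed.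

Lemma spread_ge r (y : 'I_r -> R) i : (0 < r)%N ->
  (y i - mass y / r%:R) ^+ 2 <= spread y.
Proof.
move=> r0; rewrite spreadE// (bigD1 i)//= lerDl sumr_ge0// => j _.
by rewrite sqr_ge0.
Qed.

Lemma mass_lift r (x : 'I_r.+1 -> R) j :
  mass x = x j + mass (fun i => x (lift j i)).
Proof. by rewrite /mass (bigD1_ord j). Qed.

(** Chain rule of the relative entropy, together with Pythagoras for [spread]:
the coefficient r.+1 / r comes from the distance of (a, (1 - a)/r, ..., (1 - a)/r)
to the uniform vector. *)
Lemma deficit_split r (x : 'I_r.+1 -> R) j : (0 < r)%N -> (forall i, 0 <= x i) ->
  mass x = 1 -> let y := fun i => x (lift j i) in
  rel_entropy x - beta_crit R r.+1 / 2 * spread x =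
  binary_deficit r%:R (beta_crit R r.+1 / 2 * (r.+1%:R / r%:R)) (x j)
    + (rel_entropy y - beta_crit R r.+1 / 2 * spread y).
Proof.
move=> r0 x0 m1 y; have my : mass y = 1 - x j by rewrite -m1 (mass_lift x j) addrC addKr.
have rn0 : r%:R != 0 :> R by rewrite pnatr_eq0 -lt0n.
have rp : 0 < r%:R :> R by rewrite ltr0n.
have rp1 : 0 < 1 + r%:R :> R by lra.
have rn1 : 1 + r%:R != 0 :> R by rewrite gt_eqF.
have y0 i : 0 <= y i by apply: x0.
have my0 : 0 <= mass y by apply: sumr_ge0.
rewrite /rel_entropy m1 ln1 mulr0 subr0 (bigD1_ord j)//= -/(y _).
rewrite /spread m1 (bigD1_ord j)//=.
have -> : \sum_(i < r) x (lift j i) * ln (r.+1%:R * x (lift j i)) =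
   \sum_(i < r) y i * ln (r%:R * y i) + mass y * (ln (r.+1%:R) - ln r%:R).
  rewrite /mass mulr_suml -big_split/=; apply: eq_bigr => i _.
  by rewrite -/(y i) ![_%:R * y i]mulrC !xlnM ?ltr0n//; ring.
have -> : \sum_(i < r) x (lift j i) ^+ 2 = \sum_(i < r) y i ^+ 2 by [].
rewrite /binary_deficit -natr1 -my.
have -> : mass y * ln (mass y * ((r%:R + 1) / r%:R)) =
   mass y * ln (mass y) + mass y * (ln (r%:R + 1) - ln r%:R).
  have c0 : 0 < (r%:R + 1) / r%:R :> R by apply: divr_gt0; lra.
  by rewrite xlnM// ln_div ?posrE//; lra.
rewrite [(_ + 1) * x j]mulrC.
move: (\sum_(i < r) y i * _) (\sum_(i < r) y i ^+ 2) => S1 S2.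
rewrite my; field; rewrite rn0 addrC rn1//.
Qed.

(** For mass 1 this says that at the critical temperature energy never beats
entropy.  The homogeneous form applies to vectors of any mass. *)
Definition critical_ineq r := forall y : 'I_r -> R, (forall i, 0 <= y i) ->
  beta_crit R r / 2 * spread y <= mass y * rel_entropy y.

Lemma mass_eq0 r (y : 'I_r -> R) : (forall i, 0 <= y i) -> mass y = 0 ->
  forall i, y i = 0.
Proof.
move=> y0 /eqP; rewrite psumr_eq0// => /allP H i.
by apply/eqP/H; rewrite mem_index_enum.
Qed.

Lemma exists_max_coord r (x : 'I_r.+1 -> R) : mass x = 1 -> exists j,
  r.+1%:R^-1 <= x j /\ forall i, x i <= x j.
Proof.
move=> m1; pose j := [arg max_(i > ord0) x i]%O.
have jP i : x i <= x j by rewrite /j; case: arg_maxP => // k _; apply.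
exists j; split=> //; rewrite -[leLHS]mul1r ler_pdivrMr ?ltr0n// -[leLHS]m1.
rewrite mulr_natr -[in leRHS](card_ord r.+1) -sumr_const.
by apply: ler_sum => i _.
Qed.

(** Both sides of [critical_ineq] are homogeneous of degree 2. *)
Lemma critical_ineq_mass1 r : (forall y : 'I_r -> R, (forall i, 0 <= y i) -> mass y = 1 ->
  beta_crit R r / 2 * spread y <= rel_entropy y) -> critical_ineq r.
Proof.
move=> H y y0.
have : 0 <= mass y by apply: sumr_ge0.
rewrite le_eqVlt => /predU1P[M0|M0].
  have yi := mass_eq0 y0 (esym M0).
  rewrite /spread -M0 expr0n/= mul0r subr0 mul0r big1 ?mulr0// => i _.
  by rewrite yi expr0n.
have Mn : mass y != 0 by rewrite gt_eqF.
pose z i := y i / mass y.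
have z0 i : 0 <= z i by rewrite divr_ge0// ltW.
have mz : mass z = 1 by rewrite /mass -mulr_suml -/(mass y) divff.
have := H z z0 mz.
have -> : spread z = spread y / mass y ^+ 2.
  rewrite /spread mz (eq_bigr (fun i => y i ^+ 2 / mass y ^+ 2)); last first.
    by move=> i _; rewrite /z exprMn exprVn.
  rewrite -mulr_suml mulrBl; congr (_ - _).
  by rewrite expr1n [RHS]mulrAC divff// expf_neq0.
have -> : rel_entropy z = rel_entropy y / mass y.
  rewrite /rel_entropy mz ln1 mulr0 subr0 mulrBl [X in _ - X]mulrAC divff// mul1r.
  rewrite -[X in _ = _ - X]mul1r -[X in _ = _ - X * _]mz /mass !mulr_suml -sumrB.
  apply: eq_bigr => i _; rewrite -/(mass y) /z.
  case: (ltrgtP 0 (y i)) (y0 i) => // [yi _|<-]; last by rewrite !mul0r subr0.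
  rewrite mulrA ln_div ?posrE//; first by field.
  by rewrite mulr_gt0// ltr0n; apply: leq_ltn_trans (ltn_ord i).
move=> H1; have M2 : 0 <= mass y ^+ 2 by exact: sqr_ge0.
have := ler_wpM2r M2 H1.
have -> : beta_crit R r / 2 * (spread y / mass y ^+ 2) * mass y ^+ 2 =
    beta_crit R r / 2 * spread y.
  by field.
have -> // : rel_entropy y / mass y * mass y ^+ 2 = mass y * rel_entropy y by field.
Qed.

(** The remaining coordinates have mass at most r / r.+1, so the homogeneous
inequality for r colours bounds their entropy with a margin, by the strict
monotonicity of beta_c / r. *)
Lemma deficit_ge r (x : 'I_r.+1 -> R) j : (0 < r)%N -> critical_ineq r ->
  (forall i, 0 <= x i) -> mass x = 1 -> r.+1%:R^-1 <= x j ->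
  binary_deficit r%:R (beta_crit R r.+1 / 2 * (r.+1%:R / r%:R)) (x j) +
    (beta_crit R r - r%:R / r.+1%:R * beta_crit R r.+1) / 2
       * spread (fun i => x (lift j i))
  <= rel_entropy x - beta_crit R r.+1 / 2 * spread x.
Proof.
move=> r0 V x0 m1 xj; rewrite (deficit_split j)//= lerD2l.
set y := fun i => x (lift j i).
have rp : 0 < r%:R :> R by rewrite ltr0n.
have y0 i : 0 <= y i by apply: x0.
have my : mass y = 1 - x j by rewrite -m1 (mass_lift x j) addrC addKr.
have my0 : 0 <= mass y by apply: sumr_ge0.
have mr : mass y <= r%:R / r.+1%:R.
  rewrite my; have -> : r%:R / r.+1%:R = 1 - r.+1%:R^-1 :> R; last first.
    by rewrite lerD2l lerN2.
  by rewrite -natr1; field; lra.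
have S0 := spread_ge0 y r0.
have := V y y0; have b1 := beta_crit_gt0 r.+1.
have K0 : 0 < beta_crit R r - r%:R / r.+1%:R * beta_crit R r.+1.
  by rewrite mulrAC subr_gt0 ltr_pdivrMr ?ltr0n// [ltRHS]mulrC beta_crit_ratio.
move: mr K0; set c := r%:R / _ => mr K0.
have : mass y <= 1 by rewrite my; have := x0 j; lra.
rewrite le_eqVlt in my0; case/predU1P : my0 => [M0|my0].
  have yi := mass_eq0 y0 (esym M0).
  move=> _ _; rewrite /rel_entropy /spread -M0 mul0r subr0 expr0n/= mul0r subr0.
  rewrite !big1 ?mulr0 ?subr0//.
  - by move=> i _; rewrite yi mul0r.
  - by move=> i _; rewrite yi expr0n.
move: (mass y) (rel_entropy y) (spread y) (beta_crit R r) (beta_crit R r.+1) b1 mr my0 K0 S0.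
move=> M H S b b' b1 mr my0 K0 S0 M1 V'.
suff : M * ((b - c * b') / 2 * S) <= M * (H - b' / 2 * S) by rewrite ler_pM2l.
have A1 : M * ((b - c * b') / 2 * S) <= (b - c * b') / 2 * S.
  by apply: ler_piMl => //; apply: mulr_ge0 => //; lra.
have A2 : M * b' <= c * b' by rewrite ler_pM2r.
have A3 : M * b' * S <= c * b' * S by rewrite ler_wpM2r.
lra.
Qed.

Lemma binary_deficit_crit_ge0 r a : (0 < r)%N -> 0 <= a <= 1 ->
  0 <= binary_deficit r%:R (beta_crit R r.+1 / 2 * (r.+1%:R / r%:R)) a.
Proof.
case: r => // -[_|r _] a01.
  have -> : beta_crit R 2 / 2 * (2 / 1) = 2 by rewrite /beta_crit/=; field.
  exact: binary_deficit2_ge0.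
have r1 : 1 < r.+2%:R :> R by rewrite ltr1n.
have := binary_deficit_ge0 r1 a01; congr (_ <= binary_deficit _ _ _).
by rewrite /beta_crit/= /beta_c -[r.+3%:R]natr1 addrK; move: r1; move: (ln _) => l ?; field; lra.
Qed.

(** Induction on r, with the largest coordinate split off. *)
Lemma critical_ineq_holds r : (0 < r)%N -> critical_ineq r.
Proof.
elim: r => // -[_ _|r IH _].
  move=> y y0; rewrite /spread /rel_entropy /mass !big_ord1 mul1r divr1 subrr mulr0.
  by rewrite subrr mulr0.
apply: critical_ineq_mass1 => x x0 m1; have [j [xj _]] := exists_max_coord m1.
have /= := deficit_ge (ltn0Sn r) (IH isT) x0 m1 xj.
move=> D; rewrite -subr_ge0; apply: le_trans D; apply: addr_ge0.
  apply: binary_deficit_crit_ge0 => //; rewrite x0/= -m1 /mass (bigD1 j)//= lerDl.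
  exact: sumr_ge0.
apply: mulr_ge0; last exact: spread_ge0.
apply: divr_ge0 => //.
by rewrite mulrAC subr_ge0 ler_pdivrMr ?ltr0n// [leRHS]mulrC ltW// beta_crit_ratio.
Qed.

Definition near_disordered q (e : R) (x : 'I_q -> R) := forall i, `|x i - q%:R^-1| <= e.
Definition near_ordered q (e : R) (x : 'I_q -> R) (j : 'I_q) :=
  `|x j - (1 - q%:R^-1)| <= e /\
  forall i, i != j -> `|x i - (q%:R * (q%:R - 1))^-1| <= e.

(** A small deficit forces the largest frequency to be close to a zero of
[binary_deficit] and the remaining ones to be close to each other.  If the zero is
1/q, then no coordinate exceeds the mean by much, hence none is far below it. *)
Lemma phase_gap q (e : R) : (2 < q)%N -> 0 < e -> exists2 d, 0 < d &
  forall x : 'I_q -> R, (forall i, 0 <= x i) -> mass x = 1 ->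
  rel_entropy x - beta_crit R q / 2 * spread x < d ->
  near_disordered e x \/ exists j, near_ordered e x j.
Proof.
case: q => // r r2 e0.
have r3 : 2 <= r%:R :> R by rewrite ler_nat.
have r1 : 1 < r%:R :> R by lra.
have r0 : (0 < r)%N by case: r r2 {r3 r1}.
(* If all coordinates are at most 1/q + e1, each is at least 1/q - r e1. *)
pose e1 := e / (2 * r.+1%:R).
have e10 : 0 < e1 by rewrite /e1 divr_gt0// mulr_gt0// ltr0n.
have [d1 d10 H1] := binary_deficit_gap r1 e10.
pose k := (beta_crit R r - r%:R / r.+1%:R * beta_crit R r.+1) / 2.
have k0 : 0 < k.
  apply: divr_gt0 => //; rewrite mulrAC subr_gt0 ltr_pdivrMr ?ltr0n//.
  by rewrite [ltRHS]mulrC beta_crit_ratio.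
exists (Num.min d1 (k * e1 ^+ 2)); first by rewrite lt_min d10 mulr_gt0 ?exprn_gt0.
move=> x x0 m1; rewrite lt_min => /andP[L1 L2].
have [j [xj jmax]] := exists_max_coord m1.
have := deficit_ge r0 (critical_ineq_holds r0) x0 m1 xj; rewrite -/k.
set y := fun i => x (lift j i).
have my : mass y = 1 - x j by rewrite -m1 (mass_lift x j) addrC addKr.
have y0 i : 0 <= y i by apply: x0.
have my0 : 0 <= mass y by apply: sumr_ge0.
have a01 : 0 <= x j <= 1 by rewrite x0/=; lra.
have Hh := binary_deficit_crit_ge0 r0 a01; have S0 := spread_ge0 y r0.
have kS : 0 <= k * spread y by rewrite mulr_ge0// ltW.
have Hphi : beta_crit R r.+1 / 2 * (r.+1%:R / r%:R) = ln r%:R * ((r%:R + 1) / (r%:R - 1)) :> R.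
  rewrite /beta_crit leqNgt r2/= /beta_c -[r.+1%:R]natr1 addrK.
  by move: (ln _) => l; field; lra.
rewrite Hphi in Hh *; move: Hh (H1 _ a01); set h := binary_deficit _ _ _ => Hh H1' Hs.
have e1r : e1 * (2 * r.+1%:R) = e by rewrite /e1 divfK// gt_eqF// mulr_gt0// ltr0n.
have r4 : 3 <= r.+1%:R :> R by rewrite ler_nat.
have rS : r.+1%:R = r%:R + 1 :> R by rewrite natr1.
have e1e : e1 <= e by rewrite -e1r; nra.
have [C1|C1] := ltrP `|x j - r.+1%:R^-1| e1.
  have rP : r%:R * r.+1%:R^-1 = 1 - r.+1%:R^-1 :> R by rewrite rS; field; lra.
  left => i; move: C1 (jmax i) rP.
  have : x i + \sum_(k | k != i) x k = 1 by rewrite -m1 /mass [RHS](bigD1 i).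
  have : \sum_(k | k != i) x k <= \sum_(k < r.+1 | k != i) x j.
    by apply: ler_sum => l _; apply: jmax.
  rewrite sumr_const (_ : #|_| = r); last by rewrite cardC1 card_ord.
  have : r%:R * e1 <= e by rewrite -e1r rS; nra.
  rewrite -[_ *+ r]mulr_natl; move: (\sum_(k | _) _) (r.+1%:R^-1) r3 => S P r3.
  move=> re SP xS; rewrite ltr_norml ler_norml => /andP[C1 C2] xij rP.
  have : r%:R * x j <= r%:R * (P + e1) by rewrite ler_pM2l; lra.
  by move=> ?; apply/andP; split; lra.
have [C2|C2] := ltrP `|x j - r%:R / (r%:R + 1)| e1; last first.
  by rewrite rS in C1; have := H1' C1 C2; lra.
right; exists j; have B1 : 1 - r.+1%:R^-1 = r%:R / (r%:R + 1) :> R.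
  by rewrite rS; field; lra.
split; first by rewrite B1; apply: le_trans (ltW C2) _; nra.
move=> i ij; have [i' ->|] := unliftP j i; last by move=> E; rewrite E eqxx in ij.
have Sy : spread y < e1 ^+ 2 by rewrite -(ltr_pM2l k0); lra.
have := le_lt_trans (spread_ge y i' r0) Sy.
rewrite -[ltLHS]real_normK ?num_real// ltr_pXn2r// ?nnegrE ?normr_ge0//; last exact: ltW.
rewrite my -/(y i') => Y1.
have -> : y i' - (r.+1%:R * (r.+1%:R - 1))^-1 =
  (y i' - (1 - x j) / r%:R) + (r%:R / (r%:R + 1) - x j) / r%:R.
  by rewrite rS; field; lra.
apply: le_trans (ler_normD _ _) _.
have : `|(r%:R / (r%:R + 1) - x j) / r%:R| <= e1.
  rewrite normrM distrC; apply: le_trans (_ : `|x j - r%:R / (r%:R + 1)| <= _).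
    by apply: ler_piMr => //; rewrite ger0_norm ?invr_ge0 ?ler0n// invf_le1; lra.
  exact: ltW.
nra.
Qed.

End Critical.

(** * Colour counts and mean-field Potts weights *)

Section ColourCounts.
Variable R : realType.

Definition colour_count n r (s : {ffun 'I_n -> 'I_r}) (c : 'I_r) : nat :=
  (\sum_(v < n) (s v == c))%N.

Definition colouring_sum n r (F : ('I_r -> nat) -> R) : R :=
  \sum_(s : {ffun 'I_n -> 'I_r}) F (colour_count s).

Lemma colour_count_sum n r (s : {ffun 'I_n -> 'I_r}) : (\sum_c colour_count s c = n)%N.
Proof.
rewrite exchange_big/= -[RHS]card_ord -sum1_card; apply: eq_bigr => v _.
rewrite (bigD1 (s v))//= eqxx big1 ?addn0// => c; rewrite eq_sym.
by case: eqP.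
Qed.

Lemma colour_count_le n r (s : {ffun 'I_n -> 'I_r}) c : (colour_count s c <= n)%N.
Proof. by rewrite -[leqRHS](colour_count_sum s) (bigD1 c)//= leq_addr. Qed.

Lemma colouring_sumS n r (F : ('I_r -> nat) -> R) :
  colouring_sum n.+1 F = \sum_c colouring_sum n (fun k => F (fun d => (c == d) + k d)%N).
Proof.
pose ext (p : 'I_r * {ffun 'I_n -> 'I_r}) : {ffun 'I_n.+1 -> 'I_r} :=
  [ffun i => if unlift ord0 i is Some j then p.2 j else p.1].
pose res (s : {ffun 'I_n.+1 -> 'I_r}) :=
  (s ord0, [ffun j => s (lift ord0 j)] : {ffun 'I_n -> 'I_r}).
rewrite /colouring_sum pair_bigA/= (reindex ext)/=; last first.
  exists res => [[c s] _|s _].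
    rewrite /res /ext/=; congr (_, _); first by rewrite ffunE unlift_none.
    by apply/ffunP => j; rewrite !ffunE liftK.
  by apply/ffunP => i; rewrite !ffunE; case: unliftP => [j|] ->; rewrite ?ffunE.
apply: eq_bigr => -[c s] _; congr F; apply: funext => d.
rewrite /colour_count big_ord_recl ffunE unlift_none/=; congr (_ + _)%N.
by apply: eq_bigr => v _; rewrite ffunE liftK.
Qed.

Lemma colouring_sum0 r (F : ('I_r -> nat) -> R) : colouring_sum 0 F = F (fun=> 0%N).
Proof.
have u (s t : {ffun 'I_0 -> 'I_r}) : s = t by apply/ffunP => -[].
pose s0 : {ffun 'I_0 -> 'I_r} := [ffun i : 'I_0 => match notF (ltn_ord i) with end].
rewrite /colouring_sum (bigD1 s0)//= big1 ?addr0; last by move=> t; rewrite (u t s0) eqxx.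
by congr F; apply: funext => c; rewrite /colour_count big_ord0.
Qed.

Definition count_cons r (k : nat) (f : 'I_r -> nat) (c : 'I_r.+1) : nat :=
  if unlift ord0 c is Some d then f d else k.

Lemma count_cons0 r k (f : 'I_r -> nat) : count_cons k f ord0 = k.
Proof. by rewrite /count_cons unlift_none. Qed.

(** Choose first the class of colour 0, in 'C(n, k) ways.  The induction is on n, by
Pascal's rule. *)
Lemma colouring_sum_split n r (F : ('I_r.+1 -> nat) -> R) :
  colouring_sum n F =
  \sum_(k < n.+1) 'C(n, k)%:R * colouring_sum (n - k) (fun f => F (count_cons k f)).
Proof.
elim: n F => [|n IH] F.
  rewrite colouring_sum0 big_ord1/= bin0 mul1r colouring_sum0; congr F; apply: funext => c.
  by rewrite /count_cons; case: unlift.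
rewrite colouring_sumS big_ord_recl/=.
have -> : colouring_sum n (fun k => F (fun d => (ord0 == d) + k d)%N) =
    \sum_(k < n.+1) 'C(n, k)%:R * colouring_sum (n - k) (fun f => F (count_cons k.+1 f)).
  rewrite IH; apply: eq_bigr => k _; congr (_ * _); apply: eq_bigr => s _.
  congr F; apply: funext => c; rewrite /count_cons.
  by case: unliftP => [j|] ->; rewrite ?eqxx// eq_liftF.
have -> : \sum_(i < r) colouring_sum n (fun k => F (fun d => (lift ord0 i == d) + k d)%N) =
    \sum_(k < n.+1) 'C(n, k)%:R * colouring_sum (n - k).+1 (fun f => F (count_cons k f)).
  under eq_bigr do rewrite IH.
  rewrite exchange_big/=; apply: eq_bigr => k _; rewrite colouring_sumS mulr_sumr.
  apply: eq_bigr => c _; congr (_ * _); apply: eq_bigr => s _.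
  congr F; apply: funext => d; rewrite /count_cons.
  case: unliftP => [j|] ->; last by rewrite eq_sym eq_liftF.
  by rewrite (inj_eq lift_inj).
rewrite [RHS]big_ord_recl/= bin0 subn0.
under [X in _ = _ + X]eq_bigr do rewrite /bump/= add1n binS natrD mulrDl subSS.
rewrite big_split/= [LHS]addrC addrA; congr (_ + _).
rewrite big_ord_recl/= bin0 subn0; congr (_ + _).
rewrite [RHS]big_ord_recr/= bin_small// mul0r addr0.
by apply: eq_bigr => k _; rewrite /bump/= add1n -subSn// subSS.
Qed.

Definition sumsq r (k : 'I_r -> nat) : R := \sum_c (k c)%:R ^+ 2.
(** With exp (- s) = 1 - p this is the probability that no edge joins two colours,
since n^2 - sum_c k_c^2 is twice the number of bichromatic pairs. *)
Definition colour_weight (s : R) (n r : nat) (k : 'I_r -> nat) : R :=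
  expR (- (s / 2) * (n%:R ^+ 2 - sumsq k)).
(** Partition function of the mean-field Potts model with r colours. *)
Definition Z (s : R) (r n : nat) : R := colouring_sum n (@colour_weight s n r).
(** Number of colourings times the weight of a perfectly balanced one: the
exponential order of [Z] below the critical temperature. *)
Definition V (s : R) (r n : nat) : R :=
  r%:R ^+ n * expR (- (s / 2) * (n%:R ^+ 2 * (1 - r%:R^-1))).
Definition W (s : R) (r n : nat) : R := Z s r n / V s r n.

Lemma V_gt0 s r n : (0 < r)%N -> 0 < V s r n.
Proof. by move=> r0; rewrite mulr_gt0 ?expR_gt0// exprn_gt0// ltr0n. Qed.

Lemma colouring_sum_ge0 n r (F : ('I_r -> nat) -> R) :
  (forall k, 0 <= F k) -> 0 <= colouring_sum n F.
Proof. by move=> F0; apply: sumr_ge0. Qed.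

Lemma colouring_sumZ n r (F : ('I_r -> nat) -> R) a :
  colouring_sum n (fun k => a * F k) = a * colouring_sum n F.
Proof. by rewrite /colouring_sum mulr_sumr. Qed.

Lemma Z_ge0 s r n : 0 <= Z s r n.
Proof. by apply: colouring_sum_ge0 => k; exact: expR_ge0. Qed.

Lemma W_ge0 s r n : (0 < r)%N -> 0 <= W s r n.
Proof. by move=> r0; rewrite divr_ge0 ?Z_ge0// ltW// V_gt0. Qed.

Lemma sumsq_cons r k (f : 'I_r -> nat) : sumsq (count_cons k f) = k%:R ^+ 2 + sumsq f.
Proof.
rewrite /sumsq big_ord_recl /count_cons unlift_none; congr (_ + _).
by apply: eq_bigr => c _; rewrite liftK.
Qed.

(** Given the class of colour 0, of size k, the other n - k vertices carry a Potts
model with r colours. *)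
Lemma Z_colour s r n (G : nat -> R) :
  colouring_sum n (fun k : 'I_r.+1 -> nat => G (k ord0) * colour_weight s n k) =
  \sum_(k < n.+1) G k * ('C(n, k)%:R * expR (- s * (k%:R * (n - k)%:R)) * Z s r (n - k)).
Proof.
rewrite colouring_sum_split; apply: eq_bigr => k _.
have -> : colouring_sum (n - k) (fun f : 'I_r -> nat =>
      G (count_cons k f ord0) * colour_weight s n (count_cons k f)) =
    (G k * expR (- s * (k%:R * (n - k)%:R))) * Z s r (n - k); last by ring.
rewrite /Z -colouring_sumZ /colouring_sum; apply: eq_bigr => f _.
rewrite count_cons0 -mulrA; congr (_ * _).
rewrite /colour_weight sumsq_cons -expRD natrB; last by rewrite -ltnS.
by congr expR; field.
Qed.

(** Binomial probability of k with success probability 1 / r.+1, tilted by a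
Gaussian factor that favours unbalanced classes.  This is [Z_colour] after
normalisation of all partition functions by [V]. *)
Definition kernel (s : R) (r n k : nat) : R :=
  'C(n, k)%:R * (r%:R ^+ (n - k) / r.+1%:R ^+ n)
   * expR (s / 2 * (r.+1%:R / r%:R) * (k%:R - n%:R / r.+1%:R) ^+ 2).

Lemma kernel_ge0 s r n k : 0 <= kernel s r n k.
Proof. by rewrite mulr_ge0 ?expR_ge0// mulr_ge0// divr_ge0 ?exprn_ge0. Qed.

Lemma W_colour s r n (G : nat -> R) : (0 < r)%N ->
  colouring_sum n (fun k : 'I_r.+1 -> nat => G (k ord0) * colour_weight s n k) / V s r.+1 n =
  \sum_(k < n.+1) G k * (kernel s r n k * W s r (n - k)).
Proof.
move=> r0; rewrite Z_colour mulr_suml; apply: eq_bigr => k _.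
rewrite -[LHS]mulrA; congr (_ * _).
have Vn : V s r (n - k) != 0 by rewrite gt_eqF// V_gt0.
have rn : r%:R != 0 :> R by rewrite pnatr_eq0 -lt0n.
have rp : r.+1%:R != 0 :> R by rewrite pnatr_eq0.
have E : 'C(n, k)%:R * (expR (- s * (k%:R * (n - k)%:R)) / V s r.+1 n) =
  kernel s r n k / V s r (n - k).
  rewrite /V /kernel !invfM -!expRN.
  rewrite natrB; last by rewrite -ltnS.
  have -> : expR (s / 2 * (r.+1%:R / r%:R) * (k%:R - n%:R / r.+1%:R) ^+ 2) =
    expR (- s * (k%:R * (n%:R - k%:R))) *
    expR (- (- (s / 2) * (n%:R ^+ 2 * (1 - r.+1%:R^-1)))) *
    expR (- (s / 2) * ((n%:R - k%:R) ^+ 2 * (1 - r%:R^-1))).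
    rewrite -!expRD; congr expR.
    have rr : r.+1%:R = r%:R + 1 :> R by rewrite natr1.
    by rewrite rr in rp *; field; rewrite rn rp.
  rewrite [expR (- (- (s / 2) * ((n%:R - k%:R) ^+ 2 * (1 - r%:R^-1))))]expRN.
  set A := expR _; set B := expR _; set C := expR _.
  have C0 : C != 0 by rewrite gt_eqF// expR_gt0.
  have P0 : r%:R ^+ (n - k) != 0 :> R by rewrite expf_neq0.
  move: (_ ^+ (n - k)) P0 => P P0; move: (expf_neq0 n rp); move: (_ ^+ n) => Q Q0.
  by field; rewrite C0 P0 Q0.
rewrite /W; move: E; move: (kernel _ _ _ _) (V _ _ _) (V _ _ _) Vn (Z _ _ _).
move: (expR _) ('C(_, _)%:R).
move=> e d a b c c0 z E; have -> : d * e * z / b = (d * (e / b)) * z by ring.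
by rewrite E; field.
Qed.

Lemma W1 s n : W s 1 n = 1.
Proof.
have u (a b : {ffun 'I_n -> 'I_1}) : a = b by apply/ffunP => i; rewrite !ord1.
pose a0 : {ffun 'I_n -> 'I_1} := [ffun=> ord0].
rewrite /W /Z /colouring_sum (bigD1 a0)//= big1 ?addr0; last first.
  by move=> a; rewrite (u a a0) eqxx.
have := colour_count_sum a0; rewrite big_ord1 => ks; rewrite /V /colour_weight /sumsq big_ord1 ks.
by rewrite invr1 !subrr !mulr0 expR0 expr1n mulr1 divr1.
Qed.

Lemma sum_colour_count n r (a : {ffun 'I_n -> 'I_r}) : \sum_c (colour_count a c)%:R = n%:R :> R.
Proof. by rewrite -natr_sum colour_count_sum. Qed.

Lemma sumsq_ge n r (a : {ffun 'I_n -> 'I_r}) : (0 < r)%N ->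
  n%:R ^+ 2 / r%:R <= sumsq (colour_count a).
Proof.
move=> r0; have := spread_ge0 (fun c => (colour_count a c)%:R : R) r0.
by rewrite /spread /mass sum_colour_count subr_ge0.
Qed.

(** The balanced weight is the smallest one, by Cauchy-Schwarz. *)
Lemma V_le_Z s r n : (0 < r)%N -> 0 <= s -> V s r n <= Z s r n.
Proof.
move=> r0 s0.
have -> : V s r n = \sum_(a : {ffun 'I_n -> 'I_r})
    expR (- (s / 2) * (n%:R ^+ 2 * (1 - r%:R^-1))).
  by rewrite sumr_const card_ffun !card_ord /V -[RHS]mulr_natl natrX.
apply: ler_sum => a _; rewrite /colour_weight ler_expR.
have := sumsq_ge a r0; rewrite mulrBr mulr1 => H.
by rewrite !mulNr lerN2; apply: ler_wpM2l; [rewrite divr_ge0|lra].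
Qed.

Definition freq n r (k : 'I_r -> nat) (c : 'I_r) : R := (k c)%:R / n%:R.

(** The left-hand side is the probability, for independent colours with law
[freq k], that the colour counts are k. *)
Lemma type_count n r (k : 'I_r -> nat) : (0 < n)%N -> (\sum_c k c = n)%N ->
  #|[pred a : {ffun 'I_n -> 'I_r} | [forall c, colour_count a c == k c]]|%:R
    * expR (\sum_c (k c)%:R * ln (freq n k c)) <= 1 :> R.
Proof.
move=> n0 kn; pose y c := freq n k c.
have nn : n%:R != 0 :> R by rewrite pnatr_eq0 -lt0n.
have y0 c : 0 <= y c by rewrite divr_ge0.
have sy : \sum_c y c = 1 by rewrite -mulr_suml -natr_sum kn divff.
have E : 1 = \sum_(a : {ffun 'I_n -> 'I_r}) \prod_v y (a v).
  rewrite -[in RHS](bigA_distr_bigA (fun (_ : 'I_n) c => y c)).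
  by rewrite prodr_const sy expr1n.
rewrite [leRHS]E mulr_natl -sumr_const.
rewrite [leRHS](bigID (mem [pred a : {ffun 'I_n -> 'I_r} |
  [forall c, colour_count a c == k c]]))/=.
apply: ler_wpDr; first by apply: sumr_ge0 => a _; apply: prodr_ge0.
apply: ler_sum => a; rewrite inE => /forallP ak.
rewrite expR_sum (partition_big a predT)//=.
apply: ler_prod => c _; rewrite expR_ge0/=.
have -> : \prod_(i | a i == c) y (a i) = y c ^+ k c.
  rewrite (eq_bigr (fun=> y c)) => [|i /eqP->//].
  rewrite prodr_const -(eqP (ak c)) /colour_count -sum1_card big_mkcond/=.
  by congr (_ ^+ _); apply: eq_bigr => i _; rewrite unfold_in; case: eqP.
have [->|kc0] := eqVneq (k c) 0%N; first by rewrite mul0r expR0.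
rewrite expRM_natl lnK// posrE.
by rewrite /freq; apply: divr_gt0; rewrite ltr0n // lt0n.
Qed.

Definition deficit (th : R) r (x : 'I_r -> R) := rel_entropy x - th / 2 * spread x.

Lemma mass_freq n r (k : 'I_r -> nat) : (0 < n)%N -> (\sum_c k c = n)%N ->
  mass (freq n k) = 1.
Proof.
by move=> n0 kn; rewrite /mass -mulr_suml -natr_sum kn divff// pnatr_eq0 -lt0n.
Qed.

Lemma type_weight s n r (k : 'I_r -> nat) : (0 < r)%N -> (0 < n)%N ->
  (\sum_c k c = n)%N ->
  colour_weight s n k = V s r n * expR (- n%:R * deficit (s * n%:R) (freq n k))
     * expR (\sum_c (k c)%:R * ln (freq n k c)).
Proof.
move=> r0 n0 kn; have rp : 0 < r%:R :> R by rewrite ltr0n.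
have nn : n%:R != 0 :> R by rewrite pnatr_eq0 -lt0n.
have rn : r%:R != 0 :> R by rewrite gt_eqF.
rewrite /V -(lnK (x := r%:R)) ?posrE// -expRM_natl -!expRD /colour_weight; congr expR.
rewrite lnK ?posrE// /deficit /rel_entropy /spread mass_freq// ln1 mulr0 subr0.
have -> : \sum_i freq n k i ^+ 2 = sumsq k / n%:R ^+ 2.
  by rewrite /sumsq mulr_suml; apply: eq_bigr => c _; rewrite /freq exprMn exprVn.
have -> : \sum_i freq n k i * ln (r%:R * freq n k i) =
   (\sum_c (k c)%:R * ln (freq n k c)) / n%:R + ln r%:R.
  rewrite -[X in _ + X]mul1r -[X in _ + X * _](mass_freq n0 kn) /mass !mulr_suml -big_split/=.
  apply: eq_bigr => c _; rewrite mulrC [in LHS]mulrC [r%:R * _]mulrC xlnM//.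
    by rewrite [X in _ = X + _]mulrAC.
  by rewrite divr_ge0.
by field; rewrite nn rn.
Qed.

(** There are at most n.+1 ^ r colour counts, and each carries weight at most
V exp (- n deficit). *)
Lemma type_tail s n r (c : R) (B : ('I_r -> nat) -> bool) : (0 < r)%N -> (0 < n)%N ->
  (forall k : 'I_r -> nat, (\sum_c k c = n)%N -> B k -> c <= deficit (s * n%:R) (freq n k)) ->
  colouring_sum n (fun k => (B k)%:R * colour_weight s n k) <=
    n.+1%:R ^+ r * expR (- n%:R * c) * V s r n.
Proof.
move=> r0 n0 HB.
pose ty (a : {ffun 'I_n -> 'I_r}) : {ffun 'I_r -> 'I_n.+1} :=
  [ffun c => inord (colour_count a c)].
rewrite /colouring_sum (partition_big ty predT)//=.
have -> : n.+1%:R ^+ r * expR (- n%:R * c) * V s r n =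
  \sum_(t : {ffun 'I_r -> 'I_n.+1}) expR (- n%:R * c) * V s r n.
  by rewrite sumr_const card_ffun !card_ord -[RHS]mulr_natl natrX mulrA.
apply: ler_sum => t _.
have tyE a : ty a = t -> colour_count a = (fun c => t c : nat).
  move=> <-; apply: funext => d; rewrite ffunE inordK// ltnS; exact: colour_count_le.
have V0 := V_gt0 s n r0.
have R0 : 0 <= expR (- n%:R * c) * V s r n by rewrite mulr_ge0 ?expR_ge0// ltW.
have [/existsP[a0 /andP[/eqP a0t Ba0]]|] :=
    boolP [exists a, (ty a == t) && B (colour_count a)]; last first.
  move/existsPn => N; rewrite big1// => a /eqP at_; have := N a.
  by rewrite at_ eqxx/= => /negbTE->; rewrite mul0r.
pose k := fun c => t c : nat.
have kE : colour_count a0 = k by apply: tyE.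
have kn : (\sum_c k c = n)%N by rewrite -kE colour_count_sum.
rewrite (eq_bigr (fun=> colour_weight s n k)); last first.
  by move=> a /eqP at_; rewrite (tyE _ at_) -/k -kE Ba0 mul1r.
rewrite sumr_const type_weight//.
set S := \sum_c _ * _.
have tc := type_count n0 kn; rewrite -/S in tc.
have -> : #|[pred a | ty a == t]| =
    #|[pred a : {ffun 'I_n -> 'I_r} | [forall c, colour_count a c == k c]]|.
  apply: eq_card => a; rewrite !inE; apply/eqP/forallP => [/tyE->//|H].
  apply/ffunP => d; rewrite ffunE (eqP (H d)); apply: val_inj.
  by rewrite /= inordK//; exact: ltn_ord.
rewrite -[leLHS]mulr_natl.
set D := deficit _ _; set N := #|_| in tc *.
have -> : N%:R * (V s r n * expR (- n%:R * D) * expR S) =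
  V s r n * expR (- n%:R * D) * (N%:R * expR S) by ring.
apply: le_trans (_ : V s r n * expR (- n%:R * D) <= _).
  by rewrite ler_piMr// mulr_ge0 ?expR_ge0// ltW.
rewrite mulrC ler_pM2r// ler_expR !mulNr lerN2 ler_pM2l ?ltr0n//.
by apply: HB; rewrite // -kE.
Qed.
End ColourCounts.

(** * Gaussian sums and sequences with prescribed ratios *)

(** The limit C is left unspecified, since it cancels in [wsum_lim]. *)
Lemma gauss_primitive (R : realType) : exists F : R -> R, exists C : R,
  [/\ 0 < C, F 0 = 0,
   (forall x : R, 0 <= x -> is_derive x 1 F (gauss_fun x)) &
   forall e : R, 0 < e -> exists2 X, 0 <= X & forall x, X <= x -> `|F x - C| <= e].
Proof.
pose mu := @lebesgue_measure R.
(* Starting at -1 makes 0 an interior point, where the fundamental theorem of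
   calculus applies. *)
pose G (x : R) := (\int[mu]_(t in `[(-1)%R, x]) gauss_fun t)%R.
have dG (x : R) : 0 <= x -> is_derive x 1 G (gauss_fun x).
  move=> x0; have [] : derivable G x 1 /\ derive1 G x = gauss_fun x.
    apply: (@continuous_FTC1 R gauss_fun (BLeft (-1)) _ (x + 1) _ _ _ _).
    - by rewrite ltrDl.
    - apply: continuous_compact_integrable => //; first exact: segment_compact.
      by apply: continuous_subspaceT; exact: continuous_gauss_fun.
    - by rewrite /=; rewrite lte_fin; lra.
    - by move=> ?; exact: continuous_gauss_fun.
  by move=> dx E; apply: DeriveDef; [exact: dx|rewrite -derive1E; exact: E].
pose F x := G x - G 0.
have dF (x : R) : 0 <= x -> is_derive x 1 F (gauss_fun x).
  move=> x0; rewrite -[gauss_fun x]subr0.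
  exact: derB (dG x x0) (der_cst _ x).
have F0 : F 0 = 0 by rewrite /F subrr.
have inc x y : 0 <= x -> x < y -> F x < F y.
  move=> x0 xy; apply: (@gt0_derive_lt R F gauss_fun) => //.
  - by move=> z /andP[xz _]; apply: dF; exact: le_trans xz.
  - by move=> z _; exact: expR_gt0.
have inc' x y : 0 <= x -> x <= y -> F x <= F y.
  by move=> x0; rewrite le_eqVlt => /predU1P[->//|xy]; exact/ltW/inc.
have bd x : 0 <= x -> F x <= 2 * expR 1.
  rewrite le_eqVlt => /predU1P[<-|x0]; first by rewrite F0 mulr_ge0// expR_ge0.
  have /= := @gt0_derive_lt R (fun y => - F y - 2 * expR (1 - y))
     (fun y => 2 * expR (1 - y) - gauss_fun y) 0 x x0.
  rewrite F0 => H.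
  suff : - (2 * expR 1) < - F x - 2 * expR (1 - x).
    by have := expR_gt0 (1 - x); lra.
  have -> : - (2 * expR 1) = - 0 - 2 * expR (1 - 0) :> R by rewrite subr0 oppr0 add0r.
  apply: H => y /andP[y0 _].
    apply: (is_derive_eq (derB (derN (dF y y0)) (derM (der_cst 2 y)
      (der_expR (derB (der_cst 1 y) (der_id y)))))).
    by ring.
  have : gauss_fun y <= expR (1 - y) by rewrite /gauss_fun ler_expR; nra.
  by have := expR_gt0 (1 - y); lra.
pose S := [set F x | x in [set x | 0 <= x]].
have hS : has_sup S.
  split; first by exists (F 0); exists 0 => //=.
  by exists (2 * expR 1) => _ [x x0 <-]; exact: bd.
have Sub x : 0 <= x -> F x <= sup S.
  by move=> x0; apply: ub_le_sup; [exact: hS.2|exists x].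
exists F; exists (sup S); split => //.
  by apply: lt_le_trans (Sub 1 ler01); rewrite -F0; apply: inc.
move=> e e0; have [_ [X X0 <-] HX] := sup_adherent e0 hS.
exists X => // x Xx; have x0 : 0 <= x := le_trans X0 Xx.
rewrite ler_norml; have := Sub x x0; have := inc' X x X0 Xx.
by move=> *; apply/andP; split; lra.
Qed.

(** The integrand decreases, so a Riemann sum of mesh d is off by at most d times
its first term. *)
Lemma gauss_riemann (R : realType) (F : R -> R) (d : R) (J : nat) : 0 < d -> F 0 = 0 ->
  (forall x : R, 0 <= x -> is_derive x 1 F (gauss_fun x)) ->
  `|d * \sum_(j < J) gauss_fun (j%:R * d) - F (J%:R * d)| <= d.
Proof.
move=> d0 F0 dF; set S := fun J => d * \sum_(j < J) gauss_fun (j%:R * d).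
have gle (x y : R) : 0 <= x -> x <= y -> gauss_fun y <= gauss_fun x.
  by move=> x0 xy; rewrite /gauss_fun ler_expR; nra.
suff : F (J%:R * d) <= S J /\ S J - d + d * gauss_fun (J%:R * d) <= F (J%:R * d).
  move=> [H1 H2]; rewrite ler_norml.
  have : 0 <= d * gauss_fun (J%:R * d) by rewrite mulr_ge0 ?expR_ge0// ltW.
  by rewrite -/(S J) => ?; apply/andP; split; lra.
elim: J => [|J [IH1 IH2]].
  rewrite /S big_ord0 mulr0 mul0r F0 sub0r; split => //.
  by rewrite /gauss_fun expr0n/= oppr0 expR0; lra.
have j0 : 0 <= J%:R * d by rewrite mulr_ge0// ltW.
have SE : S J.+1 = S J + d * gauss_fun (J%:R * d).
  by rewrite /S big_ord_recr/= mulrDr.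
have JE : J.+1%:R * d = J%:R * d + d by rewrite -natr1; ring.
have ab : J%:R * d < J.+1%:R * d by rewrite JE; lra.
have [||c] := MVT ab (f := F) (df := gauss_fun).
- by move=> x; rewrite in_itv/= => /andP[ax xb]; apply: dF; apply/ltW/(le_lt_trans j0).
- apply: derivable_within_continuous => x; rewrite in_itv/= => /andP[ax xb].
  exact: (@ex_derive _ _ _ _ _ _ _ (dF _ (le_trans j0 ax))).
rewrite in_itv/= => /andP[ca cb].
have -> : J.+1%:R * d - J%:R * d = d by rewrite JE; ring.
have c0 : 0 <= c by apply/ltW/(le_lt_trans j0).
have := gle _ _ j0 (ltW ca); have := gle _ _ c0 (ltW cb).
rewrite SE => G1 G2 E.
have G3 : d * gauss_fun (J.+1%:R * d) <= gauss_fun c * d by rewrite mulrC ler_pM2r.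
have G4 : gauss_fun c * d <= d * gauss_fun (J%:R * d) by rewrite [leRHS]mulrC ler_pM2r.
by split; lra.
Qed.

Lemma nat_above (R : realType) (x : R) :
  exists N : nat, forall m : nat, (N <= m)%N -> x <= m%:R.
Proof.
exists (Num.truncn x).+1 => m Nm; apply: ltW.
by apply: lt_le_trans (truncnS_gt x) _; rewrite ler_nat.
Qed.

Lemma inv_nat_cvg0 (R : realType) : ((n%:R : R)^-1) @[n --> \oo] --> (0 : R).
Proof.
apply/cvgrPdist_le => e e0; have [N HN] := nat_above (e^-1).
exists (maxn 1 N) => //= n; rewrite /= geq_max => /andP[n0 /HN h].
rewrite sub0r normrN ger0_norm ?invr_ge0// -[leRHS]invrK lef_pV2 ?posrE ?invr_gt0//.
by rewrite ltr0n.
Qed.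

Definition gsum (R : realType) (a : R) (m J : nat) : R :=
  \sum_(j < J) expR (- (a * j%:R ^+ 2 / (2 * m%:R))).

(** Riemann sum of mesh sqrt (a / (2 m)), taken up to the diverging point
J sqrt (a / (2 m)). *)
Lemma gsum_lim (R : realType) : exists2 G : R, 0 < G &
  forall a eta e : R, 0 < a -> 0 < eta -> 0 < e -> exists N : nat,
  forall m J : nat, (N <= m)%N -> eta * m%:R <= J%:R ->
    `|gsum a m J / Num.sqrt m%:R - G / Num.sqrt a| <= e.
Proof.
have [F [C [C0 F0 dF Flim]]] := gauss_primitive R.
exists (Num.sqrt 2 * C); first by rewrite mulr_gt0// sqrtr_gt0.
move=> a eta e a0 eta0 e0.
pose b := Num.sqrt (a / 2).
have b0 : 0 < b by rewrite sqrtr_gt0 divr_gt0.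
pose e1 := e * b / 2.
have e10 : 0 < e1 by rewrite divr_gt0// mulr_gt0.
have [X X0 HX] := Flim _ e10.
have [N1 HN1] := nat_above ((b / e1) ^+ 2).
have [N2 HN2] := nat_above ((X / (eta * b)) ^+ 2).
exists (maxn 1 (maxn N1 N2)) => m J; rewrite !geq_max => /and3P[m1 /HN1 A1 /HN2 A2] etaJ.
have m0 : 0 < m%:R :> R by rewrite ltr0n.
set w := Num.sqrt m%:R; have w0 : 0 < w by rewrite sqrtr_gt0.
have w2 : m%:R = w ^+ 2 by rewrite sqr_sqrtr// ltW.
have le_w x : 0 <= x -> x ^+ 2 <= m%:R -> x <= w.
  by move=> x0; rewrite w2 ler_pXn2r// nnegrE ltW.
pose d := b / w.
have d0 : 0 < d by rewrite divr_gt0.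
have b2 : b ^+ 2 = a / 2 by rewrite sqr_sqrtr// divr_ge0// ltW.
have gE : gsum a m J = \sum_(j < J) gauss_fun (j%:R * d).
  apply: eq_bigr => j _; rewrite /gauss_fun; congr expR; congr (- _).
  rewrite exprMn /d exprMn exprVn -w2 b2; field; lra.
have R1 := gauss_riemann J d0 F0 dF.
have d_e1 : d <= e1.
  rewrite /d ler_pdivrMr// -ler_pdivrMl// mulrC.
  by apply: le_w => //; rewrite divr_ge0// ltW.
have XJ : X <= J%:R * d.
  apply: le_trans (_ : eta * m%:R * d <= _); last by rewrite ler_pM2r.
  have -> : eta * m%:R * d = (eta * b) * w by rewrite w2 /d; field; lra.
  rewrite mulrC -ler_pdivrMr ?mulr_gt0//.
  by apply: le_w => //; rewrite divr_ge0// mulr_ge0// ltW.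
have R2 := HX _ XJ.
have sa : Num.sqrt a = Num.sqrt 2 * b.
  by rewrite /b -sqrtrM//; congr Num.sqrt; field.
rewrite sa gE; set S := \sum_(j < J) _ in R1 *.
have s2 : Num.sqrt 2 != 0 :> R by rewrite gt_eqF// sqrtr_gt0.
have -> : S / w - Num.sqrt 2 * C / (Num.sqrt 2 * b) =
   ((d * S - F (J%:R * d)) + (F (J%:R * d) - C)) / b.
  by rewrite /d; field; rewrite s2 !gt_eqF.
rewrite normrM [X in _ * X]ger0_norm; last by rewrite invr_ge0 ltW.
rewrite ler_pdivrMr//; apply: le_trans (ler_normD _ _) _.
by rewrite /e1 in d_e1 R2; lra.
Qed.

(** Consecutive ratios exp (- (A j + K) / m) multiply up to a Gaussian in j. *)
Lemma ratio_bounds (R : realType) (u : nat -> R) (J m : nat) (A B K : R) :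
  (0 < m)%N -> 0 < u 0%N -> 0 <= A -> 0 <= K ->
  (forall j, (j.+1 < J)%N -> u j * expR (- ((A * j%:R + K) / m%:R)) <= u j.+1
     <= u j * expR (- ((B * j%:R - K) / m%:R))) ->
  forall j, (j < J)%N ->
   u 0%N * expR (- ((A / 2 * j%:R ^+ 2 + K * j%:R) / m%:R)) <= u j
     <= u 0%N * expR (- ((B / 2 * (j%:R ^+ 2 - j%:R) - K * j%:R) / m%:R)).
Proof.
move=> m0 u0 A0 K0 H; have mp : 0 < m%:R :> R by rewrite ltr0n.
elim=> [_|j IH jJ].
  by rewrite expr0n/= !mulr0 subrr mulr0 addr0 subr0 mul0r oppr0 expR0 mulr1 lexx.
have /andP[L1 L2] := H _ jJ; have /andP[I1 I2] := IH (ltnW jJ).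
apply/andP; split.
  apply: le_trans L1; apply: le_trans (_ : _ <= u 0%N
      * expR (- ((A / 2 * j%:R ^+ 2 + K * j%:R) / m%:R))
      * expR (- ((A * j%:R + K) / m%:R))) _; last by rewrite ler_pM2r ?expR_gt0.
  rewrite -[leRHS]mulrA -expRD ler_pM2l// ler_expR -opprD lerN2 -mulrDl.
  rewrite ler_pM2r ?invr_gt0//.
  by rewrite -[j.+1%:R]natr1; lra.
apply: le_trans L2 _; apply: le_trans (_ : u 0%N
    * expR (- ((B / 2 * (j%:R ^+ 2 - j%:R) - K * j%:R) / m%:R))
    * expR (- ((B * j%:R - K) / m%:R)) <= _); first by rewrite ler_pM2r ?expR_gt0.
rewrite -[leLHS]mulrA -expRD ler_pM2l// ler_expR -opprD lerN2 -mulrDl.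
rewrite ler_pM2r ?invr_gt0//.
by rewrite -[j.+1%:R]natr1; lra.
Qed.

(** The linear terms K j / m left by [ratio_bounds] are absorbed in a slightly
different variance, at the price of a factor exp (K' / m), by
y j <= tau j^2 / 2 + y^2 / (2 tau). *)
Lemma gauss_sandwich (R : realType) (u : nat -> R) (J m : nat) (A B K tau : R) :
  (0 < m)%N -> 0 < u 0%N -> 0 <= A -> 0 <= K -> 0 < tau ->
  (forall j, (j.+1 < J)%N -> u j * expR (- ((A * j%:R + K) / m%:R)) <= u j.+1
     <= u j * expR (- ((B * j%:R - K) / m%:R))) ->
  forall K', K' = (`|B| / 2 + K) ^+ 2 / (2 * tau) ->
  expR (- (K' / m%:R)) * gsum (A + tau) m J <= (\sum_(j < J) u j) / u 0%N
    <= expR (K' / m%:R) * gsum (B - tau) m J.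
Proof.
move=> m0 u0 A0 K0 t0 H _ ->; set K' := _ ^+ 2 / _; have mp : 0 < m%:R :> R by rewrite ltr0n.
have RB := ratio_bounds m0 u0 A0 K0 H.
have K'E (x j : R) : 0 <= j -> x <= `|B| / 2 + K -> x * j <= tau / 2 * j ^+ 2 + K'.
  move=> j0 xb; apply: le_trans (_ : (`|B| / 2 + K) * j <= _); first exact: ler_wpM2r.
  rewrite /K'; set y := _ + K; rewrite -subr_ge0.
  have -> : tau / 2 * j ^+ 2 + y ^+ 2 / (2 * tau) - y * j = (tau * j - y) ^+ 2 / (2 * tau).
    by field; lra.
  by rewrite divr_ge0 ?sqr_ge0// mulr_ge0// ltW.
have B0 := normr_ge0 B; have BB := ler_norm B.
rewrite ler_pdivlMr// ler_pdivrMr// /gsum !mulr_sumr !mulr_suml.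
apply/andP; split; apply: ler_sum => j _; have /andP[R1 R2] := RB j (ltn_ord j).
  apply: le_trans R1; rewrite mulrC ler_pM2l// -expRD ler_expR -opprD lerN2.
  have := K'E K j%:R (ler0n _ _) ltac:(lra) => H1.
  rewrite ler_pdivrMr// mulrDl divfK ?gt_eqF//.
  have -> : (A + tau) * j%:R ^+ 2 / (2 * m%:R) * m%:R = (A + tau) / 2 * j%:R ^+ 2.
    by field; lra.
  lra.
apply: le_trans R2 _; rewrite mulrC ler_pM2r// -expRD ler_expR lerNl opprD opprK.
have := K'E (B / 2 + K) j%:R (ler0n _ _) ltac:(lra) => H1.
rewrite ler_pdivlMr// mulrDl mulNr divfK ?gt_eqF//.
have -> : (B - tau) * j%:R ^+ 2 / (2 * m%:R) * m%:R = (B - tau) / 2 * j%:R ^+ 2.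
  by field; lra.
lra.
Qed.

Lemma expR_le_1Dx (R : realType) (y : R) : `|y| <= 2^-1 -> expR (y - 2 * y ^+ 2) <= 1 + y.
Proof.
rewrite ler_norml => /andP[y1 y2].
have -> : y - 2 * y ^+ 2 = - (2 * y ^+ 2 - y) by ring.
rewrite expRN -[leLHS]mul1r ler_pdivrMr ?expR_gt0//.
apply: le_trans (_ : (1 + y) * (1 + (2 * y ^+ 2 - y)) <= _).
  rewrite -subr_ge0; have -> : (1 + y) * (1 + (2 * y ^+ 2 - y)) - 1 = y ^+ 2 * (1 + 2 * y).
    by ring.
  by rewrite mulr_ge0 ?sqr_ge0//; lra.
by rewrite ler_pM2l ?expR_ge1Dx//; lra.
Qed.

Lemma expR_le_1D2x (R : realType) (x : R) : 0 <= x <= 2^-1 -> expR x <= 1 + 2 * x.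
Proof.
move=> /andP[x0 x1]; have := expR_ge1Dx (- x); rewrite expRN => H.
have e0 := expR_gt0 x.
have : (1 - x) * expR x <= 1 by rewrite -ler_pdivlMr// mul1r.
by nra.
Qed.

(** Here rho is the ratio of two consecutive values of the kernel at distance x from
its centre.  To first order its logarithm is - (al + al') (1 - lam) x / n: the
binomial law pulls back to the centre and the tilt pushes away from it. *)
Lemma step_bounds (R : realType) (al al' M eta tau lam lam0 x j n : R) :
  0 <= al <= M -> 0 <= al' <= M -> 1 <= M -> 0 < n -> 0 <= lam <= 2 ->
  (al + al') * `|lam - lam0| <= tau / 2 -> 0 < eta ->
  4 * M * eta <= 1 -> 8 * M ^+ 2 * eta <= tau -> 2 <= eta * n ->
  0 <= j <= eta * n -> `|x - j| <= 1 ->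
  let k := (al + al') * (1 - lam0) in
  let rho := (1 - al * x / n) / (1 + al' * (x + 1) / n)
     * expR (lam * (al + al') * (x + 2^-1) / n) in
  expR (- (((k + tau) * j + 7 * M) / n)) <= rho
    /\ rho <= expR (- (((k - tau) * j - 7 * M) / n)).
Proof.
move=> /andP[a0 aM] /andP[b0 bM] M1 n0 /andP[l0 l2] lam_near eta0 Me Mt en.
move=> /andP[j0 jn]; rewrite ler_norml => /andP[x1 x2] k rho.
pose y1 := - (al * x / n); pose y2 := al' * (x + 1) / n.
pose b := (j + 2) / n.
have b0' : 0 <= b by rewrite divr_ge0//; lra.
have b2 : b <= 2 * eta by rewrite ler_pdivrMr//; lra.
have xn0 : - b <= x / n by rewrite /b -mulNr ler_pM2r ?invr_gt0//; lra.
have xn1 : x / n <= b by rewrite ler_pM2r ?invr_gt0//; lra.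
have xm0 : - b <= (x + 1) / n by rewrite /b -mulNr ler_pM2r ?invr_gt0//; lra.
have xm1 : (x + 1) / n <= b by rewrite ler_pM2r ?invr_gt0//; lra.
have Mb : M * b <= 2^-1 by nra.
have Y c z : 0 <= c -> c <= M -> - b <= z -> z <= b -> `|c * z| <= M * b.
  move=> c0 cM z0 z1; rewrite normrM ger0_norm//; apply: ler_pM => //.
  by rewrite ler_norml z0.
have Y1 : `|y1| <= M * b by rewrite /y1 normrN -mulrA; apply: Y.
have Y2 : `|y2| <= M * b by rewrite /y2 -mulrA; apply: Y.
have Q y : `|y| <= M * b -> y ^+ 2 <= (2 * M ^+ 2 * eta) * b.
  move=> yb; rewrite -[y ^+ 2]real_normK ?num_real//.
  apply: le_trans (_ : (M * b) ^+ 2 <= _); first by rewrite ler_pXn2r// nnegrE// mulr_ge0//; lra.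
  have -> : (M * b) ^+ 2 = M ^+ 2 * b * b by ring.
  rewrite ler_wpM2r//; have -> : 2 * M ^+ 2 * eta = M ^+ 2 * (2 * eta) by ring.
  by rewrite ler_wpM2l ?sqr_ge0.
have Q1 := Q _ Y1; have Q2 := Q _ Y2.
have E1 := expR_le_1Dx (le_trans Y1 Mb); have E2 := expR_le_1Dx (le_trans Y2 Mb).
have F1 := expR_ge1Dx y1; have F2 := expR_ge1Dx y2.
have p1 : 0 < 1 + y1 by apply: lt_le_trans E1; exact: expR_gt0.
have p2 : 0 < 1 + y2 by apply: lt_le_trans E2; exact: expR_gt0.
pose L := lam * (al + al') * (x + 2^-1) / n.
have rhoE : rho = (1 + y1) / (1 + y2) * expR L by [].
pose kl := (al + al') * (lam - lam0).
have klb : `|kl| <= tau / 2 by rewrite /kl normrM ger0_norm//; lra.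
have main : y1 - y2 + L =
    (- k * j + kl * j - (al + al') * (1 - lam) * (x - j) - al' + lam * (al + al') / 2) / n.
  by rewrite /y1 /y2 /L /k /kl; field; lra.
have c1 : `|(al + al') * (1 - lam) * (x - j)| <= 2 * M.
  rewrite !normrM [`|al + al'|]ger0_norm; last lra.
  have : `|1 - lam| <= 1.
    by move: l0 l2; clear; rewrite ler_norml => *; apply/andP; split; lra.
  have : `|x - j| <= 1 by rewrite ler_norml x1.
  have := normr_ge0 (1 - lam); have := normr_ge0 (x - j).
  move: (`|1 - lam|) (`|x - j|) => u v v0 u0 v1 u1.
  rewrite -mulrA; apply: le_trans (_ : al + al' <= _).
    by apply: ler_piMr; [exact: addr_ge0|exact: mulr_ile1].
  by move: aM bM; clear; lra.
have c2 : 0 <= lam * (al + al') / 2 <= 2 * M.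
  have : lam * (al + al') <= 2 * (2 * M).
    by apply: ler_pM => //; [exact: addr_ge0|move: aM bM; clear; lra].
  have : 0 <= lam * (al + al') by rewrite mulr_ge0// addr_ge0.
  by move: (lam * _); clear => z *; apply/andP; split; lra.
move: c1 klb; rewrite !ler_norml => /andP[c1 c1'] /andP[kl1 kl2].
have qb : 2 * (2 * M ^+ 2 * eta) * b <= (tau / 2 * j + 2 * M) / n.
  rewrite /b mulrA ler_pM2r ?invr_gt0// mulrDr.
  have : 2 * (2 * M ^+ 2 * eta) * j <= tau / 2 * j by rewrite ler_wpM2r//; lra.
  have : 2 * (2 * M ^+ 2 * eta) * 2 <= 2 * M.
    have -> : 2 * (2 * M ^+ 2 * eta) * 2 = 2 * M * (4 * M * eta) by ring.
    by rewrite ler_piMr// mulr_ge0// (le_trans ler01).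
  by clear; move: (_ * j) (_ * 2) => u v; lra.
have klj1 : - (tau / 2 * j) <= kl * j by rewrite -mulNr ler_wpM2r.
have klj2 : kl * j <= tau / 2 * j by rewrite ler_wpM2r.
move/andP: c2 => [c2 c2'].
have fin (z : R) : (0 <= z) -> z <= 2 * (2 * M ^+ 2 * eta) * b ->
   z <= (tau / 2 * j + 2 * M) / n by move=> _ zb; apply: le_trans zb qb.
split; rewrite rhoE.
- apply: le_trans (_ : expR (y1 - 2 * y1 ^+ 2) / expR y2 * expR L <= _); last first.
    rewrite ler_pM2r ?expR_gt0//; apply: ler_pM => //; rewrite ?expR_ge0 ?invr_ge0 ?expR_ge0//.
    by rewrite lef_pV2 ?posrE ?expR_gt0.
  rewrite -expRB -expRD ler_expR.
  have -> : y1 - 2 * y1 ^+ 2 - y2 + L = (y1 - y2 + L) - 2 * y1 ^+ 2 by ring.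
  have : 2 * y1 ^+ 2 <= (tau / 2 * j + 2 * M) / n.
    by apply: fin; [rewrite mulr_ge0 ?sqr_ge0|rewrite -mulrA ler_pM2l].
  rewrite main ler_pdivlMr// => q1; rewrite -[leLHS]mulNr ler_pdivrMr// mulrBl divfK ?gt_eqF//.
  by move: q1 klj1 c1 c1' c2 c2' b0 bM M1; clear; lra.
- apply: le_trans (_ : expR y1 / expR (y2 - 2 * y2 ^+ 2) * expR L <= _).
    rewrite ler_pM2r ?expR_gt0//; apply: ler_pM => //.
    - exact: ltW.
    - by rewrite invr_ge0 ltW.
    - by rewrite lef_pV2 ?posrE ?expR_gt0.
  rewrite -expRB -expRD ler_expR.
  have -> : y1 - (y2 - 2 * y2 ^+ 2) + L = (y1 - y2 + L) + 2 * y2 ^+ 2 by ring.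
  have : 2 * y2 ^+ 2 <= (tau / 2 * j + 2 * M) / n.
    by apply: fin; [rewrite mulr_ge0 ?sqr_ge0|rewrite -mulrA ler_pM2l].
  rewrite main ler_pdivlMr// => q1; rewrite -[leRHS]mulNr ler_pdivlMr// mulrDl divfK ?gt_eqF//.
  by move: q1 klj2 c1 c1' c2 c2' b0 bM M1; clear; lra.
Qed.

(** * The tilted binomial kernel near its centre *)

(** A positive sequence whose ratios are those of a Gaussian of inverse variance
k / m, up to tau, sums to about G sqrt (m / k) times its first term.  The constant
G is the same for all sequences. *)
Lemma one_sided_gauss_sum (R : realType) : exists2 G : R, 0 < G &
  forall k e : R, 0 < k -> 0 < e -> exists2 tau : R, 0 < tau &
  forall K eta : R, 0 <= K -> 0 < eta -> exists N : nat,
  forall m J : nat, (N <= m)%N -> eta * m%:R <= J%:R ->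
  forall u : nat -> R, 0 < u 0%N ->
  (forall j, (j.+1 < J)%N ->
     u j * expR (- (((k + tau) * j%:R + K) / m%:R)) <= u j.+1
       <= u j * expR (- (((k - tau) * j%:R - K) / m%:R))) ->
  `|(\sum_(j < J) u j) / u 0%N / Num.sqrt m%:R - G / Num.sqrt k| <= e.
Proof.
have [G G0 HG] := gsum_lim R; exists G => // k e k0 e0.
have cont : {for k, continuous (fun x : R => G / Num.sqrt x)}.
  apply: cvgM; first exact: cvg_cst.
  apply: cvgV; first by rewrite gt_eqF// sqrtr_gt0.
  exact: sqrt_continuous.
have e4 : 0 < e / 4 by lra.
have [d /= d0 Hd] : exists2 d, 0 < d &
    forall x, `|k - x| < d -> `|G / Num.sqrt k - G / Num.sqrt x| <= e / 4.
  have /cvgrPdist_le/(_ _ e4) := cont.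
  by move=> /nbhs_ballP[d d0 H]; exists d => // x; exact: H.
(* [gauss_sandwich] loses tau twice, so the variances used are within 2 tau of k. *)
pose tau := Num.min (k / 4) (d / 4).
have t0 : 0 < tau by rewrite lt_min !divr_gt0.
have tk : tau <= k / 4 by rewrite /tau ge_min lexx.
have td : tau <= d / 4 by rewrite /tau ge_min lexx orbT.
exists tau => // K eta K0 eta0.
have kp : 0 < k + tau + tau by lra.
have km : 0 < k - tau - tau by lra.
have [N1 H1] := HG _ _ _ kp eta0 e4.
have [N2 H2] := HG _ _ _ km eta0 e4.
pose K' := (`|k - tau| / 2 + K) ^+ 2 / (2 * tau).
have K'0 : 0 <= K' by rewrite divr_ge0 ?sqr_ge0// mulr_ge0// ltW.
pose B := G / Num.sqrt k + e.
have B0 : 0 < B by rewrite addr_gt0// divr_gt0// sqrtr_gt0.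
have [N3 H3] := nat_above (2 * K').
have [N4 H4] := nat_above (2 * K' * B / (e / 4)).
exists (maxn 1 (maxn (maxn N1 N2) (maxn N3 N4))) => m J.
rewrite !geq_max => /and3P[m1 /andP[/H1{}H1 /H2{}H2] /andP[/H3{}H3 /H4{}H4]] mJ u u0 Hu.
have m0 : 0 < m%:R :> R by rewrite ltr0n.
have kt : 0 <= k + tau by lra.
have /andP[L U] := gauss_sandwich m1 u0 kt K0 t0 Hu (erefl K').
have {}H1 := H1 _ mJ; have {}H2 := H2 _ mJ.
have w0 : 0 < Num.sqrt m%:R :> R by rewrite sqrtr_gt0.
set w := Num.sqrt m%:R in w0 H1 H2 *.
have D1 : `|G / Num.sqrt k - G / Num.sqrt (k + tau + tau)| <= e / 4.
  by apply: Hd; rewrite -addrA opprD addrA subrr sub0r normrN ger0_norm; lra.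
have D2 : `|G / Num.sqrt k - G / Num.sqrt (k - tau - tau)| <= e / 4.
  by apply: Hd; rewrite -addrA opprD addrA subrr sub0r normrN ler0_norm; lra.
pose x := K' / m%:R.
have x0 : 0 <= x by rewrite divr_ge0// ltW.
have x2 : x <= 2^-1 by rewrite ler_pdivrMr//; lra.
have xB : 2 * x * B <= e / 4.
  have -> : 2 * x * B = (2 * K' * B) / m%:R by rewrite /x; field; lra.
  by rewrite ler_pdivrMr// [leRHS]mulrC -ler_pdivrMr.
have E1 := expR_ge1Dx (- x); have E2 := @expR_le_1D2x R x ltac:(by rewrite x0).
have {}L : expR (- x) * (gsum (k + tau + tau) m J / w) <= (\sum_(j < J) u j) / u 0%N / w.
  by rewrite mulrA ler_pM2r ?invr_gt0.
have {}U : (\sum_(j < J) u j) / u 0%N / w <= expR x * (gsum (k - tau - tau) m J / w).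
  by rewrite mulrA ler_pM2r ?invr_gt0.
have g1 : 0 <= gsum (k + tau + tau) m J / w.
  by rewrite divr_ge0 ?sqrtr_ge0// sumr_ge0// => j _; exact: expR_ge0.
have g2 : 0 <= gsum (k - tau - tau) m J / w.
  by rewrite divr_ge0 ?sqrtr_ge0// sumr_ge0// => j _; exact: expR_ge0.
move: L U g1 g2 H1 H2 D1 D2 xB E1 E2 x0 x2 e0; rewrite /B -/w.
move: (gsum _ _ _ / w) (gsum _ _ _ / w) (_ / _ / w) (G / Num.sqrt k).
move: (G / Num.sqrt (k + tau + tau)) (G / Num.sqrt (k - tau - tau)).
move=> ga gb b a c g; clearbody x; clear.
rewrite !ler_norml => L U a0 b0 /andP[A1 A2] /andP[B1 B2] /andP[C1 C2] /andP[D1 D2].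
move=> xB E1 E2 x0 x2 e0.
have la : (1 - x) * a <= expR (- x) * a by rewrite ler_wpM2r.
have lb : expR x * b <= (1 + 2 * x) * b by rewrite ler_wpM2r.
have xa : x * a <= x * (g + e) by rewrite ler_wpM2l//; lra.
have xb : x * b <= x * (g + e) by rewrite ler_wpM2l//; lra.
have xg : 0 <= x * (g + e) by rewrite mulr_ge0//; lra.
by apply/andP; split; lra.
Qed.

Section Kernel.
Variable R : realType.

Lemma kernel_gt0 (s : R) r n k : (0 < r)%N -> (k <= n)%N -> 0 < kernel s r n k.
Proof.
move=> r0 kn; rewrite mulr_gt0 ?expR_gt0// mulr_gt0 ?ltr0n ?bin_gt0//.
by rewrite divr_gt0// exprn_gt0// ltr0n.
Qed.

Lemma natr_binS n k : (k < n)%N ->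
  'C(n, k.+1)%:R = 'C(n, k)%:R * (n%:R - k%:R) / (k%:R + 1) :> R.
Proof.
move=> kn; have k0 : k%:R + 1 != 0 :> R by rewrite natr1 pnatr_eq0.
apply: (mulIf k0); rewrite divfK// natr1 -natrB ?(ltnW kn)// -!natrM.
by rewrite mulnC mul_bin_left mulnC.
Qed.

(** The quotient is the ratio of binomial probabilities; the exponential is the
increment of the Gaussian tilt. *)
Lemma kernel_right (s : R) r n k : (0 < r)%N -> (k < n)%N ->
  let al := r.+1%:R / r%:R in let al' := r.+1%:R in
  let x := k%:R - n%:R / r.+1%:R in let lam := s * n%:R / r.+1%:R in
  kernel s r n k.+1 = kernel s r n k * ((1 - al * x / n%:R) / (1 + al' * (x + 1) / n%:R)
     * expR (lam * (al + al') * (x + 2^-1) / n%:R)).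
Proof.
move=> r0 kn al al' x lam.
have rp : 0 < r%:R :> R by rewrite ltr0n.
have np : 0 < n%:R :> R by rewrite ltr0n; apply: leq_ltn_trans kn.
have kp : 0 <= k%:R :> R by [].
have rE : r.+1%:R = r%:R + 1 :> R by rewrite natr1.
have kE : k.+1%:R = k%:R + 1 :> R by rewrite natr1.
have binE := natr_binS kn.
have powE : r%:R ^+ (n - k) = r%:R * r%:R ^+ (n - k.+1) :> R.
  by rewrite -exprS; congr (_ ^+ _); lia.
rewrite /kernel powE binE.
have -> : expR (s / 2 * (r.+1%:R / r%:R) * (k.+1%:R - n%:R / r.+1%:R) ^+ 2) =
  expR (s / 2 * (r.+1%:R / r%:R) * x ^+ 2) * expR (lam * (al + al') * (x + 2^-1) / n%:R).
  rewrite -expRD; congr expR; rewrite /lam /al /al' /x kE rE; field; lra.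
rewrite -/x; move: (expR _) (expR _) ('C(n, k)%:R) (_ ^+ (n - _)) => A B C D.
have : r.+1%:R ^+ n != 0 :> R by rewrite expf_neq0// rE; lra.
move: (_ ^+ n) => Q Q0; rewrite /al /al' /x rE; field.
have -> : n%:R + (k%:R * (r%:R + 1) - n%:R + (r%:R + 1)) = (k%:R + 1) * (r%:R + 1) :> R.
  by ring.
have k1 : k%:R + 1 != 0 :> R by lra.
have r1 : r%:R + 1 != 0 :> R by lra.
by rewrite Q0 k1 r1 !gt_eqF//= mulf_neq0.
Qed.

(** Mirror image of [kernel_right], with the two rates exchanged. *)
Lemma kernel_left (s : R) r n k : (0 < r)%N -> (k < n)%N ->
  let al := r.+1%:R in let al' := r.+1%:R / r%:R in
  let x := n%:R / r.+1%:R - k.+1%:R in let lam := s * n%:R / r.+1%:R in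
  kernel s r n k = kernel s r n k.+1 * ((1 - al * x / n%:R) / (1 + al' * (x + 1) / n%:R)
     * expR (lam * (al + al') * (x + 2^-1) / n%:R)).
Proof.
move=> r0 kn al al' x lam.
have rp : 0 < r%:R :> R by rewrite ltr0n.
have np : 0 < n%:R :> R by rewrite ltr0n; apply: leq_ltn_trans kn.
have kp : 0 <= k%:R :> R by [].
have knp : k%:R + 1 <= n%:R :> R by rewrite natr1 ler_nat.
have rE : r.+1%:R = r%:R + 1 :> R by rewrite natr1.
have kE : k.+1%:R = k%:R + 1 :> R by rewrite natr1.
have binE := natr_binS kn.
have powE : r%:R ^+ (n - k) = r%:R * r%:R ^+ (n - k.+1) :> R.
  by rewrite -exprS; congr (_ ^+ _); lia.
rewrite /kernel powE binE.
have -> : expR (s / 2 * (r.+1%:R / r%:R) * (k%:R - n%:R / r.+1%:R) ^+ 2) =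
  expR (s / 2 * (r.+1%:R / r%:R) * (k.+1%:R - n%:R / r.+1%:R) ^+ 2)
  * expR (lam * (al + al') * (x + 2^-1) / n%:R).
  rewrite -expRD; congr expR; rewrite /lam /al /al' /x kE rE; field; lra.
move: (expR _) (expR _) ('C(n, k)%:R) (_ ^+ (n - _)) => A B C D.
have : r.+1%:R ^+ n != 0 :> R by rewrite expf_neq0// rE; lra.
move: (_ ^+ n) => Q Q0; rewrite /al /al' /x rE kE; field.
have -> : r%:R * n%:R + (n%:R + - (k%:R + 1) * (r%:R + 1) + (r%:R + 1)) =
  (n%:R - k%:R) * (r%:R + 1) :> R by ring.
have k1 : k%:R + 1 != 0 :> R by lra.
have r1 : r%:R + 1 != 0 :> R by lra.
have nk : n%:R - k%:R != 0 :> R by lra.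
by rewrite Q0 k1 r1 !(gt_eqF np) (gt_eqF rp)/= mulf_neq0.
Qed.

(** Triples (n, s, J) with n -> oo and s n -> th, and with a window half-width J
of order eta n, where eta is fixed first and then sent to 0. *)
Definition window_filter (th : R) : set_system (nat * R * nat) :=
  [set P | exists2 eta0 : R, 0 < eta0 & forall eta : R, 0 < eta <= eta0 ->
    exists2 d : R, 0 < d & exists N : nat, forall (n : nat) (s : R) (J : nat),
    (N <= n)%N -> 0 <= s -> `|s * n%:R - th| <= d ->
    eta * n%:R <= J%:R <= 2 * eta * n%:R -> P (n, s, J)].

Global Instance window_filter_filter th : Filter (window_filter th).
Proof.
split.
- by exists 1 => // eta _; exists 1 => //; exists 0%N.
- move=> P Q [e1 e10 H1] [e2 e20 H2]; exists (Num.min e1 e2); first by rewrite lt_min e10.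
  move=> eta /andP[eta0]; rewrite le_min => /andP[le1 le2].
  have [|d1 d10 [N1 {}H1]] := H1 eta; first by rewrite eta0.
  have [|d2 d20 [N2 {}H2]] := H2 eta; first by rewrite eta0.
  exists (Num.min d1 d2); first by rewrite lt_min d10.
  exists (maxn N1 N2) => n s J; rewrite geq_max => /andP[n1 n2] s0.
  by rewrite le_min => /andP[sd1 sd2] HJ; split; [exact: H1|exact: H2].
- move=> P Q PQ [e e0 H]; exists e => // eta etab; have [d d0 [N {}H]] := H eta etab.
  by exists d => //; exists N => n s J *; apply: PQ; exact: H.
Qed.

(** Pairs (n, s) with n -> oo and s n -> th. *)
Definition scaling_filter (th : R) : set_system (nat * R) :=
  [set P | exists2 d : R, 0 < d & exists N : nat, forall (n : nat) (s : R),
    (N <= n)%N -> 0 <= s -> `|s * n%:R - th| <= d -> P (n, s)].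

Global Instance scaling_filter_filter th : Filter (scaling_filter th).
Proof.
split.
- by exists 1 => //; exists 0%N.
- move=> P Q [d1 d10 [N1 H1]] [d2 d20 [N2 H2]].
  exists (Num.min d1 d2); first by rewrite lt_min d10.
  exists (maxn N1 N2) => n s; rewrite geq_max => /andP[n1 n2] s0.
  by rewrite le_min => /andP[sd1 sd2]; split; [exact: H1|exact: H2].
- move=> P Q PQ [d d0 [N H]].
  by exists d => //; exists N => n s *; apply: PQ; exact: H.
Qed.

Lemma center_bounds n r : let x := (n %/ r.+1)%:R - n%:R / r.+1%:R : R in -1 <= x <= 0.
Proof.
have rp : 0 < r.+1%:R :> R by rewrite ltr0n.
rewrite /= lerBrDr subr_le0 ler_pdivlMr// -natrM ler_nat leq_trunc_div andbT.
rewrite addrC lerBlDr ler_pdivrMr// natr1 -natrM ler_nat ltnW//.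
by rewrite mulnC; have := ltn_ceil n (ltn0Sn r); rewrite mulnC.
Qed.

Lemma window_arith j J k0 n : (j.+1 < J)%N -> (J <= k0)%N -> (k0 + J <= n)%N ->
  [/\ (j <= J)%N, (k0 + j < n)%N, (k0 - j.+1 < n)%N,
      (k0 - j.+1).+1 = (k0 - j)%N & (k0 - j <= n)%N && (j <= k0)%N].
Proof. by move=> *; split; lia. Qed.

(** Inside a window of half-width J of order eta n, the kernel has Gaussian ratios
on both sides of its centre n %/ r.+1. *)
Lemma half_window (r : nat) (lam0 tau : R) : (0 < r)%N -> 0 <= lam0 < 1 -> 0 < tau ->
  exists2 eta0 : R, 0 < eta0 & forall eta : R, 0 < eta <= eta0 ->
  exists2 d : R, 0 < d & exists N : nat, forall (n : nat) (s : R) (J : nat),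
    (N <= n)%N -> 0 <= s -> `|s * n%:R - lam0 * r.+1%:R| <= d ->
    eta * n%:R <= J%:R <= 2 * eta * n%:R ->
    let k0 := (n %/ r.+1)%N in let k := r.+1%:R ^+ 2 / r%:R * (1 - lam0) in
    let K := 7 * r.+1%:R in
    [/\ (0 < n)%N, (J <= k0)%N, (k0 + J <= n)%N,
      forall j, (j.+1 < J)%N ->
       kernel s r n (k0 + j) * expR (- (((k + tau) * j%:R + K) / n%:R))
       <= kernel s r n (k0 + j.+1)
       <= kernel s r n (k0 + j) * expR (- (((k - tau) * j%:R - K) / n%:R)) &
      forall j, (j.+1 < J)%N ->
       kernel s r n (k0 - j) * expR (- (((k + tau) * j%:R + K) / n%:R))
       <= kernel s r n (k0 - j.+1)
       <= kernel s r n (k0 - j) * expR (- (((k - tau) * j%:R - K) / n%:R))].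
Proof.
move=> r0 /andP[l0 l1] t0.
pose M : R := r.+1%:R.
have rp : 1 <= r%:R :> R by rewrite ler1n.
have ME : M = r%:R + 1 by rewrite /M natr1.
have M2 : 2 <= M by rewrite ME; lra.
have M1 : 1 <= M by lra.
have Mp : 0 < M by lra.
have Mn : M != 0 by lra.
pose eta0 := Num.min (8 * M)^-1 (tau / (16 * M ^+ 2)).
have M20 : 0 < 16 * M ^+ 2 by rewrite mulr_gt0// exprn_gt0//; lra.
have eta00 : 0 < eta0.
  by rewrite lt_min invr_gt0 divr_gt0// andbT; lra.
exists eta0 => // eta /andP[etap]; rewrite /eta0 le_min => /andP[].
rewrite -[_^-1]mul1r !ler_pdivlMr//; last lra.
move=> eM etau.
exists (Num.min (tau / (2 * M)) 1); first by rewrite lt_min divr_gt0//=; lra.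
have [N1 H1] := nat_above (eta^-1).
have [N2 H2] := nat_above (2 * M).
exists (maxn N1 N2) => n s J; rewrite geq_max => /andP[/H1{}H1 /H2{}H2] s0.
rewrite le_min => /andP[sd1 sd2] /andP[J1 J2].
set k0 := (n %/ r.+1)%N; set k := _ * (1 - lam0); set K := 7 * r.+1%:R.
have n0 : 0 < n%:R :> R by lra.
have en : 1 <= eta * n%:R by rewrite -ler_pdivrMl// mulr1.
have /andP[c1 c2] := center_bounds n r; rewrite -/k0 -/M in c1 c2.
have [X XE] : exists X, X = n%:R / M by exists (n%:R / M).
have nM : X * M = n%:R by rewrite XE divfK.
rewrite -XE in c1 c2.
have etaM : 2 * eta * n%:R <= X / 4.
  rewrite XE ler_pdivlMr// ler_pdivlMr; last lra.
  by have : 8 * M * eta * n%:R <= 1 * n%:R; [rewrite ler_pM2r//; lra|lra].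
have nM2 : 2 <= X by rewrite XE ler_pdivlMr.
have nM3 : X <= n%:R / 2 by rewrite XE ler_pM2l// lef_pV2 ?posrE.
have [Y YE] : exists Y, Y = k0%:R :> R by exists k0%:R.
rewrite -YE in c1 c2.
have Jk : (J <= k0)%N by rewrite -(ler_nat R) -YE; lra.
have kJ : (k0 + J <= n)%N by rewrite -(ler_nat R) natrD -YE; lra.
have np : (0 < n)%N by rewrite -(ltr_nat R).
pose lam := s * n%:R / M.
have lamD : `|lam - lam0| <= tau / (2 * M) / M /\ `|lam - lam0| <= 1.
  have -> : lam - lam0 = (s * n%:R - lam0 * M) / M by rewrite /lam; field.
  rewrite normrM [`|M^-1|]ger0_norm ?invr_ge0; last lra.
  have Mi : M^-1 <= 1 by rewrite invf_le1; lra.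
  have Mi0 : 0 < M^-1 by rewrite invr_gt0; lra.
  split; first by rewrite ler_pM2r.
  by rewrite -[leRHS]mulr1; apply: ler_pM => //; exact: ltW.
case: lamD => lamD1 lamD2.
have lamb : 0 <= lam <= 2.
  have -> /= : 0 <= lam by apply: divr_ge0; [exact: mulr_ge0|lra].
  by move: lamD2; rewrite ler_norml => /andP[]; lra.
pose A := M / r%:R.
have rn : r%:R != 0 :> R by lra.
have A0 : 0 <= A <= M.
  have -> /= : 0 <= A by rewrite divr_ge0// ltW.
  by rewrite ler_pdivrMr ?(lt_le_trans ltr01)// ler_peMr// ltW.
have M0M : 0 <= M <= M by rewrite lexx andbT ltW.
have AM : A + M = M ^+ 2 / r%:R by rewrite /A ME; field.
have lamT : (A + M) * `|lam - lam0| <= tau / 2.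
  apply: le_trans (_ : M ^+ 2 * (tau / (2 * M) / M) <= _).
    apply: ler_pM => //; first by rewrite AM divr_ge0// sqr_ge0.
    by rewrite AM ler_pdivrMr ?(lt_le_trans ltr01)// ler_peMr ?sqr_ge0.
  by move: Mn; clear => Mn; have -> : M ^+ 2 * (tau / (2 * M) / M) = tau / 2 by field.
have kE : (A + M) * (1 - lam0) = k by rewrite AM.
have e2 : 0 < 2 * eta by rewrite mulr_gt0.
have e4M : 4 * M * (2 * eta) <= 1 by move: eM; clear; lra.
have e8M : 8 * M ^+ 2 * (2 * eta) <= tau by move: etau; clear; lra.
have e2n : 2 <= 2 * eta * n%:R by move: en; clear; lra.
split => // j jJ; have [jJ' kjn kjn' E1 /andP[kj jk]] := window_arith jJ Jk kJ.
- have jb : 0 <= (j%:R : R) <= 2 * eta * n%:R.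
    by apply/andP; split; [exact: ler0n|apply: le_trans J2; rewrite ler_nat].
  rewrite addnS kernel_right//.
  set x := (k0 + j)%:R - _; have xj : `|x - j%:R| <= 1.
    rewrite /x natrD -/M -XE -YE ler_norml; move: c1 c2; clear.
    by move: (j%:R) => ? ? ?; apply/andP; split; lra.
  have [] := step_bounds A0 M0M M1 n0 lamb lamT e2 e4M e8M e2n jb xj.
  rewrite kE => L1 L2; have b0 : 0 < kernel s r n (k0 + j).
    by apply: kernel_gt0 => //; exact: ltnW.
  by rewrite !ler_pM2l// -/M -/A -/lam L1.
- have jb : 0 <= (j%:R : R) <= 2 * eta * n%:R.
    by apply/andP; split; [exact: ler0n|apply: le_trans J2; rewrite ler_nat].
  rewrite [in X in _ <= X <= _](@kernel_left s r n (k0 - j.+1))// E1.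
  set x := _ - (k0 - j)%:R; have xj : `|x - j%:R| <= 1.
    rewrite /x natrB// -/M -XE -YE ler_norml; move: c1 c2; clear.
    by move: (j%:R) => ? ? ?; apply/andP; split; lra.
  rewrite addrC in lamT kE.
  have [] := step_bounds M0M A0 M1 n0 lamb lamT e2 e4M e8M e2n jb xj.
  rewrite kE => L1 L2; have b0 : 0 < kernel s r n (k0 - j) by apply: kernel_gt0.
  by rewrite !ler_pM2l// -/M -/A -/lam L1.
Qed.
End Kernel.

(** * Mass of the kernel inside and outside a window *)

Lemma poly_exp_small (R : realType) (c e : R) (K : nat) : 0 < c -> 0 < e ->
  exists N : nat, forall n : nat, (N <= n)%N ->
    n.+1%:R ^+ K * expR (- n%:R * c) <= e.
Proof.
move=> c0 e0.
pose B : R := 2 ^+ K * (K.+1)`!%:R / c ^+ K.+1.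
have [N HN] := nat_above (B / e).
exists (maxn 1 N) => n; rewrite geq_max => /andP[n1 /HN nB].
have n0 : 0 < n%:R :> R by rewrite ltr0n.
have cn0 : 0 < c * n%:R by rewrite mulr_gt0.
have f0 : 0 < (K.+1)`!%:R :> R by rewrite ltr0n fact_gt0.
have E : (c * n%:R) ^+ K.+1 / (K.+1)`!%:R <= expR (c * n%:R).
  by have := expR_ge1Dxn K (ltW cn0); lra.
rewrite mulNr expRN [n%:R * c]mulrC ler_pdivrMr ?expR_gt0//.
apply: le_trans (_ : e * ((c * n%:R) ^+ K.+1 / (K.+1)`!%:R) <= _); last by rewrite ler_pM2l.
apply: le_trans (_ : (2 * n%:R) ^+ K <= _).
  have nn : n.+1%:R <= 2 * n%:R :> R.
    by have : 1 <= n%:R :> R; [rewrite ler1n|rewrite -natr1; lra].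
  by apply: lerXn2r => //; rewrite nnegrE// mulr_ge0.
have -> : e * ((c * n%:R) ^+ K.+1 / (K.+1)`!%:R) = (2 * n%:R) ^+ K * (e * n%:R / B).
  rewrite /B [(c * _) ^+ _]exprMn exprMn [n%:R ^+ K.+1]exprSr.
  have c1 : c ^+ K.+1 != 0 by rewrite expf_neq0// gt_eqF.
  have t1 : 2 ^+ K != 0 :> R by rewrite expf_neq0.
  move: c1 t1 (gt_eqF f0) => + +; move: (c ^+ K.+1) (2 ^+ K) (K.+1)`!%:R => C T f C0 T0 ff.
  by field; rewrite C0 T0 ff.
have B0 : 0 < B by rewrite /B divr_gt0 ?exprn_gt0// mulr_gt0// exprn_gt0.
apply: ler_peMr; first by rewrite exprn_ge0// mulr_ge0.
by rewrite ler_pdivlMr// mul1r mulrC -ler_pdivrMr.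
Qed.

Section Windows.
Variable R : realType.

Definition in_window (k0 J k : nat) := (k < k0 + J)%N && (k0 < k + J)%N.

Lemma window_sum (f : nat -> R) n k0 J : (J <= k0)%N -> (k0 + J <= n)%N ->
  (0 < J)%N ->
  \sum_(k < n.+1 | in_window k0 J k) f k =
    \sum_(j < J) f (k0 + j)%N + \sum_(j < J) f (k0 - j)%N - f k0.
Proof.
elim: J => // -[_ _ kn _|J IH Jk kn _].
  rewrite !big_ord1 addn0 subn0 addrK.
  have kn' : (k0 < n.+1)%N by lia.
  rewrite (bigD1 (Ordinal kn'))/=; last by rewrite /in_window; lia.
  rewrite big1 ?addr0// => k /andP[]; rewrite /in_window -val_eqE/=; lia.
rewrite [in RHS]big_ord_recr/= [X in _ = _ + X - _]big_ord_recr/=.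
rewrite [RHS](_ : _ = (\sum_(j < J.+1) f (k0 + j)%N + \sum_(j < J.+1) f (k0 - j)%N - f k0)
   + f (k0 + J.+1)%N + f (k0 - J.+1)%N); last by ring.
rewrite -IH//; [|lia|lia].
have p1 : (k0 + J.+1 < n.+1)%N by lia.
have p2 : (k0 - J.+1 < n.+1)%N by lia.
rewrite (bigD1 (Ordinal p1))/=; last by rewrite /in_window; lia.
rewrite (bigD1 (Ordinal p2))/=; last by rewrite /in_window -val_eqE/=; lia.
set S := \sum_(k < n.+1 | _) _; set S' := \sum_(k < n.+1 | _) _.
have -> : S = S'; last by ring.
by apply: eq_bigl => k; rewrite /in_window -!val_eqE/=; lia.
Qed.
End Windows.

Lemma cvg_eventually_eq (R : realType) (T : Type) (F : set_system T)
    (FF : Filter F) (f g : T -> R) (l : R) :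
  F [set x | f x = g x] -> f x @[x --> F] --> l -> g x @[x --> F] --> l.
Proof. by move=> E L; apply: cvg_trans L; exact: near_eq_cvg. Qed.

Section KernelLimit.
Variable R : realType.
Local Notation wsum s r n J := (\sum_(k < n.+1 | in_window (n %/ r.+1) J k) kernel s r n k).

Lemma window_filter_sqrt (th : R) :
  (Num.sqrt (x.1.1%:R : R))^-1 @[x --> window_filter th] --> (0 : R).
Proof.
apply/cvgrPdist_le => e e0; exists 1 => // eta _; exists 1 => //.
have [N HN] := nat_above (e^-1 ^+ 2).
exists (maxn 1 N) => n s J; rewrite geq_max => /andP[n1 /HN nN] _ _ _ /=.
have n0 : 0 < n%:R :> R by rewrite ltr0n.
rewrite sub0r normrN ger0_norm ?invr_ge0 ?sqrtr_ge0//.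
rewrite -[leRHS]invrK lef_pV2 ?posrE ?sqrtr_gt0 ?invr_gt0//.
have -> : e^-1 = Num.sqrt (e^-1 ^+ 2) by rewrite sqrtr_sqr ger0_norm// invr_ge0 ltW.
by rewrite ler_sqrt.
Qed.

(** Laplace's method: a window sum divided by the central value and by sqrt n. *)
Lemma wsum_height_lim : exists2 G : R, 0 < G &
  forall (r : nat) (lam0 : R), (0 < r)%N -> 0 <= lam0 < 1 ->
  wsum x.1.2 r x.1.1 x.2 / kernel x.1.2 r x.1.1 (x.1.1 %/ r.+1) / Num.sqrt x.1.1%:R
     @[x --> window_filter (lam0 * r.+1%:R)]
   --> G / Num.sqrt (r.+1%:R ^+ 2 / r%:R * (1 - lam0)).
Proof.
have [G G0 HG] := one_sided_gauss_sum R; exists (2 * G); first by rewrite mulr_gt0.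
move=> r lam0 r0 l01; set k := _ * (1 - lam0).
have k0 : 0 < k.
  move/andP: l01 => [l0 l1]; apply: mulr_gt0; last lra.
  by rewrite divr_gt0 ?exprn_gt0 ?ltr0n.
set F := window_filter _; have FF : Filter F by exact: window_filter_filter.
pose side (sg : nat -> nat -> nat) (x : nat * R * nat) :=
  let k0 := (x.1.1 %/ r.+1)%N in
  (\sum_(j < x.2) kernel x.1.2 r x.1.1 (sg k0 j)) / kernel x.1.2 r x.1.1 k0 / Num.sqrt x.1.1%:R.
have sideP sg : (sg = addn \/ sg = subn) -> side sg x @[x --> F] --> G / Num.sqrt k.
  move=> Hsg; apply/cvgrPdist_le => e e0.
  have [tau t0 {}HG] := HG k e k0 e0.
  have [eta0 eta00 H] := half_window r0 l01 t0; exists eta0 => // eta etab.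
  have [d d0 [N1 {}H]] := H eta etab; exists d => //.
  have eta_gt0 : 0 < eta by case/andP: etab.
  have [N2 {}HG] := HG (7 * r.+1%:R) eta (mulr_ge0 (ler0n _ _) (ler0n _ _)) eta_gt0.
  exists (maxn N1 N2) => n s J; rewrite geq_max => /andP[n1 n2] s0 sd Jb /=.
  have /= [np Jk kJ Hr Hl] := H n s J n1 s0 sd Jb.
  rewrite distrC /side/=.
  have /andP[Jb1 _] := Jb.
  have b0 : 0 < kernel s r n (n %/ r.+1) by apply: kernel_gt0 => //; exact: leq_div.
  case: Hsg => ->.
    have := HG n J n2 Jb1 (fun j => kernel s r n (n %/ r.+1 + j)); rewrite addn0; exact.
  have := HG n J n2 Jb1 (fun j => kernel s r n (n %/ r.+1 - j)); rewrite subn0; exact.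
have -> : 2 * G / Num.sqrt k = G / Num.sqrt k + G / Num.sqrt k - 0 by ring.
have L := cvgB (cvgD (sideP addn (or_introl erefl)) (sideP subn (or_intror erefl)))
  (window_filter_sqrt (lam0 * r.+1%:R)).
apply: cvg_eventually_eq (L FF FF).
have [eta0 eta00 H] := half_window r0 l01 ltr01; exists eta0 => // eta etab.
have [d d0 [N1 {}H]] := H eta etab; exists d => //; exists N1 => n s J n1 s0 sd Jb /=.
have /= [np Jk kJ _ _] := H n s J n1 s0 sd Jb.
have J0 : (0 < J)%N.
  rewrite -(ltr_nat R); case/andP: Jb => Jb _; apply: lt_le_trans Jb.
  by case/andP: etab => ? _; rewrite mulr_gt0// ltr0n.
have b0 : 0 < kernel s r n (n %/ r.+1) by apply: kernel_gt0 => //; exact: leq_div.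
rewrite /side/= (window_sum (kernel s r n))// !mulrBl !mulrDl divff ?gt_eqF// mul1r.
by [].
Qed.
End KernelLimit.

Section Tails.
Variable R : realType.
Local Notation wsum s r n J := (\sum_(k < n.+1 | in_window (n %/ r.+1) J k) kernel s r n k).

(** At s = 0 the weights are constant, and [Z] counts colourings. *)
Lemma W0 r n : (0 < r)%N -> W (0 : R) r n = 1.
Proof.
move=> r0; rewrite /W /Z /V /colouring_sum /colour_weight !mul0r oppr0 mul0r expR0 mulr1.
rewrite (eq_bigr (fun=> 1)); last by move=> a _; rewrite mul0r expR0.
rewrite sumr_const card_ffun !card_ord -natrX divff// natrX expf_neq0//.
by rewrite pnatr_eq0 -lt0n.
Qed.

Lemma outside_window_far (eta : R) r n J k : (0 < n)%N -> 2 <= eta * n%:R ->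
  eta * n%:R <= J%:R -> ~~ in_window (n %/ r.+1) J k ->
  (eta / 2) ^+ 2 <= (k%:R / n%:R - r.+1%:R^-1) ^+ 2.
Proof.
move=> n0 en eJ nw; have /andP[c1 c2] := center_bounds R n r.
have np : 0 < n%:R :> R by rewrite ltr0n.
have -> : k%:R / n%:R - r.+1%:R^-1 = (k%:R - n%:R / r.+1%:R) / n%:R :> R.
  by rewrite mulrBl [X in _ = _ - X]mulrAC divff ?gt_eqF// mul1r.
have e0 : 0 <= eta / 2.
  by rewrite divr_ge0// -(pmulr_lge0 _ np); lra.
set x := _ - _; rewrite -[leRHS]real_normK ?num_real// lerXn2r// ?nnegrE//.
rewrite normrM [`|_^-1|]ger0_norm ?invr_ge0// ler_pdivlMr//.
have k0_far : (n %/ r.+1 + J <= k)%N || (k + J <= n %/ r.+1)%N.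
  by move: nw; rewrite /in_window negb_and -!leqNgt.
have -> : eta / 2 * n%:R = (eta * n%:R) / 2 by ring.
move: c1 c2 eJ en; rewrite /x; move: (eta * n%:R) (n%:R / r.+1%:R) => d c c1 c2 eJ en.
have {k0_far}[|] := orP k0_far; rewrite -(ler_nat R) natrD.
  move: c1 c2 eJ en; move: (k%:R) (J%:R) (_%:R) => a b e c1 c2 eJ en H.
  apply: le_trans (ler_norm _); move: c1 c2 H eJ en; clear; lra.
move: c1 c2 eJ en; move: (k%:R) (J%:R) (_%:R) => a b e c1 c2 eJ en H.
rewrite -normrN; apply: le_trans (ler_norm _); move: c1 c2 H eJ en; clear; lra.
Qed.

(** Strictly below the critical temperature the deficit controls the distance to
the uniform law quadratically. *)
Lemma deficit_sub r th (x : 'I_r -> R) i : (0 < r)%N -> th <= beta_crit R r ->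
  (forall i, 0 <= x i) -> mass x = 1 ->
  (beta_crit R r - th) / 2 * (x i - r%:R^-1) ^+ 2 <= deficit th x.
Proof.
move=> r0 thb x0 m1; have := critical_ineq_holds r0 x0; rewrite m1 mul1r => V.
have := spread_ge x i r0; rewrite m1 mul1r => S.
have : (beta_crit R r - th) / 2 * (x i - r%:R^-1) ^+ 2 <= (beta_crit R r - th) / 2 * spread x.
  by apply: ler_wpM2l => //; apply: divr_ge0 => //; rewrite subr_ge0.
by rewrite /deficit; lra.
Qed.

(** Relative to [V], each term is the weight of the colourings with r.+1 colours
in which colour 0 has k vertices, so the large deviation bound [type_tail] applies to the
sum. *)
Lemma outside_tail r (th : R) : (0 < r)%N -> 0 <= th < beta_crit R r.+1 ->
  forall eta e : R, 0 < eta -> 0 < e ->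
  exists2 d : R, 0 < d & exists N : nat, forall (n : nat) (s : R) (J : nat),
    (N <= n)%N -> 0 <= s -> `|s * n%:R - th| <= d -> eta * n%:R <= J%:R ->
    \sum_(k < n.+1 | ~~ in_window (n %/ r.+1) J k) kernel s r n k * W s r (n - k) <= e.
Proof.
move=> r0 /andP[th0 thb] eta e eta0 e0.
(* When s n stays within d of th, it is at least d below the critical value. *)
pose d := (beta_crit R r.+1 - th) / 2.
have d0 : 0 < d by rewrite divr_gt0// subr_gt0.
pose c := d / 2 * (eta / 2) ^+ 2.
have c0 : 0 < c by rewrite mulr_gt0 ?exprn_gt0// divr_gt0.
have [N1 H1] := poly_exp_small r.+1 c0 e0.
have [N2 H2] := nat_above (2 / eta).
exists d => //; exists (maxn 1 (maxn N1 N2)) => n s J.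
rewrite !geq_max => /and3P[n0 /H1{}H1 /H2{}H2] s0 sd eJ.
have en : 2 <= eta * n%:R by rewrite mulrC -ler_pdivrMr.
pose B (k : 'I_r.+1 -> nat) := ~~ in_window (n %/ r.+1) J (k ord0).
have V0 := @V_gt0 R s r.+1 n (ltn0Sn r).
have T : colouring_sum n (fun k => (B k)%:R * colour_weight s n k) <=
    n.+1%:R ^+ r.+1 * expR (- n%:R * c) * V s r.+1 n.
  apply: type_tail => // k kn Bk.
  have sth : s * n%:R <= beta_crit R r.+1 - d.
    by move: sd; rewrite ler_norml => /andP[_]; rewrite /d; lra.
  have x0 i : 0 <= freq R n k i by rewrite divr_ge0.
  have sb : s * n%:R <= beta_crit R r.+1 by move: sth d0; clear; lra.
  have D := @deficit_sub r.+1 (s * n%:R) (freq R n k) ord0 (ltn0Sn r) sb x0 (mass_freq R n0 kn).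
  apply: le_trans D.
  have F := outside_window_far n0 en eJ Bk.
  apply: ler_pM => //; [by rewrite divr_ge0// ltW|exact: sqr_ge0|].
  by move: sth; clear; lra.
have -> : \sum_(k < n.+1 | ~~ in_window (n %/ r.+1) J k) kernel s r n k * W s r (n - k)
   = colouring_sum n (fun k => (B k)%:R * colour_weight s n k) / V s r.+1 n.
  rewrite (W_colour s n (fun k => (~~ in_window (n %/ r.+1) J k)%:R) r0) big_mkcond/=.
  by apply: eq_bigr => k _; case: ifP => _; rewrite ?mul1r ?mul0r.
rewrite ler_pdivrMr//; apply: le_trans T _; by rewrite ler_pM2r.
Qed.

(** At s = 0 the kernel is the binomial law, of total mass 1, concentrated in the
window. *)
Lemma wsum0_lim r (th : R) : (0 < r)%N ->
  wsum (0 : R) r x.1.1 x.2 @[x --> window_filter th] --> (1 : R).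
Proof.
move=> r0; apply/cvgrPdist_le => e e0; exists 1 => // eta /andP[eta0 _].
have [d d0 [N H]] := @outside_tail r 0 r0 ltac:(by rewrite lexx beta_crit_gt0) eta e eta0 e0.
exists 1 => //; exists N => n s J Nn _ _ /andP[eJ _] /=.
have := H n 0 J Nn (lexx 0); rewrite mul0r subrr normr0 => /(_ (ltW d0) eJ) T.
have E : W 0 r.+1 n = \sum_(k < n.+1) 1 * (kernel 0 r n k * W 0 r (n - k)) :> R.
  rewrite -(W_colour 0 n (fun=> 1) r0) /W /Z; congr (_ / _).
  by apply: eq_bigr => a _; rewrite mul1r.
rewrite W0// in E.
have {}E : 1 = wsum (0 : R) r n J +
    \sum_(k < n.+1 | ~~ in_window (n %/ r.+1) J k) kernel 0 r n k * W 0 r (n - k).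
  rewrite E (bigID (fun k : 'I_n.+1 => in_window (n %/ r.+1) J k))/=; congr (_ + _).
    by apply: eq_bigr => k _; rewrite W0// mulr1 mul1r.
  by apply: eq_bigr => k _; rewrite mul1r.
rewrite E addrAC subrr add0r ger0_norm//.
by apply: sumr_ge0 => k _; rewrite mulr_ge0 ?kernel_ge0 ?W_ge0.
Qed.

(** The tilt is exp (O(1/n)) at the centre, which is within 1 of n / r.+1. *)
Lemma height_ratio_lim r (th : R) : (0 < r)%N -> 0 <= th ->
  kernel x.1.2 r x.1.1 (x.1.1 %/ r.+1) / kernel 0 r x.1.1 (x.1.1 %/ r.+1)
     @[x --> window_filter th] --> (1 : R).
Proof.
move=> r0 th0; apply/cvgrPdist_le => e e0; exists 1 => // eta _; exists 1 => //.
pose A : R := r.+1%:R / r%:R.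
have A0 : 0 < A by rewrite divr_gt0 ?ltr0n.
have [N1 H1] := nat_above ((th + 1) * A).
have [N2 H2] := nat_above ((th + 1) * A / e).
exists (maxn 1 (maxn N1 N2)) => n s J; rewrite !geq_max.
move=> /and3P[n0 /H1{}H1 /H2{}H2] s0 sd _ /=.
have np : 0 < n%:R :> R by rewrite ltr0n.
have b0 : 0 < kernel 0 r n (n %/ r.+1) :> R by apply: kernel_gt0 => //; exact: leq_div.
set y := s / 2 * A * ((n %/ r.+1)%:R - n%:R / r.+1%:R) ^+ 2.
have -> : kernel s r n (n %/ r.+1) = kernel 0 r n (n %/ r.+1) * expR y.
  by rewrite /kernel !mul0r expR0 mulr1.
rewrite mulrAC divff ?gt_eqF// mul1r distrC.
have /andP[c1 c2] := center_bounds R n r.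
have y0 : 0 <= y by rewrite mulr_ge0 ?sqr_ge0// mulr_ge0 ?divr_ge0// ltW.
have sn : s <= (th + 1) / n%:R.
  by rewrite ler_pdivlMr//; move: sd; rewrite ler_norml => /andP[_]; lra.
have yb : y <= (th + 1) / n%:R * A / 2.
  have q : ((n %/ r.+1)%:R - n%:R / r.+1%:R) ^+ 2 <= 1 :> R.
    by move: c1 c2; clear; move: (_ - _) => z; nra.
  apply: le_trans (_ : s / 2 * A * 1 <= _).
    by apply: ler_wpM2l => //; rewrite mulr_ge0 ?divr_ge0// ltW.
  have : s * A <= (th + 1) / n%:R * A by rewrite ler_pM2r.
  by lra.
have z1 : (th + 1) / n%:R * A <= 1 by rewrite mulrAC ler_pdivrMr// mul1r.
have z2 : (th + 1) / n%:R * A <= e.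
  by rewrite mulrAC ler_pdivrMr// [leRHS]mulrC -ler_pdivrMr.
rewrite ger0_norm; last by rewrite subr_ge0 -expR0 ler_expR.
have := @expR_le_1D2x R y; move: y0 yb z1 z2; clear.
move: (expR y) (_ * A) => E z y0 yb z1 z2 /(_ ltac:(apply/andP; split; lra)); lra.
Qed.
End Tails.

(** * Limit of the normalised Potts partition function *)

Section WLimit.
Variable R : realType.
Local Notation wsum s r n J := (\sum_(k < n.+1 | in_window (n %/ r.+1) J k) kernel s r n k).

Lemma window_filter_large (th : R) : window_filter th [set x : nat * R * nat | (0 < x.1.1)%N].
Proof. by exists 1 => // eta _; exists 1 => //; exists 1%N. Qed.

(** Divide the limit of [wsum_height_lim] for s by the one for s = 0, where the window
sum tends to 1: the Gaussian constant and the central binomial term drop out. *)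
Lemma wsum_lim r (lam0 : R) : (0 < r)%N -> 0 <= lam0 < 1 ->
  wsum x.1.2 r x.1.1 x.2 @[x --> window_filter (lam0 * r.+1%:R)] --> (Num.sqrt (1 - lam0))^-1.
Proof.
move=> r0 l01; have [l0 l1] := andP l01.
have [G G0 HG] := wsum_height_lim R.
set F := window_filter _; have FF : Filter F by exact: window_filter_filter.
have c0 : 0 < r.+1%:R ^+ 2 / r%:R :> R by rewrite divr_gt0 ?exprn_gt0 ?ltr0n.
have c1 : 0 < 1 - lam0 by rewrite subr_gt0.
have La := HG r lam0 r0 l01.
have L0 : wsum 0 r x.1.1 x.2 / kernel 0 r x.1.1 (x.1.1 %/ r.+1) / Num.sqrt x.1.1%:R
     @[x --> F] --> G / Num.sqrt (r.+1%:R ^+ 2 / r%:R).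
  have := HG r 0 r0 ltac:(by rewrite lexx ltr01).
  rewrite mul0r subr0 mulr1 => /cvgrPdist_le H; apply/cvgrPdist_le => e e0.
  have [eta0 eta00 {}H] := H e e0; exists eta0 => // eta etab.
  have [d d0 [N {}H]] := H eta etab; exists 1 => //; exists N => n s J Nn _ _ Jb.
  by apply: (H n 0 J) => //; rewrite mul0r subrr normr0 ltW.
have th0 : 0 <= lam0 * r.+1%:R by rewrite mulr_ge0.
have Lh := height_ratio_lim r0 th0.
have Lw := @wsum0_lim R r (lam0 * r.+1%:R) r0.
have Gn0 : G / Num.sqrt (r.+1%:R ^+ 2 / r%:R) != 0.
  by rewrite mulf_neq0 ?invr_eq0 ?gt_eqF ?sqrtr_gt0.
have La0 := @cvgM _ _ F FF _ _ _ _ La (@cvgV _ _ F FF _ _ Gn0 L0).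
have L := @cvgM _ _ F FF _ _ _ _ (@cvgM _ _ F FF _ _ _ _ La0 Lh) Lw.
have -> : (Num.sqrt (1 - lam0))^-1 =
   G / Num.sqrt (r.+1%:R ^+ 2 / r%:R * (1 - lam0))
     / (G / Num.sqrt (r.+1%:R ^+ 2 / r%:R)) * 1 * 1.
  rewrite sqrtrM ?ltW// !mulr1 !invfM invrK.
  have /lt0r_neq0 : 0 < Num.sqrt (1 - lam0) by rewrite sqrtr_gt0.
  have /lt0r_neq0 : 0 < Num.sqrt (r.+1%:R ^+ 2 / r%:R) :> R by rewrite sqrtr_gt0.
  move: (Num.sqrt _) (Num.sqrt _) => a b b0 a0; field.
  by rewrite a0 b0 gt_eqF.
apply: cvg_eventually_eq L.
have W0 : \forall x \near F, 0 < wsum (0 : R) r x.1.1 x.2.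
  exact: (cvgr_gt 1 Lw 0 ltr01).
apply: filterS2 (window_filter_large (lam0 * r.+1%:R)) W0 => -[[n s] J] /= n0 w0.
have b0 : 0 < kernel 0 r n (n %/ r.+1) :> R by apply: kernel_gt0 => //; exact: leq_div.
have bs : 0 < kernel s r n (n %/ r.+1) :> R by apply: kernel_gt0 => //; exact: leq_div.
have q0 : 0 < Num.sqrt n%:R :> R by rewrite sqrtr_gt0 ltr0n.
move: w0 b0 bs q0 => /lt0r_neq0 + /lt0r_neq0 + /lt0r_neq0 + /lt0r_neq0.
rewrite /=.
move: (\sum_(k < n.+1 | _) kernel 0 r n k) (\sum_(k < n.+1 | _) kernel s r n k).
move: (kernel 0 r n _) (kernel s r n _) (Num.sqrt _).
move=> c d e a b a0 c0' d0 e0.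
by field; rewrite a0 c0' d0 e0.
Qed.

Lemma W_rec (s : R) r n : (0 < r)%N ->
  W s r.+1 n = \sum_(k < n.+1) kernel s r n k * W s r (n - k).
Proof.
move=> r0; have := W_colour s n (fun=> 1) r0.
under [RHS]eq_bigr do rewrite mul1r.
move=> <-; rewrite /W /Z; congr (_ / _).
by apply: eq_bigr => a _; rewrite mul1r.
Qed.

Lemma in_window_dist r n J k : in_window (n %/ r.+1) J k ->
  `|k%:R - n%:R / r.+1%:R| <= J%:R + 1 :> R.
Proof.
move=> /andP[k1 k2]; have /andP[c1 c2] := center_bounds R n r.
have : k%:R <= (n %/ r.+1)%:R + J%:R :> R by rewrite -natrD ler_nat ltnW.
have : (n %/ r.+1)%:R <= k%:R + J%:R :> R by rewrite -natrD ler_nat ltnW.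
move: c1 c2; clear; rewrite ler_norml.
move: (k%:R) (J%:R) (_%:R) (n%:R / _) => a b c d *; apply/andP; split; lra.
Qed.

(** By [W_rec], W for r.+1 colours is an average of W for r colours under the
kernel.  In the window, k is close to n / r.+1, so s (n - k) tends to
th r / r.+1, which has the same ratio to the number of colours as th does; every
induction step thus contributes the same factor. *)
Lemma W_lim r (th : R) : (0 < r)%N -> 0 <= th < beta_crit R r ->
  W x.2 r x.1 @[x --> scaling_filter th] --> (Num.sqrt (1 - th / r%:R))^-1 ^+ r.-1.
Proof.
elim: r th => // -[_ th _ _|r IH th _ /andP[th0 thb]].
  rewrite expr0; under eq_fun do rewrite W1; exact: cvg_cst.
set q := r.+1; have q0 : (0 < q)%N by [].
pose lam0 := th / q.+1%:R.
have q1 : 0 < q.+1%:R :> R by rewrite ltr0n.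
have qp : 0 < q%:R :> R by rewrite ltr0n.
have qE : q.+1%:R = q%:R + 1 :> R by rewrite natr1.
have lamE : lam0 * q.+1%:R = th by rewrite divfK ?gt_eqF.
have l01 : 0 <= lam0 < 1.
  rewrite divr_ge0//= ltr_pdivrMr// mul1r; apply: lt_le_trans thb _.
  exact: beta_crit_le.
have [l0 l1] := andP l01.
pose th' := th * q%:R / q.+1%:R.
have th'E : th' / q%:R = lam0 by rewrite /th' /lam0; field; rewrite !gt_eqF.
(* th' is the limit of s (n - k) in the window *)
have th'0 : 0 <= th' by rewrite divr_ge0// mulr_ge0.
have th'b : th' < beta_crit R q.
  rewrite ltr_pdivrMr//; have := @beta_crit_ratio R q q0; rewrite [beta_crit R q * _]mulrC.
  by apply: lt_trans; rewrite [X in _ < X]mulrC ltr_pM2r.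
have := IH th' q0; rewrite th'0 th'b => /(_ isT).
rewrite th'E; set om := _ ^+ r; set L := (Num.sqrt (1 - lam0))^-1 => IHl.
have -> : L ^+ r.+1 = om * L by rewrite exprSr.
have sq0 : 0 < Num.sqrt (1 - lam0) by rewrite sqrtr_gt0 subr_gt0.
have L0 : 0 < L by rewrite invr_gt0.
have om0 : 0 < om by rewrite exprn_gt0.
have Lw := wsum_lim q0 l01; rewrite lamE -/L in Lw.
apply/cvgrPdist_le => e e0.
pose e1 := e / (4 * (L + 1)).
pose e2 := Num.min (e / (4 * (om + 1))) 1.
have e10 : 0 < e1 by rewrite divr_gt0// mulr_gt0// addr_gt0.
have e20 : 0 < e2 by rewrite lt_min ltr01 andbT divr_gt0// mulr_gt0// addr_gt0.
have e40 : 0 < e / 4 by rewrite divr_gt0.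
move/cvgrPdist_le : IHl => /(_ e1 e10) [d1 d10 [N1 H1]].
move/cvgrPdist_le : Lw => /(_ e2 e20) [eta0 eta00 H2].
pose eta := Num.min eta0 (Num.min (1 / 12) (d1 / (6 * (th + 1)))).
have th1 : 0 < th + 1 by rewrite ltr_wpDl.
have etap : 0 < eta by rewrite !lt_min eta00 !divr_gt0//= mulr_gt0.
have etale : eta <= eta0 by rewrite ge_min lexx.
have eta12 : eta <= 1 / 12 by rewrite !ge_min lexx orbT.
have etad : eta * (6 * (th + 1)) <= d1.
  by rewrite -ler_pdivlMr ?mulr_gt0// !ge_min lexx !orbT.
have [|d2 d20 [N2 {}H2]] := H2 eta; first by rewrite etap.
have [|d3 d30 [N3 H3]] := @outside_tail R q th q0 _ eta (e / 4) etap e40.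
  by rewrite th0.
have [N4 H4] := nat_above eta^-1.
have [N5 H5] := nat_above (4 * N1%:R : R).
exists (Num.min (Num.min d2 d3) (Num.min (d1 / 2) 1)).
  by rewrite !lt_min d20 d30 divr_gt0//=.
exists (maxn (maxn N2 N3) (maxn N4 N5)) => n s; rewrite !geq_max.
move=> /andP[/andP[n2 n3] /andP[/H4{}H4 /H5{}H5]] s0.
rewrite !le_min => /andP[/andP[sd2 sd3] /andP[sd4 sd5]] /=.
have en : 1 <= eta * n%:R by rewrite -ler_pdivrMl// mulr1.
have np : 0 < n%:R :> R by rewrite -(pmulr_rgt0 _ etap) (lt_le_trans ltr01).
pose J := (Num.truncn (eta * n%:R)).+1.
have J1 : eta * n%:R <= J%:R by apply/ltW/truncnS_gt.
have J2 : J%:R <= 2 * eta * n%:R.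
  rewrite /J -natr1; apply: le_trans (_ : eta * n%:R + 1 <= _).
    by rewrite lerD2r truncn_le// ltW// mulr_gt0.
  by move: en; clear; rewrite -mulrA; move: (eta * _) => z; lra.
have {}H2 := H2 n s J n2 s0 sd2 (introT andP (conj J1 J2)).
have {}H3 := H3 n s J n3 s0 sd3 J1.
have in_win (k : nat) : (k <= n)%N -> in_window (n %/ q.+1) J k -> `|om - W s q (n - k)| <= e1.
  move=> kn /in_window_dist kw.
  have kw' : `|k%:R - n%:R / q.+1%:R| <= 3 * (eta * n%:R).
    apply: le_trans kw _; move: J2 en; rewrite -mulrA; clear.
    by move: (eta * _) (J%:R) => a b; lra.
  apply: (H1 (n - k)%N s) => //.
    rewrite -(ler_nat R) natrB//.
    have : n%:R / q.+1%:R <= n%:R / 2 :> R.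
      by rewrite ler_pM2l// lef_pV2 ?posrE// ler_nat.
    have : eta * n%:R <= 1 / 12 * n%:R by rewrite ler_pM2r.
    move: kw' H5; rewrite ler_norml => /andP[_]; clear.
    by move: (k%:R) (N1%:R) (n%:R) (n%:R / q.+1%:R) (eta * _) => a b c d f; lra.
  rewrite natrB//=.
  have -> : s * (n%:R - k%:R) - th' =
      (s * n%:R - th) * (q%:R / q.+1%:R) - s * (k%:R - n%:R / q.+1%:R).
    by rewrite /th' qE; field; move: qp; clear; lra.
  apply: le_trans (ler_normB _ _) _.
  have A1 : `|(s * n%:R - th) * (q%:R / q.+1%:R)| <= d1 / 2.
    rewrite normrM [X in _ * X]ger0_norm ?divr_ge0//; apply: le_trans sd4.
    by apply: ler_piMr => //; rewrite ler_pdivrMr// mul1r ler_nat.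
  have A2 : `|s * (k%:R - n%:R / q.+1%:R)| <= d1 / 2.
    rewrite normrM [X in X * _]ger0_norm//.
    apply: le_trans (_ : s * (3 * (eta * n%:R)) <= _); first by rewrite ler_wpM2l.
    have -> : s * (3 * (eta * n%:R)) = 3 * eta * (s * n%:R) by ring.
    apply: le_trans (_ : 3 * eta * (th + 1) <= _).
      apply: ler_wpM2l; first by rewrite mulr_ge0// ltW.
      by move: sd5; rewrite ler_norml => /andP[_]; clear; lra.
    by move: etad; clear; lra.
  by move: A1 A2; clear; lra.
rewrite W_rec// (bigID (fun k : 'I_n.+1 => in_window (n %/ q.+1) J k))/=.
move: H2 => /=; set S := \sum_(k < n.+1 | _) kernel s q n k => H2.
set T := \sum_(k < n.+1 | ~~ _) _ in H3 *; set U := \sum_(k < n.+1 | _) _.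
have T0 : 0 <= T by apply: sumr_ge0 => k _; rewrite mulr_ge0 ?kernel_ge0 ?W_ge0.
have D : `|om * S - U| <= e1 * S.
  rewrite /U /S !mulr_sumr -sumrB; apply: le_trans (ler_norm_sum _ _ _) _.
  apply: ler_sum => k kw; rewrite mulrC -mulrBr normrM ger0_norm ?kernel_ge0//.
  by rewrite [leRHS]mulrC ler_wpM2l ?kernel_ge0// in_win// -ltnS.
have S1 : S <= L + 1.
  have : e2 <= 1 by rewrite ge_min lexx orbT.
  by move: H2; rewrite ler_norml => /andP[]; clear; lra.
have D' : `|om * S - U| <= e / 4.
  apply: le_trans D _; apply: le_trans (_ : e1 * (L + 1) <= _); first by rewrite ler_pM2l.
  rewrite /e1; have L1 : L + 1 != 0 by rewrite gt_eqF// addr_gt0.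
  by rewrite le_eqVlt; apply/orP; left; apply/eqP; field.
have E : `|om * (L - S)| <= e / 4.
  rewrite normrM gtr0_norm//; apply: le_trans (_ : om * (e / (4 * (om + 1))) <= _).
    by rewrite ler_pM2l//; apply: le_trans H2 _; rewrite ge_min lexx.
  have o1 : 0 < om + 1 by rewrite addr_gt0.
  rewrite mulrA ler_pdivrMr ?mulr_gt0//.
  have -> : e / 4 * (4 * (om + 1)) = e * om + e by field.
  by rewrite mulrC lerDl ltW.
have -> : om * L - (U + T) = om * (L - S) + (om * S - U) - T by ring.
move: D' E H3 T0 e0; rewrite !ler_norml; clear.
move: (om * (L - S)) (om * S - U) => a b /andP[? ?] /andP[? ?] ? ? ?.
by apply/andP; split; lra.
Qed.
End WLimit.

(** * The Edwards-Sokal coupling *)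

Section EdwardsSokal.
Variables (R : realType) (n : nat).
Implicit Types (w : config n) (e : edge n).

Lemma adj_sym w : symmetric (adj w).
Proof.
by move=> x y; apply/existsP/existsP => -[e /andP[we /eqP ee]]; exists e;
  rewrite we ee finset.setUC eqxx.
Qed.

Lemma adj_csym w : connect_sym (adj w).
Proof. exact: sym_connect_sym (@adj_sym w). Qed.

Definition compatible q w (a : {ffun 'I_n -> 'I_q}) : bool :=
  [forall x, forall y, adj w x y ==> (a x == a y)].

Lemma compatibleP q w (a : {ffun 'I_n -> 'I_q}) :
  reflect (forall x y, connect (adj w) x y -> a x = a y) (compatible w a).
Proof.
apply: (iffP idP) => [/forallP H x y /connectP[p + ->]|H].
  elim: p x => //= z p IH x /andP[xz /IH <-].
  by have /forallP/(_ z)/implyP/(_ xz)/eqP := H x.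
apply/forallP => x; apply/forallP => y; apply/implyP => xy.
by apply/eqP/H/connect1.
Qed.

(** A compatible colouring is a colouring of the roots of the components. *)
Lemma card_compatible q w :
  #|[pred a : {ffun 'I_n -> 'I_q} | compatible w a]| = (q ^ ncomp w)%N.
Proof.
pose T := {x : 'I_n | roots (adj w) x}.
pose rt (x : 'I_n) : T := Sub (fingraph.root (adj w) x) (roots_root (@adj_csym w) x).
pose h (f : {ffun T -> 'I_q}) : {ffun 'I_n -> 'I_q} := [ffun x => f (rt x)].
have rtK (t : T) : rt (val t) = t.
  by apply: val_inj; rewrite /= (eqP (valP t)).
have h_inj : injective h.
  by move=> f g /ffunP fg; apply/ffunP => t; have := fg (val t); rewrite !ffunE rtK.
have -> : (q ^ ncomp w)%N = #|{ffun T -> 'I_q}|.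
  rewrite card_ffun card_ord card_sig /ncomp /n_comp_mem; congr (_ ^ _)%N.
  by apply: eq_card => x; rewrite !inE andbT.
rewrite -(card_codom h_inj); apply: eq_card => a; rewrite inE; apply/idP/codomP.
  move=> /compatibleP ca; exists [ffun t => a (val t)]; apply/ffunP => x; rewrite !ffunE.
  by apply: ca; exact: connect_root.
move=> [f ->]; apply/compatibleP => x y xy; rewrite !ffunE; congr (f _).
by apply: val_inj => /=; apply/eqP; rewrite root_connect//; exact: adj_csym.
Qed.

Definition edge_weight (p : R) w : R := \prod_(e : edge n) (p ^+ w e * (1 - p) ^+ (1 - w e)).

(** Edwards-Sokal weight of a configuration and a colouring that is constant on its
components. *)
Definition es_weight (p : R) q w (a : {ffun 'I_n -> 'I_q}) : R :=
  edge_weight p w * (compatible w a)%:R.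

Lemma edge_weight_ge0 p w : 0 <= p <= 1 -> 0 <= edge_weight p w.
Proof.
move=> /andP[p0 p1]; apply: prodr_ge0 => e _; apply: mulr_ge0; apply: exprn_ge0 => //.
by rewrite subr_ge0.
Qed.

Lemma es_weight_ge0 p q w (a : {ffun 'I_n -> 'I_q}) : 0 <= p <= 1 -> 0 <= es_weight p w a.
Proof. by move=> p01; rewrite mulr_ge0// edge_weight_ge0. Qed.

Lemma es_sum_colours p q w :
  \sum_(a : {ffun 'I_n -> 'I_q}) es_weight p w a = rc_weight p q%:R w.
Proof.
rewrite /es_weight -mulr_sumr /rc_weight -natrX -card_compatible; congr (_ * _).
rewrite -natr_sum; congr (_%:R); rewrite -sum1_card [RHS]big_mkcond/=.
by apply: eq_bigr => a _; rewrite inE; case: compatible.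
Qed.

Definition monochromatic q (a : {ffun 'I_n -> 'I_q}) e : bool :=
  [forall x in val e, forall y in val e, a x == a y].

Lemma edgeP e : exists x y, x != y /\ val e = [set x; y]%SET.
Proof. by have /cards2P[x [y [xy E]]] := valP e; exists x, y. Qed.

Lemma monochromatic2 q (a : {ffun 'I_n -> 'I_q}) e x y : val e = [set x; y]%SET ->
  monochromatic a e = (a x == a y).
Proof.
move=> ee; apply/idP/eqP => [/forall_inP/(_ x)|axy].
  by rewrite ee !inE eqxx => /(_ isT)/forall_inP/(_ y); rewrite !inE eqxx orbT => /(_ isT)/eqP.
apply/forall_inP => u; rewrite ee !inE => ux; apply/forall_inP => v; rewrite !inE => vx.
by case/orP: ux => /eqP->; case/orP: vx => /eqP->; rewrite ?axy.
Qed.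

Lemma compatible_edges q w (a : {ffun 'I_n -> 'I_q}) :
  compatible w a = [forall e, w e ==> monochromatic a e].
Proof.
apply/idP/forallP => [/forallP H e|H].
  apply/implyP => we; have [x [y [xy E]]] := edgeP e; rewrite (monochromatic2 a E).
  apply: (implyP (forallP (H x) y)).
  by apply/existsP; exists e; rewrite we E eqxx.
apply/forallP => x; apply/forallP => y; apply/implyP => /existsP[e /andP[we /eqP E]].
by have := H e; rewrite we (monochromatic2 a E).
Qed.

(** Given the colouring, monochromatic edges are free and contribute p + (1 - p),
whereas bichromatic edges are forced to be closed. *)
Lemma es_sum_configs p q (a : {ffun 'I_n -> 'I_q}) :
  \sum_w es_weight p w a = (1 - p) ^+ #|[pred e | ~~ monochromatic a e]|.
Proof.
pose F (e : edge n) (b : bool) : R :=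
  p ^+ b * (1 - p) ^+ (1 - b) * (b ==> monochromatic a e)%:R.
rewrite (eq_bigr (fun w : config n => \prod_e F e (w e))); last first.
  move=> w _; rewrite /F big_split/= /es_weight; congr (_ * _); rewrite compatible_edges.
  have [/forallP H|/forallPn[e He]] := boolP [forall e, w e ==> monochromatic a e].
    by rewrite big1// => e _; rewrite H.
  by rewrite (bigD1 e)//= (negbTE He) mul0r.
rewrite -bigA_distr_bigA/= -prodr_const [RHS]big_mkcond/=; apply: eq_bigr => e _.
rewrite big_bool /F/= inE expr0 !expr1 mul1r mulr1; case: (monochromatic a e) => /=.
  by rewrite ?mulr1 addrC subrK.
by rewrite mulr0 add0r mulr1.
Qed.

Lemma set2_eq (x y u v : 'I_n) : x != y ->
  ([set u; v]%SET == [set x; y]%SET) = ((u, v) == (x, y)) || ((u, v) == (y, x)).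
Proof.
move=> xy; apply/eqP/orP => [E|[/eqP[-> ->]//|/eqP[-> ->]]]; last exact: finset.setUC.
have := finset.set21 u v; have := finset.set22 u v; rewrite E !inE.
have := finset.set21 x y; have := finset.set22 x y; rewrite -E !inE !xpair_eqE.
do 4![case/orP => /eqP ?]; subst; rewrite ?eqxx/= ?orbT; try by [left|right].
all: by rewrite eqxx in xy.
Qed.

(** Count ordered pairs of vertices: each edge gives two pairs, and the
monochromatic pairs, including the diagonal, number sum_c k_c^2. *)
Lemma bichromatic_count q (a : {ffun 'I_n -> 'I_q}) :
  (#|[pred e : edge n | ~~ monochromatic a e]| * 2 + \sum_c colour_count a c ^ 2 = n ^ 2)%N.
Proof.
have two e : (\sum_(p : 'I_n * 'I_n) ([set p.1; p.2]%SET == val e) = 2)%N.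
  have [x [y [xy E]]] := edgeP e.
  rewrite (eq_bigr (fun p : 'I_n * 'I_n => (p == (x, y)) || (p == (y, x)) : nat)); last first.
    by move=> [u v] _; rewrite E set2_eq.
  rewrite -big_mkcond/= sum1_card.
  have -> : #|[pred p : 'I_n * 'I_n | (p == (x, y)) || (p == (y, x))]| = #|pred2 (x, y) (y, x)|.
    by apply: eq_card.
  by rewrite card2 xpair_eqE negb_and xy.
have -> : (#|[pred e : edge n | ~~ monochromatic a e]| * 2 =
    \sum_(p : 'I_n * 'I_n) (a p.1 != a p.2))%N.
  rewrite -sum1_card big_distrl/=.
  under eq_bigr => e _ do rewrite mul1n -(two e).
  rewrite exchange_big/=; apply: eq_bigr => -[u v] _ /=.
  have [auv|auv] := eqVneq (a u) (a v).
    rewrite big1// => e; rewrite inE => me; case: eqP => // E.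
    by rewrite (monochromatic2 a (esym E)) auv eqxx in me.
  have uv : #|[set u; v]%SET| == 2%N.
    by rewrite cards2; have -> : u != v by apply: contraNneq auv => ->.
  pose e0 : edge n := Sub [set u; v]%SET uv.
  have m0 : ~~ monochromatic a e0 by rewrite (@monochromatic2 q a e0 u v).
  rewrite (bigD1 e0)//= eqxx big1// => e /andP[_ ee]; case: eqP => // E.
  by move: ee; rewrite -val_eqE/= E eqxx.
have -> : (\sum_c colour_count a c ^ 2 = \sum_(p : 'I_n * 'I_n) (a p.1 == a p.2))%N.
  rewrite -(pair_bigA _ (fun u v => (a u == a v : nat)))/=.
  under eq_bigr => c _ do rewrite expnS expn1 {1}/colour_count big_distrl/=.
  rewrite exchange_big/=; apply: eq_bigr => u _.
  rewrite (bigD1 (a u))//= eqxx mul1n big1 ?addn0.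
    by apply: eq_bigr => v _; rewrite eq_sym.
  by move=> c; rewrite eq_sym => /negbTE->; rewrite mul0n.
rewrite -big_split/= (eq_bigr (fun=> 1%N)) => [|p _]; last by case: eqP.
by rewrite sum1_card card_prod card_ord expnS expn1.
Qed.

Lemma es_marginal (p s : R) q (a : {ffun 'I_n -> 'I_q}) : 1 - p = expR (- s) ->
  \sum_w es_weight p w a = colour_weight s n (colour_count a).
Proof.
move=> ps; rewrite es_sum_configs ps -expRM_natl /colour_weight; congr expR.
have := congr1 (fun k => k%:R : R) (bichromatic_count a).
rewrite natrD natrM natrX natr_sum /sumsq.
under eq_bigr do rewrite natrX.
by move=> <-; field.
Qed.

Lemma es_total (p s : R) q (F : ('I_q -> nat) -> R) : 1 - p = expR (- s) ->
  \sum_w \sum_(a : {ffun 'I_n -> 'I_q}) F (colour_count a) * es_weight p w a =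
  colouring_sum n (fun k => F k * colour_weight s n k).
Proof.
move=> ps; rewrite exchange_big/=; apply: eq_bigr => a _.
by rewrite -mulr_sumr (es_marginal a ps).
Qed.

Lemma rc_partitionE (p s : R) q : 1 - p = expR (- s) ->
  rc_partition n p q%:R = Z s q n.
Proof.
move=> ps; rewrite /rc_partition /Z.
under eq_bigr do rewrite -es_sum_colours.
rewrite exchange_big/=; apply: eq_bigr => a _; exact: es_marginal.
Qed.

Lemma rc_probE (p s : R) q (A : {set config n}) : 1 - p = expR (- s) ->
  rc_prob p q%:R A =
  (\sum_w \sum_(a : {ffun 'I_n -> 'I_q}) (w \in A)%:R * es_weight p w a) / Z s q n.
Proof.
move=> ps; rewrite /rc_prob -mulr_suml (rc_partitionE q ps); congr (_ / _).
rewrite big_mkcond/=; apply: eq_bigr => w _.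
rewrite -mulr_sumr es_sum_colours; case: ifP => _; by rewrite ?mul1r ?mul0r.
Qed.

Definition swap q (U : pred 'I_n) (c d : 'I_q) (a : {ffun 'I_n -> 'I_q}) :
  {ffun 'I_n -> 'I_q} := [ffun x => if U x then tperm c d (a x) else a x].

Lemma swapK q U (c d : 'I_q) : involutive (swap U c d).
Proof.
by move=> a; apply/ffunP => x; rewrite !ffunE; case: (U x); rewrite ?tpermK.
Qed.

Lemma swap_weight p q w (U : pred 'I_n) (c d : 'I_q) (a : {ffun 'I_n -> 'I_q}) :
  fingraph.closed (adj w) U -> es_weight p w (swap U c d a) = es_weight p w a.
Proof.
move=> cU; rewrite /es_weight; congr (_ * (_ : bool)%:R).
have H (b : {ffun 'I_n -> 'I_q}) : compatible w b -> compatible w (swap U c d b).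
  move=> /compatibleP cb; apply/compatibleP => x y xy; rewrite !ffunE.
  have := closed_connect cU xy; rewrite !unfold_in => ->.
  by rewrite (cb _ _ xy).
by apply/idP/idP => [/H|/H//]; rewrite swapK.
Qed.

Lemma swap_sum p q w (U : pred 'I_n) (c d : 'I_q) (f : {ffun 'I_n -> 'I_q} -> R) :
  fingraph.closed (adj w) U ->
  \sum_a f (swap U c d a) * es_weight p w a = \sum_a f a * es_weight p w a.
Proof.
move=> cU; rewrite [RHS](reindex_inj (inv_inj (swapK U c d)))/=.
by apply: eq_bigr => a _; rewrite swap_weight.
Qed.

(** Every compatible pair in P is sent into f by one of the weight-preserving involutions
indexed by I, so its total weight is at most #|I| times that of f. *)
Lemma swap_union_bound p q (I : finType) (P : config n -> {ffun 'I_n -> 'I_q} -> bool)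
   (f : {ffun 'I_n -> 'I_q} -> bool)
   (U : I -> config n -> pred 'I_n) (c d : I -> 'I_q) : 0 <= p <= 1 ->
  (forall i w, fingraph.closed (adj w) (U i w)) ->
  (forall w a, compatible w a -> P w a -> exists i, f (swap (U i w) (c i) (d i) a)) ->
  \sum_w \sum_a (P w a)%:R * es_weight p w a <=
    #|I|%:R * \sum_w \sum_a (f a)%:R * es_weight p w a.
Proof.
move=> p01 cU H; rewrite mulr_sumr; apply: ler_sum => w _.
have -> : #|I|%:R * (\sum_a (f a)%:R * es_weight p w a) =
  \sum_(i : I) \sum_a (f (swap (U i w) (c i) (d i) a))%:R * es_weight p w a.
  rewrite mulr_natl -sumr_const; apply: eq_bigr => i _.
  by rewrite (swap_sum p _ _ (fun a => (f a)%:R) (cU i w)).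
rewrite exchange_big/=; apply: ler_sum => a _; rewrite -mulr_suml.
have [ca|nca] := boolP (compatible w a); last by rewrite /es_weight (negbTE nca) !mulr0.
apply: ler_wpM2r; first exact: es_weight_ge0.
have [Pw|_] := boolP (P w a); last by apply: sumr_ge0.
have [i fi] := H w a ca Pw.
by rewrite (bigD1 i)//= fi lerDl sumr_ge0.
Qed.
End EdwardsSokal.

(** * Bad colour counts and recolouring *)

Section Phases.
Variable R : realType.

Definition bad_count n q (eps : R) (k : 'I_q -> nat) : bool :=
  `[< ~ near_disordered eps (freq R n k) /\ ~ exists j, near_ordered eps (freq R n k) j >].

Lemma spread_le1 r (x : 'I_r -> R) : (0 < r)%N -> (forall i, 0 <= x i) -> mass x = 1 ->
  spread x <= 1.
Proof.
move=> r0 x0 m1; rewrite /spread m1; apply: le_trans (_ : \sum_i x i ^+ 2 <= _).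
  by rewrite gerBl divr_ge0.
rewrite -[leRHS]m1 /mass; apply: ler_sum => i _.
have : x i <= 1 by rewrite -m1 /mass (bigD1 i)//= lerDl sumr_ge0.
by have := x0 i; nra.
Qed.

(** Every bad colour count has a deficit bounded below, and the exponential decay
absorbs the polynomial number of recolourings used later, here the factor n.+1. *)
Lemma bad_small q (eps eta : R) : (2 < q)%N -> 0 < eps -> 0 < eta ->
  exists2 tau : R, 0 < tau & exists N : nat, forall (n : nat) (s : R),
    (N <= n)%N -> 0 <= s -> `|s * n%:R - beta_crit R q| <= tau ->
    n.+1%:R * (colouring_sum n (fun k : 'I_q -> nat =>
      (bad_count n eps k)%:R * colour_weight s n k) / Z s q n) <= eta.
Proof.
move=> q2 eps0 eta0; have [d d0 H] := phase_gap q2 eps0.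
have q0 : (0 < q)%N by apply: leq_trans q2.
have d2 : 0 < d / 2 by rewrite divr_gt0.
have [N HN] := poly_exp_small q.+1 d2 eta0.
exists d => //; exists (maxn 1 N) => n s; rewrite geq_max => /andP[n0 /HN{}HN] s0 sd.
have V0 := @V_gt0 R s q n q0; have VZ := V_le_Z n q0 s0.
have Z0 := lt_le_trans V0 VZ.
have T : colouring_sum n (fun k : 'I_q -> nat =>
     (bad_count n eps k)%:R * colour_weight s n k) <=
   n.+1%:R ^+ q * expR (- n%:R * (d / 2)) * V s q n.
  apply: type_tail => // k kn /asboolP[nd no].
  have x0 i : 0 <= freq R n k i by rewrite divr_ge0.
  have m1 := mass_freq R n0 kn.
  have [L|L] := ltP (rel_entropy (freq R n k) - beta_crit R q / 2 * spread (freq R n k)) d.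
    by have [] := H _ x0 m1 L.
  have S0 := spread_ge0 (freq R n k) q0; have S1 := spread_le1 q0 x0 m1.
  move: sd; rewrite ler_norml => /andP[_ sd].
  have : (s * n%:R - beta_crit R q) * spread (freq R n k) <= d.
    apply: le_trans (_ : d * spread (freq R n k) <= _); first exact: ler_wpM2r.
    by rewrite ler_piMr// ltW.
  by rewrite /deficit; move: L; clear; lra.
apply: le_trans HN; rewrite exprS -mulrA; apply: ler_wpM2l => //.
rewrite ler_pdivrMr//; apply: le_trans T _; exact: ler_wpM2l.
Qed.

Lemma colour_count_swap_out n q (U : pred 'I_n) (c d e : 'I_q)
    (a : {ffun 'I_n -> 'I_q}) : e != c -> e != d ->
  colour_count (swap U c d a) e = colour_count a e.
Proof.
move=> ec ed; apply: eq_bigr => v _; rewrite ffunE; case: (U v) => //.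
have E : tperm c d e = e by rewrite tpermD// eq_sym.
by rewrite -{1}E (inj_eq perm_inj).
Qed.

Lemma colour_count_swap_in n q (U : pred 'I_n) (c d : 'I_q)
    (a : {ffun 'I_n -> 'I_q}) : c != d ->
  (forall v, U v -> a v = c) -> (colour_count (swap U c d a) c + #|U| = colour_count a c)%N.
Proof.
move=> cd Ua; rewrite /colour_count -sum1_card [X in (_ + X)%N]big_mkcond/= -big_split/=.
apply: eq_bigr => v _; rewrite ffunE unfold_in; have := Ua v.
case: (U v) => [/(_ isT)->|_]; last by rewrite addn0.
by rewrite tpermL eqxx eq_sym (negbTE cd).
Qed.

Lemma colour_count_diff n q (S : pred 'I_n) (a b : {ffun 'I_n -> 'I_q}) c :
  (forall v, ~~ S v -> a v = b v) -> (colour_count a c <= colour_count b c + #|S|)%N.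
Proof.
move=> H; rewrite /colour_count -sum1_card [X in (_ + X)%N]big_mkcond/= -big_split/=.
apply: leq_sum => v _; rewrite unfold_in; case: (boolP (S v)) => Sv.
  by case: (a v == c); rewrite ?addn1.
by rewrite H// addn0.
Qed.

Lemma two_others q (c : 'I_q) : (2 < q)%N -> exists d e : 'I_q,
  [/\ d != c, e != c & e != d].
Proof.
case: q c => // -[|[|q]] // c _.
have [c0|c0] := eqVneq c ord0.
  by exists (inord 1), (inord 2); rewrite c0 -!val_eqE/= !inordK.
have [c1|c1] := eqVneq c (inord 1).
  by exists ord0, (inord 2); rewrite c1 -!val_eqE/= !inordK.
by exists ord0, (inord 1); rewrite eq_sym c0 eq_sym c1 -!val_eqE/= !inordK.
Qed.

Section Deterministic.
Variables (n q : nat) (eps delta : R).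
Hypotheses (n0 : (0 < n)%N) (q2 : (2 < q)%N) (eps0 : 0 < eps) (epsd : 2 * eps < delta).
Hypothesis (epsq : 4 * eps <= q%:R^-1 - (q%:R * (q%:R - 1))^-1).
Let Q : R := q%:R.
Let fr (a : {ffun 'I_n -> 'I_q}) c := freq R n (colour_count a) c.

(** The frequencies 1/q, 1 - 1/q and 1/(q (q - 1)) that occur in the two kinds of
phases are at distance at least 4 eps from each other: the two smallest ones are the
closest. *)
Lemma gap_facts : [/\ 4 * eps <= 1 - q%:R^-1 - q%:R^-1, 0 < n%:R :> R &
  4 * eps <= 1 - q%:R^-1 - (q%:R * (q%:R - 1))^-1 :> R].
Proof.
have Q3 : 3 <= Q by rewrite ler_nat.
have n1 : 0 < n%:R :> R by rewrite ltr0n.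
have i0 : 0 < (q%:R * (q%:R - 1))^-1 :> R.
  by rewrite invr_gt0 mulr_gt0//; move: Q3; rewrite /Q; lra.
have i1 : q%:R^-1 <= 3^-1 :> R by rewrite lef_pV2 ?posrE//; move: Q3; rewrite /Q; lra.
move: epsq i0 i1; move: (q%:R^-1) ((_ * _)^-1) => u v ? ? ?.
by split => //; lra.
Qed.

(** Recolouring the giant removes a fraction delta from one colour, so the
new counts are not disordered.  A third colour keeps its frequency 1/q, which no
ordered count has. *)
Lemma giant_swap_bad (w : config n) (a : {ffun 'I_n -> 'I_q}) (x : 'I_n) :
  compatible w a -> near_disordered eps (fr a) -> delta * n%:R <= #|connect (adj w) x|%:R ->
  exists d : 'I_q, bad_count n eps (colour_count (swap (connect (adj w) x) (a x) d a)).
Proof.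
move=> ca nd gx; have [d [e [dc ec ed]]] := two_others (a x) q2.
have [g1 n1 g2] := gap_facts.
exists d; apply/asboolP; set a' := swap _ _ _ _.
have Uc v : connect (adj w) x v -> a v = a x.
  by move=> xv; rewrite -(compatibleP _ _ ca _ _ xv).
have k1 : (colour_count a' (a x) + #|connect (adj w) x| = colour_count a (a x))%N.
  by apply: colour_count_swap_in => //; rewrite eq_sym.
have k2 : colour_count a' e = colour_count a e by apply: colour_count_swap_out.
have F1 : freq R n (colour_count a') (a x) + delta <= fr a (a x).
  rewrite /fr /freq -k1 natrD mulrDl lerD2l ler_pdivlMr//.
have F2 : freq R n (colour_count a') e = fr a e by rewrite /freq k2.
have D1 := nd (a x); have D2 := nd e.
split.
  move=> /(_ (a x)); move: D1; rewrite !ler_norml => /andP[_ D1] /andP[D3 _].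
  by move: F1 D1 D3 epsd; lra.
move=> [j [j1 j2]].
have [ej|ej] := eqVneq e j.
  move: j1; rewrite -ej F2; move: D2; rewrite !ler_norml => /andP[_ A1] /andP[B1 _].
  by move: A1 B1 g1 eps0; lra.
move: (j2 e ej); rewrite F2; move: D2; rewrite !ler_norml => /andP[A1 _] /andP[_ B1].
by move: A1 B1 epsq eps0; lra.
Qed.

Hypothesis (deltaq : delta <= 1 - q%:R^-1 - q%:R^-1 - 3 * eps).

(** Unions of components, in the order of their roots, used to recolour the
components one after the other. *)
Definition root_below (w : config n) (t : nat) : pred 'I_n :=
  fun x => (fingraph.root (adj w) x < t)%N.

Lemma root_below_closed w t : fingraph.closed (adj w) (root_below w t).
Proof.
move=> x y xy; rewrite !unfold_in.
have /eqP-> // : fingraph.root (adj w) x == fingraph.root (adj w) y.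
by rewrite root_connect; [exact: connect1|exact: adj_csym].
Qed.

(** A discrete intermediate value theorem. *)
Lemma first_drop (g : nat -> R) (m : nat) (h st : R) : h <= g 0%N -> g m < h ->
  (forall t, g t - st <= g t.+1) -> exists2 t, (t <= m)%N & h - st <= g t < h.
Proof.
move=> g0 gm gs; have ex : exists t, g t < h by exists m.
case: (ex_minnP ex) => t gt tmin; exists t; first exact: tmin.
rewrite gt andbT; case: t gt tmin => [|t] gt tmin; first by move: gt; rewrite ltNge g0.
apply: le_trans (gs t); rewrite lerD2r leNgt; apply/negP => /tmin.
by rewrite ltnn.
Qed.

(** The frequency of j starts near 1 - 1/q and ends at the frequency of d, near
1/(q (q - 1)), in steps smaller than delta.  It therefore visits the interval of
length delta below 1 - 1/q - eps, which contains no frequency of an ordered or a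
disordered count. *)
Lemma ord_swap_bad (w : config n) (a : {ffun 'I_n -> 'I_q}) (j d : 'I_q) :
  d != j -> near_ordered eps (fr a) j ->
  (forall x, #|connect (adj w) x|%:R < delta * n%:R) ->
  exists t : 'I_n.+1, bad_count n eps (colour_count (swap (root_below w t) j d a)).
Proof.
move=> dj [a1 a2] small; have [g1 n1 g2] := gap_facts.
pose g t := freq R n (colour_count (swap (root_below w t) j d a)) j.
have [] := @first_drop g n (1 - q%:R^-1 - eps) delta.
- have -> : g 0%N = fr a j.
    by rewrite /g /fr; congr (freq R n (colour_count _) j); apply/ffunP => v; rewrite ffunE.
  by move: a1; rewrite ler_norml => /andP[]; lra.
- have -> : g n = fr a d.
    rewrite /g /fr /freq; congr (_%:R / _); apply: eq_bigr => v _.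
    by rewrite ffunE /root_below ltn_ord -[in RHS](inj_eq (@perm_inj _ (tperm j d))) tpermR.
  by have := a2 d dj; rewrite ler_norml => /andP[_]; move: g2 eps0; lra.
- move=> t; pose S : pred 'I_n := fun x => (fingraph.root (adj w) x == t :> nat).
  have K : (colour_count (swap (root_below w t) j d a) j <=
      colour_count (swap (root_below w t.+1) j d a) j + #|S|)%N.
    apply: colour_count_diff => v; rewrite /S => nv; rewrite !ffunE /root_below.
    by rewrite [in RHS]ltnS [in RHS]leq_eqVlt (negbTE nv).
  have cS : #|S|%:R <= delta * n%:R.
    have [/pred0P S0|] := boolP (pred0b S).
      by rewrite (eq_card0 S0) mulr_ge0// (le_trans _ (ltW epsd))// mulr_ge0// ltW.
    move=> /pred0Pn[x Sx]; apply: le_trans (ltW (small x)); rewrite ler_nat.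
    apply: subset_leq_card; apply/fintype.subsetP => y ry.
    have : connect (adj w) x y; last by [].
    rewrite -(root_connect (@adj_csym n w)); apply/eqP/val_inj => /=.
    by rewrite (eqP (Sx : S x)) (eqP (ry : S y)).
  rewrite /g /freq lerBlDr -ler_pdivlMr ?invr_gt0// invrK mulrDl divfK ?gt_eqF//.
  apply: le_trans
    (_ : (colour_count (swap (root_below w t.+1) j d a) j + #|S|)%:R <= _).
    by rewrite ler_nat.
  by rewrite natrD lerD2l.
move=> t tn /andP[t1 t2]; exists (inord t); rewrite inordK ?ltnS//.
apply/asboolP; rewrite -/(g t) in t1 t2 *; split.
  move=> /(_ j); rewrite -/(g t) ler_norml => /andP[_].
  by move: t1 deltaq eps0; lra.
move=> [i [i1 i2]]; have [ji|ji] := eqVneq j i.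
  by move: i1; rewrite -ji -/(g t) ler_norml => /andP[+ _]; move: t2; lra.
move: (i2 j ji); rewrite -/(g t) ler_norml => /andP[_].
move: t1 deltaq epsq eps0; move: (q%:R^-1) ((_ * _)^-1) => u v; lra.
Qed.
End Deterministic.
End Phases.

(** * Giant components and the two phases *)

Section Classification.
Variables (R : realType) (r n : nat) (eps : R).
Local Notation q := r.+1.

(** On counts that are not bad, the phase can be read off from a single colour.
Expressed in this way, the disordered phase and the phase ordered at colour 0 are
events about the size of one colour class, and can be matched by k -> n - k. *)
Definition in_dis (k : 'I_q -> nat) : bool := `|freq R n k ord0 - q%:R^-1| <= eps.
Definition in_ord (j : 'I_q) (k : 'I_q -> nat) : bool :=
  `|freq R n k j - (1 - q%:R^-1)| <= eps.

Hypotheses (n0 : (0 < n)%N) (q2 : (2 < q)%N) (eps0 : 0 < eps).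
Hypothesis (epsq : 4 * eps <= q%:R^-1 - (q%:R * (q%:R - 1))^-1).

Lemma windows_disjoint (x : R) : let a := q%:R^-1 in let b := 1 - q%:R^-1 in
  let c := (q%:R * (q%:R - 1))^-1 in
  [/\ ~~ ((`|x - a| <= eps) && (`|x - b| <= eps)),
      ~~ ((`|x - a| <= eps) && (`|x - c| <= eps)) &
      ~~ ((`|x - b| <= eps) && (`|x - c| <= eps))].
Proof.
have [g1 n1 g2] := gap_facts n0 q2 epsq.
move=> a b c; rewrite !ler_norml /b.
move: g1 g2 epsq eps0; rewrite -/a -/c; move: a c => u v g1 g2 g3 e0.
by split; apply/negP => /andP[/andP[x1 x2] /andP[x3 x4]]; lra.
Qed.

Lemma near_disordered_cases (k : 'I_q -> nat) : near_disordered eps (freq R n k) ->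
  in_dis k /\ forall j, in_ord j k = false.
Proof.
move=> nd; split; first exact: nd.
move=> j; have [/negbTE + _ _] := windows_disjoint (freq R n k j).
by rewrite (nd j).
Qed.

Lemma near_ordered_cases (k : 'I_q -> nat) j : near_ordered eps (freq R n k) j ->
  [/\ in_dis k = false, in_ord j k & forall i, i != j -> in_ord i k = false].
Proof.
move=> [j1 j2]; split => //.
- rewrite /in_dis; have [A B C] := windows_disjoint (freq R n k ord0).
  apply/negbTE/negP => h; have [E|E] := eqVneq ord0 j.
    by move: A; rewrite h /= E j1.
  by move: B; rewrite h /= (j2 _ E).
- move=> i ij; have [_ _ C] := windows_disjoint (freq R n k i).
  by apply/negbTE/negP => h; move: C; rewrite (j2 i ij) andbT -/(in_ord i k) h.
Qed.

Lemma not_badP (k : 'I_q -> nat) : ~~ bad_count n eps k ->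
  near_disordered eps (freq R n k) \/ exists j, near_ordered eps (freq R n k) j.
Proof.
move=> /asboolPn nb; have [|nd] := pselect (near_disordered eps (freq R n k)); first by left.
have [|no] := pselect (exists j, near_ordered eps (freq R n k) j); first by right.
by exfalso; apply: nb.
Qed.

Lemma ord_sum_bounds (k : 'I_q -> nat) :
  0 <= \sum_j (in_ord j k)%:R :> R /\ \sum_j (in_ord j k)%:R <= q%:R :> R.
Proof.
split; first exact: sumr_ge0.
rewrite -[X in _ <= X](_ : \sum_(j < q) 1 = _); last by rewrite sumr_const card_ord.
by apply: ler_sum => j _; rewrite lern1 leq_b1.
Qed.

Lemma ord_sum1 (k : 'I_q -> nat) j : near_ordered eps (freq R n k) j ->
  \sum_i (in_ord i k)%:R = 1 :> R.
Proof.
move=> /near_ordered_cases[_ h1 h2]; rewrite (bigD1 j)//= h1 big1 ?addr0// => i ij.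
by rewrite h2.
Qed.

Lemma ord_sum0 (k : 'I_q -> nat) : near_disordered eps (freq R n k) ->
  \sum_i (in_ord i k)%:R = 0 :> R.
Proof. by move=> /near_disordered_cases[_ h]; rewrite big1// => i _; rewrite h. Qed.

(** Counts that are not bad belong to exactly one phase. *)
Lemma partition_pointwise (k : 'I_q -> nat) :
  `|(in_dis k)%:R + \sum_j (in_ord j k)%:R - 1| <= q%:R * (bad_count n eps k)%:R :> R.
Proof.
have [b|nb] := boolP (bad_count n eps k).
  rewrite mulr1; have [s0 s1] := ord_sum_bounds k.
  have d0 : 0 <= (in_dis k)%:R :> R by rewrite ler0n.
  have d1 : (in_dis k)%:R <= 1 :> R by rewrite lern1 leq_b1.
  have : 1 <= q%:R :> R by rewrite ler1n.
  rewrite ler_norml; move: (\sum_j _) (_%:R) s0 s1 d0 d1 => S D *.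
  by apply/andP; split; lra.
rewrite mulr0; have [nd|[j no]] := not_badP nb.
  by have [-> _] := near_disordered_cases nd; rewrite ord_sum0// addr0 subrr normr0.
by have [-> _ _] := near_ordered_cases no; rewrite (ord_sum1 no) add0r subrr normr0.
Qed.

(** When the counts are not bad, having a giant and being ordered can only disagree in
the two situations made unlikely by [giant_swap_bad] and [ord_swap_bad]. *)
Lemma giant_pointwise (g : bool) (k : 'I_q -> nat) :
  `|g%:R - \sum_j (in_ord j k)%:R| <=
    (g && `[< near_disordered eps (freq R n k) >])%:R
    + \sum_j (`[< near_ordered eps (freq R n k) j >] && ~~ g)%:R
    + q%:R * (bad_count n eps k)%:R :> R.
Proof.
have S0 : 0 <= \sum_j (`[< near_ordered eps (freq R n k) j >] && ~~ g)%:R :> R.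
  exact: sumr_ge0.
have [b|nb] := boolP (bad_count n eps k).
  apply: le_trans (_ : q%:R * true%:R <= _); last by rewrite lerDr addr_ge0.
  have [s0 s1] := ord_sum_bounds k; rewrite mulr1.
  have : 1 <= q%:R :> R by rewrite ler1n.
  move: s0 s1; move: (\sum_j (in_ord _ _)%:R) => S s0 s1 q1.
  by case: g {S0}; rewrite ler_norml; apply/andP; split; rewrite ?mulr1n ?mulr0n; lra.
rewrite mulr0 addr0; have [nd|[j no]] := not_badP nb.
  rewrite ord_sum0// subr0 (asboolT nd) andbT ger0_norm//.
  by rewrite lerDl.
rewrite (ord_sum1 no); case: g S0 => /= S0; first by rewrite subrr normr0 addr_ge0.
rewrite sub0r normrN normr1 add0r (bigD1 j)//= (asboolT no)/= lerDl.
exact: sumr_ge0.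
Qed.
End Classification.

Section FiniteBound.
Variables (R : realType) (r n : nat) (eps delta p s : R).
Local Notation q := r.+1.
Hypotheses (n0 : (0 < n)%N) (q2 : (2 < q)%N) (eps0 : 0 < eps) (epsd : 2 * eps < delta).
Hypothesis (epsq : 4 * eps <= q%:R^-1 - (q%:R * (q%:R - 1))^-1).
Hypothesis (deltaq : delta <= 1 - q%:R^-1 - q%:R^-1 - 3 * eps).
Hypotheses (p01 : 0 <= p <= 1) (ps : 1 - p = expR (- s)).

Definition es_sum (f : config n -> {ffun 'I_n -> 'I_q} -> R) : R :=
  \sum_w \sum_a f w a * es_weight p w a.

Let bad : R := colouring_sum n (fun k : 'I_q -> nat =>
  (bad_count n eps k)%:R * colour_weight s n k).

Lemma es_sum_le f g : (forall w a, f w a <= g w a) -> es_sum f <= es_sum g.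
Proof.
move=> H; apply: ler_sum => w _; apply: ler_sum => a _.
by apply: ler_wpM2r => //; exact: es_weight_ge0.
Qed.

Lemma es_sumD f g : es_sum (fun w a => f w a + g w a) = es_sum f + es_sum g.
Proof.
rewrite /es_sum -big_split/=; apply: eq_bigr => w _; rewrite -big_split/=.
by apply: eq_bigr => a _; rewrite mulrDl.
Qed.

Lemma es_sumN f : es_sum (fun w a => - f w a) = - es_sum f.
Proof.
rewrite /es_sum -sumrN; apply: eq_bigr => w _; rewrite -sumrN.
by apply: eq_bigr => a _; rewrite mulNr.
Qed.

Lemma es_sumZ c f : es_sum (fun w a => c * f w a) = c * es_sum f.
Proof.
rewrite /es_sum mulr_sumr; apply: eq_bigr => w _; rewrite mulr_sumr.
by apply: eq_bigr => a _; rewrite mulrA.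
Qed.

Lemma es_sum_sum (I : finType) (f : I -> config n -> {ffun 'I_n -> 'I_q} -> R) :
  es_sum (fun w a => \sum_i f i w a) = \sum_i es_sum (f i).
Proof.
rewrite /es_sum [RHS]exchange_big/=; apply: eq_bigr => w _.
rewrite [RHS]exchange_big/=; apply: eq_bigr => a _; by rewrite mulr_suml.
Qed.

Lemma es_sum_norm f : `|es_sum f| <= es_sum (fun w a => `|f w a|).
Proof.
apply: le_trans (ler_norm_sum _ _ _) _; apply: ler_sum => w _.
apply: le_trans (ler_norm_sum _ _ _) _; apply: ler_sum => a _.
by rewrite normrM [X in _ * X]ger0_norm// es_weight_ge0.
Qed.

Lemma es_sum_count (F : ('I_q -> nat) -> R) :
  es_sum (fun w a => F (colour_count a)) = colouring_sum n (fun k => F k * colour_weight s n k).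
Proof. exact: es_total. Qed.

(** The recolourings of [giant_swap_bad] are indexed by a vertex of the giant and two
colours. *)
Lemma giant_dis_bound (G := has_component_ge n delta) :
  es_sum (fun w a =>
    ((w \in G) && `[< near_disordered eps (freq R n (colour_count a)) >])%:R) <=
  (n * q * q)%:R * bad.
Proof.
rewrite /bad -es_sum_count /es_sum.
have := @swap_union_bound R n p q ('I_n * 'I_q * 'I_q)%type
  (fun w a => (w \in G) && `[< near_disordered eps (freq R n (colour_count a)) >])
  (fun a => bad_count n eps (colour_count a)) (fun i w => connect (adj w) i.1.1)
  (fun i => i.1.2) (fun i => i.2) p01.
rewrite !card_prod !card_ord; apply.
  by move=> i w x y xy; exact: (same_connect_r (@adj_csym n w) (connect1 xy) i.1.1).
move=> w a ca /andP[]; rewrite inE => /existsP[x gx] /asboolP nd.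
have [d bd] := giant_swap_bad n0 q2 eps0 epsd epsq ca nd gx.
by exists (x, a x, d).
Qed.

(** The recolourings of [ord_swap_bad] are indexed by a bound on the roots. *)
Lemma ord_nogiant_bound (G := has_component_ge n delta) (j : 'I_q) :
  es_sum (fun w a =>
    (`[< near_ordered eps (freq R n (colour_count a)) j >] && (w \notin G))%:R) <=
  n.+1%:R * bad.
Proof.
have [d [_ [dj _ _]]] := two_others j q2.
rewrite /bad -es_sum_count /es_sum.
have := @swap_union_bound R n p q 'I_n.+1
  (fun w a => `[< near_ordered eps (freq R n (colour_count a)) j >] && (w \notin G))
  (fun a => bad_count n eps (colour_count a)) (fun t w => root_below w t)
  (fun i => j) (fun i => d) p01.
rewrite card_ord; apply; first by move=> t w; exact: root_below_closed.
move=> w a _ /andP[/asboolP no]; rewrite inE => /existsPn ng.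
have small x : #|connect (adj w) x|%:R < delta * n%:R by rewrite ltNge.
exact: (ord_swap_bad n0 q2 eps0 epsd epsq deltaq dj no small).
Qed.

Let Zn := Z s q n.
Let x := colouring_sum n (fun k : 'I_q -> nat =>
  (in_dis n eps k)%:R * colour_weight s n k) / Zn.
Let y := colouring_sum n (fun k : 'I_q -> nat =>
  (in_ord n eps ord0 k)%:R * colour_weight s n k) / Zn.

(** Permuting the colours preserves the Potts weight. *)
Lemma ord_symmetric j :
  colouring_sum n (fun k : 'I_q -> nat => (in_ord n eps j k)%:R * colour_weight s n k) =
  colouring_sum n (fun k : 'I_q -> nat => (in_ord n eps ord0 k)%:R * colour_weight s n k).
Proof.
pose h (a : {ffun 'I_n -> 'I_q}) : {ffun 'I_n -> 'I_q} := [ffun v => tperm ord0 j (a v)].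
have hK : involutive h by move=> a; apply/ffunP => v; rewrite !ffunE tpermK.
rewrite /colouring_sum (reindex_inj (inv_inj hK))/=; apply: eq_bigr => a _.
have K c : colour_count (h a) c = colour_count a (tperm ord0 j c).
  apply: eq_bigr => v _; rewrite ffunE.
  by rewrite -[in RHS](inj_eq (@perm_inj _ (tperm ord0 j))) tpermK.
congr (_%:R * expR (_ * (_ - _))).
  by rewrite /in_ord /freq K tpermR.
rewrite /sumsq (reindex_inj (@perm_inj _ (tperm ord0 j)))/=.
by apply: eq_bigr => c _; rewrite K tpermK.
Qed.

Lemma finite_bounds : let b := n.+1%:R * (bad / Zn) in
  `|rc_prob p q%:R (has_component_ge n delta) - q%:R * y| <= (q%:R * q%:R + 2 * q%:R) * b
  /\ `|x + q%:R * y - 1| <= q%:R * b.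
Proof.
have Z0 : 0 < Zn.
  rewrite /Zn /Z /colouring_sum (bigD1 [ffun=> ord0])//= ltr_pwDl ?expR_gt0// sumr_ge0// => a _.
  exact: expR_ge0.
have b0 : 0 <= bad by apply: colouring_sum_ge0 => k; rewrite mulr_ge0 ?expR_ge0.
have ZE : es_sum (fun _ _ => 1) = Zn.
  by rewrite (es_sum_count (fun=> 1)) colouring_sumZ mul1r.
have yE j : es_sum (fun w a => (in_ord n eps j (colour_count a))%:R) = y * Zn.
  by rewrite (es_sum_count (fun k => (in_ord n eps j k)%:R)) ord_symmetric /y divfK// gt_eqF.
have xE : es_sum (fun w a => (in_dis n eps (colour_count a))%:R) = x * Zn.
  by rewrite (es_sum_count (fun k => (in_dis n eps k)%:R)) /x divfK// gt_eqF.
have badE : es_sum (fun w a => (bad_count n eps (colour_count a))%:R) = bad.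
  exact: (es_sum_count (fun k => (bad_count n eps k)%:R)).
set G := has_component_ge n delta.
have n1 : 1 <= n.+1%:R :> R by rewrite ler1n.
have q1 : 1 <= q%:R :> R by rewrite ler1n.
have sumyE : es_sum (fun w a => \sum_j (in_ord n eps j (colour_count a))%:R) = q%:R * y * Zn.
  rewrite es_sum_sum (eq_bigr (fun=> y * Zn)) => [|j _]; last exact: yE.
  by rewrite sumr_const card_ord -[LHS]mulr_natl mulrA.
have bZ0 : 0 <= bad / Zn by rewrite divr_ge0// ltW.
split.
- rewrite (rc_probE q G ps) -/Zn -[q%:R * y](mulfK (lt0r_neq0 Z0)) -mulrBl normrM.
  rewrite [X in _ * X]ger0_norm; last by rewrite invr_ge0 ltW.
  rewrite -sumyE.
  rewrite [X in _ <= X]mulrA [X in _ <= X]mulrA ler_pM2r ?invr_gt0//.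
  rewrite -/(es_sum (fun w a => (w \in G)%:R)) -es_sumN -es_sumD.
  apply: le_trans (es_sum_norm _) _.
  apply: le_trans (es_sum_le (fun w a =>
    giant_pointwise n0 q2 eps0 epsq (w \in G) (colour_count a))) _.
  rewrite !es_sumD es_sumZ es_sum_sum badE.
  have A := giant_dis_bound; rewrite -/G in A.
  have B : \sum_(j < q) es_sum (fun w a =>
       (`[< near_ordered eps (freq R n (colour_count a)) j >] && (w \notin G))%:R)
     <= q%:R * n.+1%:R * bad.
    apply: le_trans (_ : \sum_(j < q) n.+1%:R * bad <= _).
      by apply: ler_sum => j _; exact: ord_nogiant_bound.
    by rewrite sumr_const card_ord -[leLHS]mulr_natl mulrA.
  apply: le_trans (_ : (n * q * q)%:R * bad + q%:R * n.+1%:R * bad + q%:R * bad <= _).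
    by apply: lerD => //; exact: lerD.
  rewrite -!mulrDl ler_wpM2r// !natrM.
  have : n%:R <= n.+1%:R :> R by rewrite ler_nat.
  move: n1 q1; move: (n.+1%:R) (q%:R) (n%:R) => N Q M N1 Q1 MN.
  by nra.
- have -> : x + q%:R * y - 1 = es_sum (fun w a => (in_dis n eps (colour_count a))%:R
      + \sum_j (in_ord n eps j (colour_count a))%:R - 1) / Zn.
    rewrite !es_sumD es_sumN ZE xE sumyE; field; exact: lt0r_neq0.
  rewrite normrM [X in _ * X]ger0_norm; last by rewrite invr_ge0 ltW.
  rewrite ler_pdivrMr//.
  apply: le_trans (es_sum_norm _) _.
  apply: le_trans (es_sum_le (fun w a =>
    partition_pointwise n0 q2 eps0 epsq (colour_count a))) _.
  rewrite es_sumZ badE -!mulrA ler_wpM2l// mulrCA mulVf ?lt0r_neq0// mulr1.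
  by rewrite ler_peMr.
Qed.
End FiniteBound.

(** * Ratio of the ordered and the disordered phase *)

Section Mirror.
Variables (R : realType) (r n : nat) (eps s L e : R).
Local Notation q := r.+1.
Hypothesis (n0 : (0 < n)%N).

Lemma in_dis_terms :
  colouring_sum n (fun k : 'I_q -> nat => (in_dis n eps k)%:R * colour_weight s n k) =
  \sum_(k < n.+1) (`|k%:R / n%:R - q%:R^-1| <= eps)%R%:R *
     ('C(n, k)%:R * expR (- s * (k%:R * (n - k)%:R)) * Z s r (n - k)).
Proof.
by rewrite -(Z_colour s r n (fun k : nat => (`|k%:R / n%:R - q%:R^-1| <= eps)%R%:R)).
Qed.

(** Colour 0 with a class of size n - k has the same binomial factor and the same
number of bichromatic pairs as with a class of size k. *)
Lemma in_ord_terms :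
  colouring_sum n (fun k : 'I_q -> nat =>
    (in_ord n eps ord0 k)%:R * colour_weight s n k) =
  \sum_(k < n.+1) (`|k%:R / n%:R - q%:R^-1| <= eps)%R%:R *
     ('C(n, k)%:R * expR (- s * (k%:R * (n - k)%:R)) * Z s r k).
Proof.
pose G (k : nat) : R := (`|k%:R / n%:R - (1 - q%:R^-1)| <= eps)%R%:R.
rewrite -[LHS]/(colouring_sum n (fun k : 'I_q -> nat =>
  G (k ord0) * colour_weight s n k)) Z_colour /G.
rewrite (reindex_inj rev_ord_inj)/=; apply: eq_bigr => k _.
have kn : (k <= n)%N by rewrite -ltnS.
rewrite subSS subKn// bin_sub// [(n - k)%:R * k%:R]mulrC; congr (_%:R * _).
have nn : n%:R != 0 :> R by rewrite pnatr_eq0 -lt0n.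
rewrite natrB// mulrBl divff//.
by rewrite -normrN; congr (`|_| <= _); ring.
Qed.

Lemma mirror_bound : (forall k : nat, (k <= n)%N -> `|k%:R / n%:R - q%:R^-1| <= eps ->
     `|Z s r k - L * Z s r (n - k)| <= e * Z s r (n - k)) ->
  forall x y,
  x = colouring_sum n (fun k : 'I_q -> nat =>
    (in_dis n eps k)%:R * colour_weight s n k) ->
  y = colouring_sum n (fun k : 'I_q -> nat =>
    (in_ord n eps ord0 k)%:R * colour_weight s n k) ->
  `|y - L * x| <= e * x.
Proof.
move=> H x y -> ->; rewrite in_dis_terms in_ord_terms !mulr_sumr -sumrB.
apply: le_trans (ler_norm_sum _ _ _) _; apply: ler_sum => k _.
have kn : (k <= n)%N by rewrite -ltnS.
set c := 'C(n, k)%:R * expR _.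
have c0 : 0 <= c by rewrite mulr_ge0 ?expR_ge0.
have [h|h] := boolP (`|k%:R / n%:R - q%:R^-1| <= eps); last first.
  by rewrite !mul0r !mulr0 subrr normr0.
rewrite !mul1r (mulrCA L) -mulrBr normrM ger0_norm// (mulrCA e).
by apply: ler_wpM2l => //; exact: H.
Qed.

Lemma in_dis_le :
  colouring_sum n (fun k : 'I_q -> nat => (in_dis n eps k)%:R * colour_weight s n k)
  <= Z s q n.
Proof.
apply: ler_sum => a _; rewrite -[leRHS]mul1r ler_wpM2r ?expR_ge0//.
by rewrite lern1 leq_b1.
Qed.
End Mirror.

Section RatioLimit.
Variables (R : realType) (r : nat).
Local Notation q := r.+1.

(** Pairs (n, k) with n -> oo and k / n -> 1/q. *)
Definition fraction_filter : set_system (nat * nat) :=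
  [set P | exists2 eps0 : R, 0 < eps0 & exists N : nat, forall n k : nat,
    (N <= n)%N -> (k <= n)%N -> `|k%:R / n%:R - q%:R^-1 : R| <= eps0 -> P (n, k)].

Global Instance fraction_filter_filter : Filter fraction_filter.
Proof.
split.
- by exists 1 => //; exists 0%N.
- move=> P Q [e1 e10 [N1 H1]] [e2 e20 [N2 H2]].
  exists (Num.min e1 e2); first by rewrite lt_min e10.
  exists (maxn N1 N2) => n k; rewrite geq_max => /andP[n1 n2] kn.
  by rewrite le_min => /andP[k1 k2]; split; [exact: H1|exact: H2].
- move=> P Q PQ [e e0 [N H]].
  by exists e => //; exists N => n k *; apply: PQ; exact: H.
Qed.

Lemma fraction_filter_seq (u : nat -> R) (l : R) :
  u n @[n --> \oo] --> l -> u x.1 @[x --> fraction_filter] --> l.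
Proof.
move=> /cvgrPdist_le H; apply/cvgrPdist_le => e e0; have [N _ HN] := H e e0.
by exists 1 => //; exists N => n k Nn _ _; exact: HN.
Qed.

Lemma fraction_filter_freq : (x.2%:R / x.1%:R : R) @[x --> fraction_filter] --> (q%:R^-1 : R).
Proof.
apply/cvgrPdist_le => e e0; exists e => //; exists 0%N => n k _ _.
by rewrite distrC.
Qed.

Lemma fraction_filter_comp (g : nat * nat -> nat) (s : nat -> R) (th : R)
    (f : nat * R -> R) (l : R) :
  (forall N : nat, fraction_filter [set x | (N <= g x)%N]) ->
  fraction_filter [set x | 0 <= s x.1] ->
  s x.1 * (g x)%:R @[x --> fraction_filter] --> th -> f @ scaling_filter th --> l ->
  f (g x, s x.1) @[x --> fraction_filter] --> l.
Proof.
move=> gN s0 /cvgrPdist_le sg /cvgrPdist_le fl; apply/cvgrPdist_le => e e0.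
have [d d0 [N H]] := fl e e0.
apply: filterS3 (gN N) s0 (sg d d0) => x /= g1 s1 sd.
by apply: H => //; rewrite distrC.
Qed.

Hypothesis q2 : (2 < q)%N.

Lemma fraction_filter_bounds : fraction_filter [set x : nat * nat |
   (0 < x.1)%N /\ x.1%:R / (2 * q%:R) <= x.2%:R :> R /\
   x.1%:R / (2 * q%:R) <= (x.1 - x.2)%:R :> R /\ (x.2 <= x.1)%N].
Proof.
have q3 : 3 <= q%:R :> R by rewrite ler_nat.
have qi : 0 < q%:R^-1 :> R by rewrite invr_gt0.
exists (q%:R^-1 / 2); first by rewrite divr_gt0.
exists 1%N => n k n0 kn /=; rewrite ler_norml => /andP[k1 k2].
have np : 0 < n%:R :> R by rewrite ltr0n.
have qi3 : q%:R^-1 <= 3^-1 :> R by rewrite lef_pV2 ?posrE.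
have E : k%:R = k%:R / n%:R * n%:R :> R by rewrite divfK// gt_eqF.
have F : n%:R / (2 * q%:R) = q%:R^-1 / 2 * n%:R :> R by rewrite invfM; ring.
split => //; rewrite natrB// F E; move: k1 k2 qi qi3.
move: (k%:R / n%:R) (q%:R^-1) => u v k1 k2 qi qi3; split; first by rewrite ler_pM2r//; lra.
split => //.
have -> : n%:R - u * n%:R = (1 - u) * n%:R by ring.
by rewrite ler_pM2r//; lra.
Qed.

Lemma fraction_filter_large (N : nat) :
  fraction_filter [set x : nat * nat | (N <= x.2)%N /\ (N <= x.1 - x.2)%N].
Proof.
have [M HM] := nat_above (N%:R * (2 * q%:R) : R).
have LM : fraction_filter [set x : nat * nat | (M <= x.1)%N] by exists 1 => //; exists M.
apply: filterS2 LM fraction_filter_bounds => -[n k] /= /HM Mn [n0 [k1 [k2 _]]].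
by split; rewrite -(ler_nat R); [apply: le_trans k1|apply: le_trans k2];
  rewrite ler_pdivlMr// mulr_gt0.
Qed.

Let b : R := beta_c R q.
(** The exponential is the limit of the ratio of the two [V]; the powers are the
limits of the two [W]. *)
Definition mirror_ratio (Gam : R) : R :=
  expR ((1 - 2 / q%:R) * Gam * ((1 - r%:R^-1) / 2)) *
  ((Num.sqrt (1 - b / q%:R / r%:R))^-1 ^+ r.-1 / (Num.sqrt (1 - b / q%:R))^-1 ^+ r.-1).

(** After removal of one colour class, both phases leave a subcritical model with
r colours: s k -> b / q and s (n - k) -> b - b / q, both below the critical value
for r colours. *)
Lemma crit_facts : [/\ 0 < b, b < q%:R, b / q%:R < beta_crit R r & b - b / q%:R < beta_crit R r].
Proof.
have bE : b = beta_crit R q by rewrite /beta_crit leqNgt q2.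
have qp : 0 < q%:R :> R by [].
have b0 : 0 < b by rewrite bE beta_crit_gt0.
have bq : b < q%:R by rewrite bE beta_crit_lt.
have r0 : (0 < r)%N by case: r q2.
have r2 : 2 <= r%:R :> R by rewrite ler_nat.
have rE : q%:R = r%:R + 1 :> R by rewrite natr1.
have D : b - b / q%:R < beta_crit R r.
  have := @beta_crit_ratio R r r0; rewrite -bE => h.
  have -> : b - b / q%:R = r%:R * b / q%:R by rewrite rE; field; lra.
  by rewrite ltr_pdivrMr// [ltRHS]mulrC.
split => //; apply: lt_trans D.
rewrite ltrBrDr; have -> : b / q%:R + b / q%:R = b * (2 / q%:R) by ring.
by rewrite gtr_pMr// ltr_pdivrMr// rE; lra.
Qed.

(** At s n = b the leading factors V(k) and V(n - k) are equal, because
ln r = (b / 2) (1 - 1/r) makes the entropy of r ^ (2 k - n) compensate the energy.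
What remains is the effect of n (s n - b) -> Gam and the ratio of the two [W]. *)
Lemma ratio_limit (s : nat -> R) (Gam : R) :
  (\forall n \near \oo, 0 <= s n) ->
  (fun n => n%:R * (s n * n%:R - b)) @ \oo --> Gam ->
  Z (s x.1) r x.2 / Z (s x.1) r (x.1 - x.2) @[x --> fraction_filter] --> mirror_ratio Gam.
Proof.
move=> s0 sG; have [b0 bq th1 th2] := crit_facts.
have r0 : (0 < r)%N by case: r q2.
have r2 : 2 <= r%:R :> R by rewrite ler_nat.
have rE : q%:R = r%:R + 1 :> R by rewrite natr1.
have FF : Filter fraction_filter by exact: fraction_filter_filter.
have sG' := fraction_filter_seq sG.
have s0' : fraction_filter [set x | 0 <= s x.1].
  by have [N _ HN] := s0; exists 1 => //; exists N => n k Nn _ _; exact: HN.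
have inv0 : (x.1%:R : R)^-1 @[x --> fraction_filter] --> (0 : R).
  by apply: (@fraction_filter_seq (fun n => n%:R^-1)); exact: inv_nat_cvg0.
have sn : s x.1 * x.1%:R @[x --> fraction_filter] --> b.
  have L := @cvgD _ _ _ fraction_filter FF _ _ _ _
    (@cvgM _ _ fraction_filter FF _ _ _ _ sG' inv0)
    (cvg_cst b : (fun=> b) x @[x --> fraction_filter] --> b).
  rewrite mulr0 add0r in L; apply: cvg_eventually_eq (L FF).
  apply: filterS fraction_filter_bounds => -[n k] /= [n0 _].
  have nn : n%:R != 0 :> R by rewrite pnatr_eq0 -lt0n.
  by change (n%:R * (s n * n%:R - b) * n%:R^-1 + b = s n * n%:R); field.
have sk : s x.1 * x.2%:R @[x --> fraction_filter] --> b / q%:R.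
  have L := @cvgM _ _ fraction_filter FF _ _ _ _ sn fraction_filter_freq.
  apply: cvg_eventually_eq L.
  apply: filterS fraction_filter_bounds => -[n k] /= [n0 _].
  have nn : n%:R != 0 :> R by rewrite pnatr_eq0 -lt0n.
  by change (s n * n%:R * (k%:R / n%:R) = s n * k%:R); field.
have snk : s x.1 * (x.1 - x.2)%:R @[x --> fraction_filter] --> b - b / q%:R.
  have L := @cvgB _ _ _ fraction_filter FF _ _ _ _ sn sk.
  apply: cvg_eventually_eq L.
  apply: filterS fraction_filter_bounds => -[n k] /= [n0 [_ [_ kn]]].
  by change (s n * n%:R - s n * k%:R = s n * (n - k)%:R); rewrite natrB// mulrBr.
have t1 : 0 <= b / q%:R < beta_crit R r by rewrite th1 andbT divr_ge0// ltW.
have t2 : 0 <= b - b / q%:R < beta_crit R r.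
  rewrite th2 andbT subr_ge0 ler_pdivrMr// ler_peMr ?ltW//; move: rE r2; lra.
have kl1 N : fraction_filter [set x : nat * nat | (N <= x.2)%N].
  by apply: filterS (fraction_filter_large N) => x [].
have kl2 N : fraction_filter [set x : nat * nat | (N <= x.1 - x.2)%N].
  by apply: filterS (fraction_filter_large N) => x [].
have W1 := fraction_filter_comp kl1 s0' sk (W_lim r0 t1).
have W2 := fraction_filter_comp (g := fun x => (x.1 - x.2)%N) kl2 s0' snk (W_lim r0 t2).
have E2 : (b - b / q%:R) / r%:R = b / q%:R by rewrite rE; field; lra.
rewrite E2 in W2.
have w0 : (Num.sqrt (1 - b / q%:R))^-1 ^+ r.-1 != 0 :> R.
  by rewrite gt_eqF// exprn_gt0// invr_gt0 sqrtr_gt0 subr_gt0 ltr_pdivrMr// mul1r.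
have V1 : expR ((1 - 2 * (x.2%:R / x.1%:R)) * (x.1%:R * (s x.1 * x.1%:R - b))
     * ((1 - r%:R^-1) / 2))
   @[x --> fraction_filter] --> expR ((1 - 2 / q%:R) * Gam * ((1 - r%:R^-1) / 2)).
  apply: continuous_cvg; first exact: continuous_expR.
  apply: (@cvgM _ _ fraction_filter FF); last exact: cvg_cst.
  apply: (@cvgM _ _ fraction_filter FF) => //.
  apply: (@cvgB _ _ _ fraction_filter FF); first exact: cvg_cst.
  by apply: (@cvgM _ _ fraction_filter FF); [exact: cvg_cst|exact: fraction_filter_freq].
have W12 := @cvgM _ _ fraction_filter FF _ _ _ _ W1
  (@cvgV _ _ fraction_filter FF _ _ w0 W2).
have L := @cvgM _ _ fraction_filter FF _ _ _ _ V1 W12.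
apply: cvg_eventually_eq L.
apply: filterS2 s0' fraction_filter_bounds => -[n k] /= sn0 [n0 [_ [_ kn]]].
set A := expR _.
have E : V (s n) r k = A * V (s n) r (n - k).
  have powE m : r%:R ^+ m = expR (m%:R * ln r%:R) :> R.
    by rewrite expRM_natl lnK// posrE; lra.
  rewrite /V !powE -!expRD; congr expR.
  have nn : n%:R != 0 :> R by rewrite pnatr_eq0 -lt0n.
  have -> : ln r%:R = b / 2 * (1 - r%:R^-1) :> R.
    have q1 : q%:R - 1 = r%:R :> R by rewrite rE addrK.
    have q2' : q%:R - 2 = r%:R - 1 :> R by rewrite rE; ring.
    by rewrite /b /beta_c q1 q2'; move: r2; move: (ln _) => l r2; field; lra.
  rewrite natrB//; move: (r%:R^-1) => ri; field; exact: nn.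
have V0 : V (s n) r (n - k) != 0 by rewrite gt_eqF// V_gt0.
have A0 : A != 0 by rewrite gt_eqF// expR_gt0.
have Z0 : Z (s n) r (n - k) != 0.
  by rewrite gt_eqF// (lt_le_trans _ (V_le_Z _ r0 sn0))// V_gt0.
change (A * (W (s n) r k * (W (s n) r (n - k))^-1) = Z (s n) r k / Z (s n) r (n - k)).
rewrite /W E; clear E; clearbody A; move: V0 Z0.
move: (Z _ _ k) (Z _ _ (n - k)) (V _ _ _) => a c d V0 Z0.
by field; rewrite V0 Z0 A0.
Qed.
End RatioLimit.

Section EdgeProbability.
Variable R : realType.

Lemma neg_ln_bounds (p : R) : 0 <= p <= 2^-1 ->
  p + p ^+ 2 / 2 <= - ln (1 - p) <= p + p ^+ 2 / 2 + p ^+ 3.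
Proof.
move=> /andP[]; rewrite le_eqVlt => /predU1P[<- _|p0 p2].
  by rewrite subr0 ln1 !expr0n/= mul0r !addr0 oppr0 lexx.
have dl (x : R) : 0 <= x <= p -> is_derive x 1 (fun y => - ln (1 - y)) ((1 - x)^-1).
  move=> /andP[x0 xp]; have x1 : 0 < 1 - x by lra.
  by apply: is_derive_eq; [der => // | field; rewrite gt_eqF].
have dq (x : R) : is_derive x 1 (fun y => y + y ^+ 2 / 2) (1 + x).
  by apply: (is_derive_eq (derD (der_id x) (derM (derX2 (der_id x)) (der_cst 2^-1 x)))); field.
have dc (x : R) : is_derive x 1 (fun y => y ^+ 2 * y) (3 * x ^+ 2).
  by apply: (is_derive_eq (derM (derX2 (der_id x)) (der_id x))); ring.
have e3 : p ^+ 3 = p ^+ 2 * p by rewrite exprSr.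
have l1 : ln (1 - 0) = 0 :> R by rewrite subr0 ln1.
apply/andP; split; apply: ltW.
- have := @gt0_derive_lt R (fun y => - ln (1 - y) - (y + y ^+ 2 / 2))
    (fun x => (1 - x)^-1 - (1 + x)) 0 p p0.
  rewrite l1 !expr0n/= mul0r !(addr0, oppr0) subr_gt0; apply.
    by move=> x xp; exact: (derB (dl x xp) (dq x)).
  move=> x /andP[x0 xp]; have x1 : 0 < 1 - x by lra.
  by rewrite subr_gt0 -[_^-1]mul1r ltr_pdivlMr//; nra.
- have := @gt0_derive_lt R (fun y => y + y ^+ 2 / 2 + y ^+ 2 * y - - ln (1 - y))
    (fun x => 1 + x + 3 * x ^+ 2 - (1 - x)^-1) 0 p p0.
  rewrite l1 !expr0n/= !mul0r !(addr0, oppr0) e3 subr_gt0; apply.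
    by move=> x xp; exact: (derB (derD (dq x) (dc x)) (dl x xp)).
  move=> x /andP[x0 xp]; have x1 : 0 < 1 - x by lra.
  by rewrite subr_gt0 -[_^-1]mul1r ltr_pdivrMr//; nra.
Qed.

(** The expansion - ln (1 - p) = p + p^2 / 2 + O(p^3) turns the second order term
gamma of p into gamma + b^2 / 2. *)
Lemma s_limit (p : nat -> R) (b gam : R) :
  (forall n : nat, 0 <= p n <= 1) ->
  (fun n : nat => p n - (b / n%:R + gam / n%:R ^+ 2))
    =o_\oo (fun n : nat => (n%:R ^+ 2)^-1 : R) ->
  let s n := - ln (1 - p n) in
  [/\ \forall n \near \oo, 0 <= s n, \forall n \near \oo, 1 - p n = expR (- s n) &
    (fun n => n%:R * (s n * n%:R - b)) @ \oo --> gam + b ^+ 2 / 2].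
Proof.
move=> p01 /eqoP po s.
have inv0 : ((n%:R : R)^-1) @[n --> \oo] --> (0 : R) by exact: inv_nat_cvg0.
(* A is the rescaled remainder of the expansion of p; it tends to 0. *)
pose A n := n%:R ^+ 2 * (p n - (b / n%:R + gam / n%:R ^+ 2)).
have pos : \forall n \near \oo, (0 < n)%N by exists 1%N.
have A0 : A n @[n --> \oo] --> (0 : R).
  apply/cvgrPdist_le => e e0; apply: filterS2 pos (po e e0) => n n0.
  have n2 : 0 < n%:R ^+ 2 :> R by rewrite exprn_gt0// ltr0n.
  rewrite [`|_ ^- 2|]ger0_norm; last by rewrite invr_ge0 ltW.
  move=> h.
  by rewrite sub0r normrN /A normrM gtr0_norm// mulrC -ler_pdivlMr.
have np : n%:R * p n @[n --> \oo] --> b.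
  have : b + gam * n%:R^-1 + A n * n%:R^-1 @[n --> \oo] --> b + gam * 0 + 0 * 0.
    apply: cvgD; last exact: cvgM.
    by apply: cvgD; [exact: cvg_cst|apply: cvgM => //; exact: cvg_cst].
  rewrite !mulr0 !addr0; apply: cvg_eventually_eq.
  apply: filterS pos => n n0; have nn : n%:R != 0 :> R by rewrite pnatr_eq0 -lt0n.
  by rewrite /A; field.
have p0 : p n @[n --> \oo] --> (0 : R).
  have : n%:R * p n * n%:R^-1 @[n --> \oo] --> b * 0 by exact: cvgM.
  rewrite mulr0; apply: cvg_eventually_eq.
  apply: filterS pos => n n0; have nn : n%:R != 0 :> R by rewrite pnatr_eq0 -lt0n.
  by field.
have phalf : \forall n \near \oo, p n <= 2^-1.
  by apply: filterS (cvgr_lt 0 p0 2^-1 _) => [n|]; [exact: ltW|rewrite invr_gt0].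
have sb : \forall n \near \oo, p n + p n ^+ 2 / 2 <= s n <= p n + p n ^+ 2 / 2 + p n ^+ 3.
  apply: filterS phalf => n ph; apply: neg_ln_bounds.
  by have /andP[-> _] := p01 n.
split.
- apply: filterS sb => n /andP[h _]; apply: le_trans h.
  by have /andP[h _] := p01 n; rewrite addr_ge0// divr_ge0// exprn_ge0.
- apply: filterS phalf => n ph; rewrite /s opprK lnK// posrE.
  by move: ph; lra.
have X : A n + gam + (n%:R * p n) ^+ 2 / 2 @[n --> \oo] --> gam + b ^+ 2 / 2.
  rewrite -[gam + _]add0r addrA; apply: cvgD.
    by apply: cvgD => //; exact: cvg_cst.
  by apply: cvgM; [rewrite expr2; apply: cvgM|exact: cvg_cst].
have Y : A n + gam + (n%:R * p n) ^+ 2 / 2 + (n%:R * p n) ^+ 2 * p n @[n --> \oo]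
    --> gam + b ^+ 2 / 2.
  rewrite -[_ + b ^+ 2 / 2]addr0; apply: cvgD => //.
  rewrite -(mulr0 (b ^+ 2)); apply: cvgM => //.
  by rewrite expr2; apply: cvgM.
apply: squeeze_cvgr X Y; apply: filterS2 pos sb => n n0 /andP[h1 h2].
have nn : n%:R != 0 :> R by rewrite pnatr_eq0 -lt0n.
have n2 : 0 < n%:R ^+ 2 :> R by rewrite exprn_gt0// ltr0n.
have E : n%:R * (s n * n%:R - b) = n%:R ^+ 2 * s n - n%:R * b by ring.
have AE : A n + gam = n%:R ^+ 2 * p n - n%:R * b by rewrite /A; field.
have -> : A n + gam + (n%:R * p n) ^+ 2 / 2 = n%:R ^+ 2 * (p n + p n ^+ 2 / 2) - n%:R * b.
  by rewrite AE; field.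
have -> : n%:R ^+ 2 * (p n + p n ^+ 2 / 2) - n%:R * b + (n%:R * p n) ^+ 2 * p n =
  n%:R ^+ 2 * (p n + p n ^+ 2 / 2 + p n ^+ 3) - n%:R * b by ring.
by rewrite E !lerD2r !ler_pM2l// h1.
Qed.
End EdgeProbability.

(** * The limit of the giant-component probability *)

(** Since P(giant) is close to q y with x + q y = 1 and y = L x, the limit is
q L / (1 + q L). *)
Lemma giant_limitE (R : realType) (r : nat) (gamma : R) : (2 < r.+1)%N ->
  let L := mirror_ratio r (gamma + beta_c R r.+1 ^+ 2 / 2) in
  0 < L /\ giant_limit r.+1 gamma = r.+1%:R * L / (1 + r.+1%:R * L).
Proof.
move=> q2; have [b0 bq th1 th2] := @crit_facts R r q2.
set b := beta_c R r.+1 in b0 bq th1 th2 *.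
have r2 : 2 <= r%:R :> R by rewrite ler_nat.
have rE : r.+1%:R = r%:R + 1 :> R by rewrite natr1.
set Q : R := r.+1%:R; have Q0 : 0 < Q by rewrite ltr0n.
have rp : 0 < r%:R :> R by move: r2; lra.
have bQ : b / Q < 1 by rewrite ltr_pdivrMr// mul1r.
have bQ0 : 0 < b / Q by rewrite divr_gt0.
have c0 : 0 < 1 - b / Q by rewrite subr_gt0.
have d0 : 0 < 1 - b / Q / r%:R.
  by rewrite subr_gt0 ltr_pdivrMr// mul1r; apply: lt_le_trans bQ _; move: r2; lra.
move=> L.
have LE : L = expR ((b ^+ 2 / 4 + gamma / 2) * ((Q - 2) ^+ 2 / (Q * (Q - 1))))
   * (((1 - b / Q) / (1 - b / Q / r%:R)) `^ (- (2 - Q) / 2)).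
  rewrite /L /mirror_ratio -/b -/Q; congr (expR _ * _).
    by rewrite /Q rE; field; rewrite addrK !gt_eqF// ltr_wpDr.
  set u := 1 - b / Q; set v := 1 - b / Q / r%:R.
  have uv0 : 0 <= u / v by rewrite divr_ge0// ltW.
  have -> : - (2 - Q) / 2 = 2^-1 * r.-1%:R.
    have r0 : (0 < r)%N by rewrite -(ltr_nat R).
    rewrite -subn1 natrB//.
    by rewrite /Q rE; field.
  rewrite powRrM powR12_sqrt// powR_mulrn ?sqrtr_ge0//.
  rewrite sqrtrM; last exact: ltW.
  rewrite sqrtrV; last exact: ltW.
  by rewrite exprMn !exprVn invrK mulrC.
have L0 : 0 < L.
  by rewrite LE; apply: mulr_gt0; [exact: expR_gt0|apply: powR_gt0; exact: divr_gt0].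
split=> //; rewrite /giant_limit -/b -/Q.
have -> : b / (Q * (Q - 1)) = b / Q / r%:R.
  by rewrite invfM mulrA; congr (_ / _); rewrite /Q rE addrK.
have E : 1 / Q * ((1 - b / Q) / (1 - b / Q / r%:R)) `^ ((2 - Q) / 2)
   * expR (- ((b ^+ 2 / 4 + gamma / 2) * ((Q - 2) ^+ 2 / (Q * (Q - 1))))) = (Q * L)^-1.
  rewrite LE expRN mulNr powRN !invfM invrK mul1r -!mulrA; congr (_ * _).
  by rewrite mulrC.
rewrite E; field.
by rewrite !gt_eqF//= addr_gt0// mulr_gt0.
Qed.

Theorem corollary3p8 (R : realType) (q : nat) (p : nat -> R) (gamma : R) :
  (2 < q)%N ->
  (forall n : nat, 0 <= p n <= 1) ->
  (fun n : nat => p n - (beta_c R q / n%:R + gamma / n%:R ^+ 2))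
    =o_\oo (fun n : nat => (n%:R ^+ 2)^-1 : R) ->
  exists2 delta0 : R, 0 < delta0 &
    forall delta : R, 0 < delta <= delta0 ->
      (fun n : nat =>
         rc_prob (p n) q%:R (has_component_ge n delta))
        @ \oo --> giant_limit q gamma.
Proof.
case: q => // r q2 p01 po; have r0 : (0 < r)%N := @ltnW 1 r q2.
set Q : R := r.+1%:R; set b := beta_c R r.+1 in po.
have Q3 : 3 <= Q by rewrite ler_nat.
have Q0 : 0 < Q by apply: lt_le_trans Q3.
have Qi3 : Q^-1 <= 3^-1 by rewrite lef_pV2 ?posrE.
have Qi0 : 0 < Q^-1 by rewrite invr_gt0.
have QQ : 0 < Q^-1 - (Q * (Q - 1))^-1.
  have Q1 : 1 < Q - 1 by move: Q3; lra.
  by rewrite invfM subr_gt0 gtr_pMr// invf_lt1// (lt_trans ltr01).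
have gap0 : 0 < 1 - Q^-1 - Q^-1 by move: Qi3; move: (Q^-1) => u; lra.
(* Half the distance between the frequencies 1/q and 1 - 1/q of the largest colour
   in the two phases. *)
exists ((1 - Q^-1 - Q^-1) / 2); first by rewrite divr_gt0.
move=> delta /andP[delta0 deltab].
have [s0 ps sG] := s_limit p01 po.
set s := fun n => - ln (1 - p n) in s0 ps sG.
have [L0 ->] := @giant_limitE R r gamma q2.
have := ratio_limit q2 s0 sG; rewrite -/b.
set L := mirror_ratio r _ in L0 *.
move=> /cvgrPdist_le HL; apply/cvgrPdist_le => e e0.
(* The errors L x - y and eta enter the final estimate with the factors Q and
   Q * Q + 3 * Q. *)
pose e1 := e / (4 * Q).
have e10 : 0 < e1 by rewrite divr_gt0// mulr_gt0.
have [eps0 eps00 [N1 H1]] := HL e1 e10.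
(* In order: the ratio estimate holds within eps of 1/q, a window is narrower than
   delta, the three windows are separated, and a gap of length delta remains between
   the windows at 1/q and 1 - 1/q. *)
pose eps := Num.min eps0 (Num.min (delta / 4) (Num.min ((Q^-1 - (Q * (Q - 1))^-1) / 4)
   ((1 - Q^-1 - Q^-1) / 8))).
have epsp : 0 < eps.
  by rewrite !lt_min eps00 !divr_gt0.
have le1 : eps <= eps0 by rewrite ge_min lexx.
have le2 : eps <= delta / 4 by rewrite !ge_min lexx orbT.
have le3 : eps <= (Q^-1 - (Q * (Q - 1))^-1) / 4 by rewrite !ge_min lexx !orbT.
have le4 : eps <= (1 - Q^-1 - Q^-1) / 8 by rewrite !ge_min lexx !orbT.
have epsd : 2 * eps < delta by move: le2 delta0; lra.
have epsq : 4 * eps <= Q^-1 - (Q * (Q - 1))^-1 by rewrite mulrC -ler_pdivlMr.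
have deltaq : delta <= 1 - Q^-1 - Q^-1 - 3 * eps by move: le4 deltab; move: (Q^-1) => u; lra.
pose eta := e / (4 * (Q * Q + 3 * Q)).
have eta0 : 0 < eta by rewrite divr_gt0// mulr_gt0// addr_gt0// mulr_gt0.
have [tau tau0 [N2 H2]] := bad_small q2 epsp eta0.
have Nl (N : nat) : \forall n \near \oo, (N <= n)%N by exists N.
have sn : \forall n \near \oo, `|s n * n%:R - b| <= tau.
  have : n%:R * (s n * n%:R - b) * (n%:R : R)^-1 @[n --> \oo] --> (gamma + b ^+ 2 / 2) * 0.
    by apply: cvgM => //; exact: inv_nat_cvg0.
  rewrite mulr0 => /cvgrPdist_le/(_ tau tau0) h.
  apply: filterS2 (Nl 1%N) h => n n0.
  by rewrite sub0r normrN mulrAC divff ?mul1r// pnatr_eq0 -lt0n.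
apply: filterS2 (filterI (Nl (maxn 1 (maxn N1 N2))) sn) (filterI s0 ps).
move=> n [Nn snb] [sn0 psn].
move: Nn; rewrite !geq_max => /and3P[n0 n1 n2].
have bE : beta_crit R r.+1 = b by rewrite /beta_crit leqNgt q2.
have B := H2 n (s n) n2 sn0 _; rewrite bE in B; have {}B := B snb.
have [F1 F2] := finite_bounds n0 q2 epsp epsd epsq deltaq (p01 n) psn.
set bad := colouring_sum n _ / _ in B F1 F2; set Zn := Z (s n) r.+1 n in F1 F2.
set x := colouring_sum n _ / Zn in F2; set y := colouring_sum n _ / Zn in F1 F2.
have Z0 : 0 < Zn by rewrite (lt_le_trans _ (V_le_Z _ (ltn0Sn r) sn0))// V_gt0.
have xy : `|y - L * x| <= e1.
  have M : `|y * Zn - L * (x * Zn)| <= e1 * (x * Zn).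
    apply: (@mirror_bound R r n eps (s n) L e1 n0); rewrite ?divfK ?gt_eqF//.
    move=> k kn kq; have /= := H1 n k n1 kn (le_trans kq le1).
    have z0 : 0 < Z (s n) r (n - k).
      by rewrite (lt_le_trans _ (V_le_Z _ r0 sn0))// V_gt0.
    move=> h; rewrite -(ler_pM2r z0) in h; apply: le_trans h.
    have -> : Z (s n) r k - L * Z (s n) r (n - k) =
        - ((L - Z (s n) r k / Z (s n) r (n - k)) * Z (s n) r (n - k)).
      by rewrite mulrBl divfK ?gt_eqF// opprB.
    by rewrite normrN normrM (gtr0_norm z0).
  have D : x <= 1 by rewrite ler_pdivrMr// mul1r in_dis_le.
  rewrite -(ler_pM2r Z0) -[X in _ * X <= _](gtr0_norm Z0) -normrM.
  have -> : (y - L * x) * Zn = y * Zn - L * (x * Zn) by ring.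
  apply: le_trans M _.
  by rewrite ler_pM2l// ler_piMl// ltW.
have nq : 1 + r%:R = Q :> R by rewrite addrC natr1.
set P := rc_prob _ _ _ in F1 *.
have QL0 : 0 < Q * L by rewrite mulr_gt0.
have QL1 : 0 < 1 + Q * L by rewrite addr_gt0.
(* Q L / (1 + Q L) is Q y for the exact solution of x + Q y = 1 and y = L x. *)
have D : `|Q * y - Q * L / (1 + Q * L)| <= Q * eta + Q * e1.
  have -> : Q * y - Q * L / (1 + Q * L) =
    (Q * L / (1 + Q * L)) * (x + Q * y - 1) + (Q / (1 + Q * L)) * (y - L * x).
    by field; rewrite nq gt_eqF.
  have g0 : 0 <= Q * L / (1 + Q * L) by rewrite divr_ge0// ltW.
  have g1 : 0 <= Q / (1 + Q * L) by rewrite divr_ge0// ltW.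
  apply: le_trans (ler_normD _ _) _; apply: lerD.
    rewrite normrM (ger0_norm g0) -[leRHS]mul1r; apply: ler_pM => //.
      by rewrite ler_pdivrMr// mul1r lerDr.
    by apply: le_trans F2 _; rewrite ler_pM2l.
  rewrite normrM (ger0_norm g1); apply: ler_pM => //; rewrite ler_pdivrMr//.
  by apply: ler_peMr; rewrite ?lerDl ltW.
have D2 : `|P - Q * y| <= (Q * Q + 2 * Q) * eta.
  by apply: le_trans F1 _; rewrite ler_pM2l// addr_gt0 ?mulr_gt0.
have E1 : Q * e1 = e / 4 by rewrite /e1; field; rewrite nq gt_eqF.
have E2 : (Q * Q + 2 * Q) * eta + Q * eta = e / 4.
  rewrite -mulrDl /eta; field.
  by rewrite nq gt_eqF// addr_gt0// mulr_gt0.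
rewrite distrC; have -> : P - Q * L / (1 + Q * L) =
    (P - Q * y) + (Q * y - Q * L / (1 + Q * L)) by ring.
apply: le_trans (ler_normD _ _) _.
by move: D D2 E1 E2 e0; lra.
Qed.
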